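(* Let $R$ be a rational map of degree $d\ge2$ and let $A\subset\overline{\mathbb{C}}$ be a completely invariant (for $R$) measurable set of positive Lebesgue measure. Assume that $A$ does not support a non-zero invariant Beltrami differential of $R$. Then the Ruelle representation of the semigroup $\mathcal{S}(D(R))$ on $L_1(A)$ (defined in the context) is left amenable.
   Context: $L_1(A)$ is taken with respect to planar Lebesgue measure $Leb$, and regarded as the functions in $L_1(\overline{\mathbb{C}})$ vanishing off $A$; completely invariant means $R^{-1}(A)=A$ up to Lebesgue measure zero. The Ruelle operator is $R_*(\phi)(y)=\sum_{R(x)=y}\frac{\phi(x)}{(R'(x))^2}$, acting on $L_1(A)$. An invariant Beltrami differential of $R$ is $\mu\in L_\infty(\overline{\mathbb{C}})$ with $\mu(R)\frac{\overline{R'}}{R'}=\mu$ a.e.; it is supported on $A$ if $\mu=0$ a.e. off $A$. Full deck group. Fix an analytic arc $\sigma\subset\overline{\mathbb{C}}$ containing all critical values of $R$. Let $U=\overline{\mathbb{C}}\setminus\sigma$; then $R^{-1}(U)=\bigcup_{i=1}^{d}D_i$ with $D_i$ disjoint, simply connected, and $R_i=R|_{D_i}:D_i\to U$ a holomorphic homeomorphism. Define $h_{i,j}$ to be $R_j^{-1}\circ R_i$ on $D_i$, $R_i^{-1}\circ R_j$ on $D_j$, and the identity elsewhere ($h_{i,i}=Id$). $D(R)$ is the group generated by the $h_{i,j}$ (maps defined up to measure zero); $R\circ\gamma=R$ a.e. for $\gamma\in D(R)$. It acts on $L_1$ by $\gamma_*(f)=f(\gamma)(\gamma')^2$. For $\gamma\in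 D(R)$ put $R_\gamma=\gamma\circ R\circ\gamma^{-1}=\gamma\circ R$, and let $\mathcal{S}(D(R))$ be the semigroup generated under composition by $\{R_\gamma:\gamma\in D(R)\}$. The Ruelle representation $\rho:\mathcal{S}(D(R))\to End(L_1(A))$ is the homomorphism given on generators by $\rho(R_\gamma)=\gamma_*\circ R_*$. Left amenability of a representation. For a semigroup $S$, $L_\infty(S)$ is the space of bounded complex functions on $S$ with the sup norm; a mean is a continuous linear functional $M$ with $M(\phi)\ge0$ for $\phi\ge0$ and $\|M\|=M(\chi_S)=1$; $l_s(\phi)(x)=\phi(sx)$. For a bounded homomorphism $\rho:S\to End(B)$, $B$ a Banach space, let $f_{(b,b^* )}(s)=b^*(\rho(s)(b))$ for $(b,b^* )\in B\times B^*$, $Y_\rho$ the closed linear span of these functions in $L_\infty(S)$ and $X_\rho$ the space generated by $Y_\rho$ and constants. $\rho$ is left amenable if there is a mean $M$ on $L_\infty(S)$ with $M(l_s\phi)=M(\phi)$ for all $\phi\in X_\rho$, $s\in S$. *)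

(* Defs.v *)
From HB Require Import structures.
From mathcomp Require Import all_boot all_order all_algebra.
From mathcomp Require Import generic_quotient complex.
From mathcomp Require Import all_classical all_reals all_analysis measurable_realfun.

Set Implicit Arguments.
Unset Strict Implicit.
Unset Printing Implicit Defensive.

Import Order.TTheory GRing.Theory Num.Theory numFieldNormedType.Exports.
Local Open Scope classical_set_scope.
Local Open Scope ring_scope.
Local Open Scope quotient_scope.

(* Typing [R[i]] as a [numClosedFieldType] makes the generic norm, topology and
   derivative of number fields available: over [Cplx R] as scalar field,
   [derivable] and [derive1] are complex differentiability and derivative. *)
Definition Cplx (R : realType) : numClosedFieldType := R[i]%C.

Section Modulus.
Context {R : realType}.

Definition ofreal (x : R) : Cplx R := (x%:C)%C.
Definition reC (z : Cplx R) : R := complex.Re (z : R[i]%C).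
Definition imC (z : Cplx R) : R := complex.Im (z : R[i]%C).
Definition cabs (z : Cplx R) : R := reC `|z|.

Lemma cabsE z : `|z| = ofreal (cabs z).
Proof. by case: z. Qed.

Lemma ofreal_le x y : (ofreal x <= ofreal y) = (x <= y).
Proof. exact: lecR. Qed.

Lemma ofreal_inj : injective ofreal.
Proof. by move=> x y []. Qed.

Lemma cabs_sqrt z : cabs z = Num.sqrt (reC z ^+ 2 + imC z ^+ 2).
Proof. by case: z. Qed.

Lemma cabs_ge0 z : 0 <= cabs z.
Proof. by rewrite cabs_sqrt sqrtr_ge0. Qed.

Lemma cabsD z w : cabs (z + w) <= cabs z + cabs w.
Proof.
rewrite -ofreal_le.
have -> : ofreal (cabs z + cabs w) = ofreal (cabs z) + ofreal (cabs w).
  exact: (rmorphD (real_complex R)).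
by rewrite -!cabsE; exact: ler_normD.
Qed.

Lemma cabsM z w : cabs (z * w) = cabs z * cabs w.
Proof.
apply: ofreal_inj.
have -> : ofreal (cabs z * cabs w) = ofreal (cabs z) * ofreal (cabs w).
  exact: (rmorphM (real_complex R)).
by rewrite -!cabsE; exact: normrM.
Qed.

Lemma cabs0 : cabs 0 = 0.
Proof. by rewrite /cabs normr0. Qed.

Lemma cabs_eq0 z : cabs z = 0 -> z = 0.
Proof. by move=> z0; apply/normr0_eq0; rewrite cabsE z0. Qed.

End Modulus.

Section L1.
Context d (T : measurableType d) (R : realType).
Variable mu : {measure set T -> \bar R}.

Definition measurable_cplx (f : T -> Cplx R) : Prop :=
  measurable_fun [set: T] (reC \o f) /\ measurable_fun [set: T] (imC \o f).

Definition L1_pred (A : set T) : set (T -> Cplx R) :=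
  [set f | [/\ measurable_cplx f,
    (\int[mu]_x (cabs (f x))%:E < +oo)%E &
    {ae mu, forall x, ~ A x -> f x = 0}]].

Lemma measurable_cabs f : measurable_cplx f ->
  measurable_fun [set: T] (EFin \o (fun x => cabs (f x))).
Proof.
move=> [mr mi]; apply/measurable_EFinP.
rewrite (_ : (fun _ => _) =
  Num.sqrt \o (fun x => (reC \o f) x ^+ 2 + (imC \o f) x ^+ 2)); last first.
  by apply/funext => x /=; rewrite cabs_sqrt.
apply: measurableT_comp.
  by apply: continuous_measurable_fun; exact: sqrt_continuous.
by apply: measurable_funD; exact: measurable_funX.
Qed.

Lemma measurable_cplx_comb (a : Cplx R) f g : measurable_cplx f ->
  measurable_cplx g -> measurable_cplx (a *: f + g).
Proof.
move=> [fr fi] [gr gi]; split.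
  rewrite (_ : reC \o _ = (fun x => (reC a * (reC \o f) x -
    imC a * (imC \o f) x) + (reC \o g) x)); last first.
    apply/funext => x /=; rewrite /reC /imC/=.
    by change ((a *: f + g) x) with (a * f x + g x); case: a (f x) (g x) =>
      [? ?] [? ?] [? ?].
  by apply: measurable_funD => //; apply: measurable_funB;
    apply: measurable_funM => //; exact: measurable_cst.
rewrite (_ : imC \o _ = (fun x => (reC a * (imC \o f) x +
  imC a * (reC \o f) x) + (imC \o g) x)); last first.
  apply/funext => x /=; rewrite /reC /imC/=.
  by change ((a *: f + g) x) with (a * f x + g x); case: a (f x) (g x) =>
    [? ?] [? ?] [? ?].
by apply: measurable_funD => //; apply: measurable_funD;
  apply: measurable_funM => //; exact: measurable_cst.
Qed.

Lemma int_cabsD f g : measurable_cplx f -> measurable_cplx g ->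
  (\int[mu]_x (cabs (f x + g x))%:E <=
   \int[mu]_x (cabs (f x))%:E + \int[mu]_x (cabs (g x))%:E)%E.
Proof.
move=> mf mg.
have mfg : measurable_cplx (1 *: f + g) by exact: measurable_cplx_comb.
rewrite scale1r in mfg.
rewrite -ge0_integralD//; last 4 first.
- by move=> x _; rewrite lee_fin cabs_ge0.
- exact: measurable_cabs.
- by move=> x _; rewrite lee_fin cabs_ge0.
- exact: measurable_cabs.
apply: ge0_le_integral => //.
- by move=> x _; rewrite lee_fin cabs_ge0.
- exact: (measurable_cabs mfg).
- by apply: emeasurable_funD; exact: measurable_cabs.
- by move=> x _; rewrite -EFinD lee_fin cabsD.
Qed.

Lemma int_cabsZ a f : measurable_cplx f ->
  (\int[mu]_x (cabs (a * f x))%:E =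
   (cabs a)%:E * \int[mu]_x (cabs (f x))%:E)%E.
Proof.
move=> mf; under eq_integral do rewrite cabsM EFinM.
rewrite ge0_integralZl//; first exact: measurable_cabs.
- by move=> x _; rewrite lee_fin cabs_ge0.
- by rewrite lee_fin cabs_ge0.
Qed.


Variable A : set T.

Lemma L1_pred_comb (a : Cplx R) f g : L1_pred A f -> L1_pred A g ->
  L1_pred A (a *: f + g).
Proof.
move=> [mf lf vf] [mg lg vg].
have maf : measurable_cplx (a *: f).
  rewrite -[a *: f]addr0; apply: measurable_cplx_comb => //.
  by split; exact: measurable_cst.
split; first exact: measurable_cplx_comb.
  apply: (le_lt_trans (int_cabsD maf mg)).
  apply: lte_add_pinfty => //.
  have -> : (\int[mu]_x (cabs ((a *: f) x))%:E =
      (cabs a)%:E * \int[mu]_x (cabs (f x))%:E)%E by exact: int_cabsZ.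
  by rewrite lte_mul_pinfty// lee_fin cabs_ge0.
apply: filterS2 vf vg => x fx gx nAx.
by change (a * f x + g x = 0); rewrite fx// gx// mulr0 addr0.
Qed.

Lemma L1_pred0 : L1_pred A 0.
Proof.
split; first by split; exact: measurable_cst.
  by under eq_integral do rewrite /= cabs0; rewrite integral0.
exact: aeW.
Qed.

Record L1fun := MkL1fun { L1val :> T -> Cplx R; L1valP : L1_pred A L1val }.

HB.instance Definition _ := gen_eqMixin L1fun.
HB.instance Definition _ := gen_choiceMixin L1fun.

Definition L1comb (a : Cplx R) (f g : L1fun) : L1fun :=
  MkL1fun (L1_pred_comb a (L1valP f) (L1valP g)).

Definition L1fun_eq (f g : L1fun) : bool := `[< f = g %[ae mu] >].

Let L1fun_eq_refl : reflexive L1fun_eq.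
Proof. by move=> f; apply/asboolP; exact: aeW. Qed.

Let L1fun_eq_sym : symmetric L1fun_eq.
Proof.
by move=> f g; apply/asboolP/asboolP; apply: filterS => x /[apply].
Qed.

Let L1fun_eq_trans : transitive L1fun_eq.
Proof.
move=> f g h /asboolP gf /asboolP fh; apply/asboolP.
by apply: filterS2 gf fh => x -> // ->.
Qed.

Canonical L1fun_eq_canonical :=
  EquivRel L1fun_eq L1fun_eq_refl L1fun_eq_sym L1fun_eq_trans.

Definition L1space : Type := {eq_quot L1fun_eq}.
HB.instance Definition _ := Choice.on L1space.
HB.instance Definition _ := EqQuotient.on L1space.

Definition L1rep (f : L1space) : T -> Cplx R := L1val (repr f).
Coercion L1rep : L1space >-> Funclass.

Lemma L1space_eqP (f g : L1space) : f = g <-> f = g %[ae mu].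
Proof.
split=> [->|fg]; first exact: aeW.
by rewrite -[f]reprK -[g]reprK; apply/eqmodP/asboolP.
Qed.

Lemma L1pi (f : L1fun) : (\pi_L1space f : L1space) = f %[ae mu].
Proof.
have /eqmodP/asboolP h : repr (\pi_L1space f) = f %[mod L1space] by rewrite reprK.
exact: h.
Qed.

Definition L1zero : L1space := \pi_L1space (MkL1fun L1_pred0).
Definition L1lin (a : Cplx R) (f g : L1space) : L1space :=
  \pi_L1space (L1comb a (repr f) (repr g)).

Lemma L1zeroE : L1zero = (fun=> 0) %[ae mu].
Proof. exact: L1pi. Qed.

Lemma L1linE a (f g : L1space) :
  L1lin a f g = (fun x => a * f x + g x) %[ae mu].
Proof. exact: L1pi. Qed.

Definition L1add (f g : L1space) := L1lin 1 f g.
Definition L1opp (f : L1space) := L1lin (-1) f L1zero.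
Definition L1scale a (f : L1space) := L1lin a f L1zero.

Lemma L1addE f g : L1add f g = (fun x => f x + g x) %[ae mu].
Proof. by apply: filterS (L1linE 1 f g) => x h /h ->; rewrite mul1r. Qed.

Lemma L1oppE f : L1opp f = (fun x => - f x) %[ae mu].
Proof.
by apply: filterS2 (L1linE (-1) f L1zero) L1zeroE => x h h0 Ix;
  rewrite h// h0// addr0 mulN1r.
Qed.

Lemma L1scaleE a f : L1scale a f = (fun x => a * f x) %[ae mu].
Proof.
by apply: filterS2 (L1linE a f L1zero) L1zeroE => x h h0 Ix;
  rewrite h// h0// addr0.
Qed.

Let L1addA : associative L1add.
Proof.
move=> f g h; apply/L1space_eqP.
near=> x => Ix; rewrite (near (L1addE f (L1add g h)) x)//.
rewrite (near (L1addE g h) x)// (near (L1addE (L1add f g) h) x)//.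
by rewrite (near (L1addE f g) x)// addrA.
Unshelve. all: by end_near. Qed.

Let L1addC : commutative L1add.
Proof.
move=> f g; apply/L1space_eqP.
near=> x => Ix; rewrite (near (L1addE f g) x)// (near (L1addE g f) x)//.
by rewrite addrC.
Unshelve. all: by end_near. Qed.

Let L1add0 : left_id L1zero L1add.
Proof.
move=> f; apply/L1space_eqP.
near=> x => Ix; rewrite (near (L1addE L1zero f) x)// (near L1zeroE x)//.
by rewrite add0r.
Unshelve. all: by end_near. Qed.

Let L1addN : left_inverse L1zero L1opp L1add.
Proof.
move=> f; apply/L1space_eqP.
near=> x => Ix; rewrite (near (L1addE (L1opp f) f) x)// (near L1zeroE x)//.
by rewrite (near (L1oppE f) x)// addNr.
Unshelve. all: by end_near. Qed.

HB.instance Definition _ := GRing.isZmodule.Build L1space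
  L1addA L1addC L1add0 L1addN.

Let L1scaleA a b f : L1scale a (L1scale b f) = L1scale (a * b) f.
Proof.
apply/L1space_eqP; near=> x => Ix.
rewrite (near (L1scaleE a (L1scale b f)) x)// (near (L1scaleE b f) x)//.
by rewrite (near (L1scaleE (a * b) f) x)// mulrA.
Unshelve. all: by end_near. Qed.

Let L1scale1 : left_id 1 L1scale.
Proof.
move=> f; apply/L1space_eqP; near=> x => Ix.
by rewrite (near (L1scaleE 1 f) x)// mul1r.
Unshelve. all: by end_near. Qed.

Let L1scaleDr : right_distributive L1scale +%R.
Proof.
move=> a f g; apply/L1space_eqP; near=> x => Ix.
rewrite (near (L1scaleE a (f + g)) x)// (near (L1addE f g) x)//.
rewrite (near (L1addE (L1scale a f) (L1scale a g)) x)//.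
by rewrite (near (L1scaleE a f) x)// (near (L1scaleE a g) x)// mulrDr.
Unshelve. all: by end_near. Qed.

Let L1scaleDl f : {morph L1scale^~ f : a b / a + b}.
Proof.
move=> a b; apply/L1space_eqP; near=> x => Ix.
rewrite (near (L1scaleE (a + b) f) x)//.
rewrite (near (L1addE (L1scale a f) (L1scale b f)) x)//.
by rewrite (near (L1scaleE a f) x)// (near (L1scaleE b f) x)// mulrDl.
Unshelve. all: by end_near. Qed.

HB.instance Definition _ := GRing.Zmodule_isLmodule.Build (Cplx R) L1space
  L1scaleA L1scale1 L1scaleDr L1scaleDl.

Lemma L1repP (f : L1space) : L1_pred A f.
Proof. exact: L1valP. Qed.

(* [normedModType (Cplx R)] has norms in [Cplx R], hence the [ofreal]. *)
Definition L1norm (f : L1space) : Cplx R :=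
  ofreal (fine (\int[mu]_x (cabs (f x))%:E)).

Lemma L1norm_fineK (f : L1space) :
  (fine (\int[mu]_x (cabs (f x))%:E))%:E = (\int[mu]_x (cabs (f x))%:E)%E.
Proof.
have [_ lf _] := L1repP f.
rewrite fineK// ge0_fin_numE//; apply: integral_ge0 => x _.
by rewrite lee_fin cabs_ge0.
Qed.

Lemma eq_int_cabs f g : measurable_cplx f -> measurable_cplx g ->
  f = g %[ae mu] ->
  (\int[mu]_x (cabs (f x))%:E = \int[mu]_x (cabs (g x))%:E)%E.
Proof.
move=> mf mg fg; apply: ge0_ae_eq_integral => //.
- exact: measurable_cabs.
- exact: measurable_cabs.
- by move=> x _; rewrite lee_fin cabs_ge0.
- by move=> x _; rewrite lee_fin cabs_ge0.
- by apply: filterS fg => x h Ix; rewrite h.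
Qed.

Let L1normD (f g : L1space) : L1norm (f + g) <= L1norm f + L1norm g.
Proof.
have [mf _ _] := L1repP f; have [mg _ _] := L1repP g.
have [mfg _ _] := L1repP (f + g).
have msum : measurable_cplx (fun x => f x + g x).
  have := measurable_cplx_comb 1 mf mg.
  by rewrite scale1r.
rewrite /L1norm.
have <- : ofreal (fine (\int[mu]_x (cabs (f x))%:E) +
    fine (\int[mu]_x (cabs (g x))%:E)) =
    ofreal (fine (\int[mu]_x (cabs (f x))%:E)) +
    ofreal (fine (\int[mu]_x (cabs (g x))%:E)).
  exact: (rmorphD (real_complex R)).
rewrite ofreal_le -lee_fin EFinD !L1norm_fineK.
by rewrite (eq_int_cabs mfg msum (L1addE f g)) int_cabsD.
Qed.

Let L1normZ (a : Cplx R) (f : L1space) : L1norm (a *: f) = `|a| * L1norm f.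
Proof.
have [mf _ _] := L1repP f; have [mz _ _] := L1repP (a *: f).
have maf : measurable_cplx (fun x => a * f x).
  have [m0 _ _] := L1_pred0.
  by have := measurable_cplx_comb a mf m0; rewrite addr0.
rewrite /L1norm cabsE.
have <- : ofreal (cabs a * fine (\int[mu]_x (cabs (f x))%:E)) =
    ofreal (cabs a) * ofreal (fine (\int[mu]_x (cabs (f x))%:E)).
  exact: (rmorphM (real_complex R)).
congr ofreal; apply: EFin_inj; rewrite EFinM !L1norm_fineK.
by rewrite (eq_int_cabs mz maf (L1scaleE a f)) int_cabsZ.
Qed.

Let L1norm_eq0 (f : L1space) : L1norm f = 0 -> f = 0.
Proof.
have [mf _ _] := L1repP f.
move=> /ofreal_inj f0; apply/L1space_eqP.
have : (\int[mu]_x `|(cabs (f x))%:E| = 0)%E.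
  under eq_integral do rewrite gee0_abs ?lee_fin ?cabs_ge0//.
  by rewrite -L1norm_fineK f0.
move/(ae_eq_integral_abs mu measurableT (measurable_cabs mf)).
apply: filterS2 L1zeroE => x z h Ix; rewrite z//.
by have /(_ Ix)[] := h => /cabs_eq0.
Qed.

HB.instance Definition _ := Lmodule_isNormed.Build (Cplx R) L1space
  L1normD L1normZ L1norm_eq0.

End L1.

Section Linf.
Variables (R : realType) (S : Type).

Definition bounded_pred : set (S -> Cplx R) :=
  [set f | exists K : R, forall s, cabs (f s) <= K].

Record Linf := MkLinf { Linfval :> S -> Cplx R; LinfvalP : bounded_pred Linfval }.

HB.instance Definition _ := gen_eqMixin Linf.
HB.instance Definition _ := gen_choiceMixin Linf.

Lemma LinfP (f g : Linf) : f =1 g -> f = g.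
Proof.
case: f g => [f fP] [g gP] /= /funext fg; rewrite fg in fP *.
by congr MkLinf; exact: Prop_irrelevance.
Qed.

Lemma bounded_comb (a : Cplx R) f g : bounded_pred f -> bounded_pred g ->
  bounded_pred (fun s => a * f s + g s).
Proof.
move=> [K fK] [L gL]; exists (cabs a * K + L) => s.
by rewrite (le_trans (cabsD _ _))// cabsM lerD// ler_wpM2l// cabs_ge0.
Qed.

Lemma bounded_const (c : Cplx R) : bounded_pred (fun=> c).
Proof. by exists (cabs c). Qed.

Definition Linf_const (c : Cplx R) : Linf := MkLinf (bounded_const c).
Definition Linf_lin a (f g : Linf) : Linf :=
  MkLinf (bounded_comb a (LinfvalP f) (LinfvalP g)).

Let add (f g : Linf) := Linf_lin 1 f g.
Let opp (f : Linf) := Linf_lin (-1) f (Linf_const 0).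
Let scale a (f : Linf) := Linf_lin a f (Linf_const 0).

Let addA : associative add.
Proof. by move=> f g h; apply: LinfP => s /=; rewrite !mul1r addrA. Qed.
Let addC : commutative add.
Proof. by move=> f g; apply: LinfP => s /=; rewrite !mul1r addrC. Qed.
Let add0 : left_id (Linf_const 0) add.
Proof. by move=> f; apply: LinfP => s /=; rewrite mul1r add0r. Qed.
Let addN : left_inverse (Linf_const 0) opp add.
Proof.
by move=> f; apply: LinfP => s /=; rewrite mul1r addr0 mulN1r addNr.
Qed.

HB.instance Definition _ := GRing.isZmodule.Build Linf addA addC add0 addN.

Let scaleA a b f : scale a (scale b f) = scale (a * b) f.
Proof. by apply: LinfP => s /=; rewrite !addr0 mulrA. Qed.
Let scale1 : left_id 1 scale.
Proof. by move=> f; apply: LinfP => s /=; rewrite mul1r addr0. Qed.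
Let scaleDr : right_distributive scale +%R.
Proof.
by move=> a f g; apply: LinfP => s /=; rewrite !addr0 !mul1r mulrDr.
Qed.
Let scaleDl f : {morph scale^~ f : a b / a + b}.
Proof.
by move=> a b; apply: LinfP => s /=; rewrite !addr0 !mul1r mulrDl.
Qed.

HB.instance Definition _ := GRing.Zmodule_isLmodule.Build (Cplx R) Linf
  scaleA scale1 scaleDr scaleDl.

Definition sup_norm (f : Linf) : Cplx R := ofreal (sup (range (cabs \o f))).

Lemma sup_norm_ub (f : Linf) s : cabs (f s) <= sup (range (cabs \o f)).
Proof.
apply: ub_le_sup; last by exists s.
by have [K fK] := LinfvalP f; exists K => y [t tI <-]; exact: fK.
Qed.

Lemma sup_norm_le (f : Linf) (K : R) : 0 <= K -> (forall s, cabs (f s) <= K) ->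
  sup (range (cabs \o f)) <= K.
Proof.
move=> K0 fK; have [[s _]|S0] := pselect (exists s : S, True).
  apply: ge_sup; first by exists (cabs (f s)); exists s.
  by move=> y [t tI <-]; exact: fK.
rewrite (_ : range _ = set0) ?sup0// -subset0 => y [s _ _].
by apply: S0; exists s.
Qed.

Lemma sup_norm_ge0 (f : Linf) : 0 <= sup (range (cabs \o f)).
Proof.
have [[s _]|S0] := pselect (exists s : S, True).
  by rewrite (le_trans _ (sup_norm_ub f s))// cabs_ge0.
rewrite (_ : range _ = set0) ?sup0// -subset0 => y [s _ _].
by apply: S0; exists s.
Qed.

Let normD (f g : Linf) : sup_norm (f + g) <= sup_norm f + sup_norm g.
Proof.
rewrite /sup_norm.
have <- : ofreal (sup (range (cabs \o f)) + sup (range (cabs \o g))) =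
    ofreal (sup (range (cabs \o f))) + ofreal (sup (range (cabs \o g))).
  exact: (rmorphD (real_complex R)).
rewrite ofreal_le; apply: sup_norm_le => [|s].
  by rewrite addr_ge0// sup_norm_ge0.
by rewrite /= mul1r (le_trans (cabsD _ _))// lerD// sup_norm_ub.
Qed.

Let normZ (a : Cplx R) (f : Linf) : sup_norm (a *: f) = `|a| * sup_norm f.
Proof.
rewrite /sup_norm cabsE.
have <- : ofreal (cabs a * sup (range (cabs \o f))) =
    ofreal (cabs a) * ofreal (sup (range (cabs \o f))).
  exact: (rmorphM (real_complex R)).
congr ofreal; apply/eqP; rewrite eq_le; apply/andP; split.
  apply: sup_norm_le => [|s]; first by rewrite mulr_ge0 ?cabs_ge0 ?sup_norm_ge0.
  by rewrite /= addr0 cabsM ler_wpM2l ?cabs_ge0 ?sup_norm_ub.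
have [a0|/eqP a0] := pselect (cabs a = 0); first by rewrite a0 mul0r sup_norm_ge0.
have a_gt0 : 0 < cabs a by rewrite lt_neqAle eq_sym a0 cabs_ge0.
rewrite mulrC -ler_pdivlMr//; apply: sup_norm_le => [|s].
  by rewrite divr_ge0 ?cabs_ge0 ?sup_norm_ge0.
rewrite ler_pdivlMr// mulrC -cabsM.
by have := sup_norm_ub (a *: f) s; rewrite /= addr0.
Qed.

Let norm_eq0 (f : Linf) : sup_norm f = 0 -> f = 0.
Proof.
move=> /ofreal_inj f0; apply: LinfP => s; apply: cabs_eq0.
by apply/eqP; rewrite eq_le cabs_ge0 andbT -f0 sup_norm_ub.
Qed.

HB.instance Definition _ := Lmodule_isNormed.Build (Cplx R) Linf
  normD normZ norm_eq0.

End Linf.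

Definition lspan (K : pzRingType) (V : lmodType K) (E : set V) : set V :=
  [set v | exists n (a : 'I_n -> K) (e : 'I_n -> V),
    (forall i, E (e i)) /\ v = \sum_(i < n) a i *: e i].

Section Amenability.
Variables (R : realType) (S : semigroupType).

Definition functional_norm (M : {linear Linf R S -> Cplx R}) : R :=
  sup [set cabs (M phi) | phi in [set phi : Linf R S | `|phi| <= 1]].

(* [0 <= z] in [Cplx R] means that z is real and nonnegative. *)
Definition is_mean (M : {linear Linf R S -> Cplx R}) : Prop :=
  [/\ continuous M,
      forall phi : Linf R S, (forall s, 0 <= phi s) -> 0 <= M phi,
      functional_norm M = 1 &
      M (Linf_const S 1) = 1].

Lemma bounded_ltrans (s : S) (phi : Linf R S) :
  bounded_pred (fun x => phi (s * x)%g).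
Proof. by have [K phiK] := LinfvalP phi; exists K => x; exact: phiK. Qed.

Definition ltrans (s : S) (phi : Linf R S) : Linf R S :=
  MkLinf (bounded_ltrans s phi).

(* Completeness of [B] plays no role in the definition. *)
Variable B : normedModType (Cplx R).
Implicit Type rho : S -> {linear B -> B}.

Definition is_representation rho : Prop :=
  (forall s, continuous (rho s)) /\
  (forall s t b, rho (s * t)%g b = rho s (rho t b)).

Definition uniformly_bounded rho : Prop :=
  exists K : R, forall s b, `|rho s b| <= ofreal K * `|b|.

Definition coefficients rho : set (Linf R S) :=
  [set phi | exists (b : B) (b' : {linear B -> Cplx R}),
    continuous b' /\ forall s, phi s = b' (rho s b)].

Definition Yspace rho : set (Linf R S) := closure (lspan (coefficients rho)).

Definition Xspace rho : set (Linf R S) :=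
  lspan (Yspace rho `|` range (Linf_const S)).

(* The notion presupposes a bounded representation: only then are all the
   coefficients elements of [Linf R S]. *)
Definition left_amenable rho : Prop :=
  uniformly_bounded rho /\
  exists2 M : {linear Linf R S -> Cplx R}, is_mean M &
    forall phi, Xspace rho phi -> forall s, M (ltrans s phi) = M phi.

End Amenability.

Section AeMaps.
Context d (T : measurableType d) (R : realType).
Variable mu : {measure set T -> \bar R}.

(* Composition passes to a.e. classes for the maps whose inverse images
   preserve null sets. *)
Definition nonsingular (f : T -> T) : Prop :=
  forall N, mu.-negligible N -> mu.-negligible (f @^-1` N).

Record nsmap := MkNsmap { nsval :> T -> T; nsvalP : nonsingular nsval }.

HB.instance Definition _ := gen_eqMixin nsmap.
HB.instance Definition _ := gen_choiceMixin nsmap.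

Lemma nonsingular_comp (f g : nsmap) : nonsingular (f \o g).
Proof. by move=> N /(nsvalP f)/(nsvalP g). Qed.

Definition nscomp (f g : nsmap) : nsmap := MkNsmap (@nonsingular_comp f g).

Definition nsmap_eq (f g : nsmap) : bool := `[< f = g %[ae mu] >].

Let nsmap_eq_refl : reflexive nsmap_eq.
Proof. by move=> f; apply/asboolP; exact: aeW. Qed.

Let nsmap_eq_sym : symmetric nsmap_eq.
Proof.
by move=> f g; apply/asboolP/asboolP; apply: filterS => x /[apply].
Qed.

Let nsmap_eq_trans : transitive nsmap_eq.
Proof.
move=> f g h /asboolP gf /asboolP fh; apply/asboolP.
by apply: filterS2 gf fh => x -> // ->.
Qed.

Canonical nsmap_eq_canonical :=
  EquivRel nsmap_eq nsmap_eq_refl nsmap_eq_sym nsmap_eq_trans.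

Definition aemap : Type := {eq_quot nsmap_eq}.
HB.instance Definition _ := Choice.on aemap.
HB.instance Definition _ := EqQuotient.on aemap.

Definition aerep (c : aemap) : T -> T := nsval (repr c).

Definition aecomp (c e : aemap) : aemap :=
  \pi_aemap (nscomp (repr c) (repr e)).

Lemma aemapP (c e : aemap) : aerep c = aerep e %[ae mu] -> c = e.
Proof.
by move=> ce; rewrite -[c]reprK -[e]reprK; apply/eqmodP/asboolP.
Qed.

Lemma aecompE c e : aerep (aecomp c e) = aerep c \o aerep e %[ae mu].
Proof.
have /eqmodP/asboolP h :
  repr (aecomp c e) = nscomp (repr c) (repr e) %[mod aemap] by rewrite reprK.
exact: h.
Qed.

Lemma ae_comp_ns (f g : T -> T) (h : aemap) : f = g %[ae mu] ->
  f \o aerep h = g \o aerep h %[ae mu].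
Proof. exact: (nsvalP (repr h)). Qed.

Let aecompA : associative aecomp.
Proof.
move=> c e f; apply: aemapP.
near=> x => Ix.
rewrite (near (aecompE c (aecomp e f)) x)//= (near (aecompE e f) x)//=.
rewrite (near (aecompE (aecomp c e) f) x)//=.
by have /= -> := near (ae_comp_ns f (aecompE c e)) x _ Ix.
Unshelve. all: by end_near. Qed.

HB.instance Definition _ := isSemigroup.Build aemap aecompA.

End AeMaps.

Section GeneratedSemigroup.
Variables (G : semigroupType) (E : set G).

Inductive generated : G -> Prop :=
| generated_gen x : E x -> generated x
| generated_mul x y : generated x -> generated y -> generated (x * y)%g.

Record gen_semigroup := MkGen { genval :> G; genvalP : generated genval }.

HB.instance Definition _ := gen_eqMixin gen_semigroup.
HB.instance Definition _ := gen_choiceMixin gen_semigroup.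

Definition gen_mul (x y : gen_semigroup) : gen_semigroup :=
  MkGen (generated_mul (genvalP x) (genvalP y)).

Let gen_mulA : associative gen_mul.
Proof.
move=> [x xP] [y yP] [z zP]; rewrite /gen_mul /=.
move: (generated_mul _ _) (generated_mul _ _) => p q; move: q p.
by rewrite mulgA => p q; congr MkGen; exact: Prop_irrelevance.
Qed.

HB.instance Definition _ := isSemigroup.Build gen_semigroup gen_mulA.

End GeneratedSemigroup.

(* [None] is the point at infinity. *)
Definition sphere (R : realType) : Type := one_point_compactification (Cplx R).

HB.instance Definition _ (R : realType) := Topological.on (sphere R).
HB.instance Definition _ (R : realType) := Pointed.on (sphere R).

Section SphereMeasure.
Variable R : realType.

Definition plane_to_sphere (w : measurableTypeR R * measurableTypeR R) :
  sphere R := Some (Complex w.1 w.2 : Cplx R).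

(* The Borel sigma-algebra of the sphere. *)
Definition sphere_measurable : set (set (sphere R)) :=
  [set B | measurable (plane_to_sphere @^-1` B)].

Let sphere_measurable0 : sphere_measurable set0.
Proof. by rewrite /sphere_measurable/= preimage_set0. Qed.

Let sphere_measurableC B : sphere_measurable B -> sphere_measurable (~` B).
Proof. by rewrite /sphere_measurable/= preimage_setC; exact: measurableC. Qed.

Let sphere_measurableU (F : (set (sphere R))^nat) :
  (forall i, sphere_measurable (F i)) -> sphere_measurable (\bigcup_i (F i)).
Proof.
by rewrite /sphere_measurable/= preimage_bigcup; exact: bigcupT_measurable.
Qed.

HB.instance Definition _ := isMeasurable.Build default_measure_display
  (sphere R) sphere_measurable0 sphere_measurableC sphere_measurableU.

Lemma measurable_plane_to_sphere : measurable_fun setT plane_to_sphere.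
Proof. by move=> _ B mB; rewrite setTI. Qed.

Definition Leb : {measure set (sphere R) -> \bar R} :=
  measure_function_pushforward__canonical__measure_function_Measure
    (@lebesgue_measure R \x @lebesgue_measure R)%E measurable_plane_to_sphere.

Lemma LebE B : Leb B =
  (@lebesgue_measure R \x @lebesgue_measure R)%E (plane_to_sphere @^-1` B).
Proof. by []. Qed.

End SphereMeasure.

Section Sphere.
Variable R : realType.
Local Notation C := (Cplx R).
Local Notation Cbar := (sphere R).

Record ratmap := RatMap {
  rnum : {poly C};
  rden : {poly C};
  rnum_rden_coprime : coprimep rnum rden }.

Definition ratdeg (Q : ratmap) : nat :=
  (maxn (size (rnum Q)) (size (rden Q))).-1.

(* At infinity, evaluate the homogenization of degree [ratdeg Q] at [1 : 0]. *)
Definition ratfun (Q : ratmap) (z : Cbar) : Cbar :=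
  let a := if z is Some w then (rnum Q).[w] else (rnum Q)`_(ratdeg Q) in
  let b := if z is Some w then (rden Q).[w] else (rden Q)`_(ratdeg Q) in
  if b == 0 then None else Some (a / b).
Coercion ratfun : ratmap >-> Funclass.

Definition sphere_inv (z : Cbar) : Cbar :=
  if z is Some w then (if w == 0 then None else Some w^-1) else Some 0.

Definition affine (z : Cbar) : C := if z is Some w then w else 0.

(* Charts around [c]: the identity for finite [c], [z |-> 1/z] at infinity. *)
Definition to_chart (c z : Cbar) : C :=
  affine (if c is None then sphere_inv z else z).
Definition of_chart (c : Cbar) (w : C) : Cbar :=
  if c is None then sphere_inv (Some w) else Some w.
Definition local_rep (f : Cbar -> Cbar) (c : Cbar) : C -> C :=
  to_chart (f c) \o f \o of_chart c.

Definition holomorphic_on (U : set Cbar) (f : Cbar -> Cbar) : Prop :=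
  forall z, U z ->
    {for z, continuous f} /\ derivable (local_rep f z) (to_chart z z) 1.

Definition critical_point (f : Cbar -> Cbar) (c : Cbar) : Prop :=
  derive1 (local_rep f c) (to_chart c c) = 0.

Definition critical_values (f : Cbar -> Cbar) : set Cbar :=
  f @` critical_point f.

(* The derivative in the affine coordinate; its junk values at infinity and at
   the poles of [f] are irrelevant up to measure zero. *)
Definition cderiv (f : Cbar -> Cbar) (z : Cbar) : C :=
  derive1 (affine \o f \o Some) (affine z).

(* Image of [0, 1] under a map conformal on a neighbourhood of [0, 1]. *)
Definition analytic_arc (sigma : set Cbar) : Prop :=
  exists (V : set Cbar) (phi : Cbar -> Cbar),
    [/\ open V,
        forall t : R, `[0, 1]%classic t -> V (Some (ofreal t)),
        holomorphic_on V phi,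
        {in V &, injective phi} &
        sigma = [set phi (Some (ofreal t)) | t in `[0, 1]%classic]].

Definition path_in (U : set Cbar) (p : R -> Cbar) : Prop :=
  {within `[0, 1], continuous p} /\ forall t, `[0, 1]%classic t -> U (p t).

Definition simply_connected (U : set Cbar) : Prop :=
  [/\ U !=set0,
      forall x y, U x -> U y -> exists2 p, path_in U p & p 0 = x /\ p 1 = y &
      forall p, path_in U p -> p 0 = p 1 ->
        exists H : R * R -> Cbar,
          [/\ {within `[0, 1] `*` `[0, 1], continuous H},
              forall w, (`[0, 1] `*` `[0, 1]) w -> U (H w),
              forall t, `[0, 1]%classic t -> H (0, t) = p t /\ H (1, t) = p 0 &
              forall s, `[0, 1]%classic s -> H (s, 0) = p 0 /\ H (s, 1) = p 0]].

Definition holomorphic_homeo (U V : set Cbar) (f : Cbar -> Cbar) : Prop :=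
  [/\ set_bij U V f, holomorphic_on U f & {within V, continuous (pinv U f)}].

Variable Q : ratmap.

Section Deck.
Variable D : 'I_(ratdeg Q) -> set Cbar.

Definition sheets (sigma : set Cbar) : Prop :=
  [/\ Q @^-1` (~` sigma) = \bigcup_i D i,
      trivIset setT D &
      forall i, [/\ open (D i), simply_connected (D i) &
                    holomorphic_homeo (D i) (~` sigma) Q]].

(* [pinv (D j) Q] is the inverse branch of [Q] with values in [D j]. *)
Definition sheet_swap (i j : 'I_(ratdeg Q)) (z : Cbar) : Cbar :=
  if z \in D i then pinv (D j) Q (Q z)
  else if z \in D j then pinv (D i) Q (Q z)
  else z.

(* For [sheets D sigma], every [sheet_swap i j] is an honest involution of the sphere, so the
   generated group is a group of honest bijections: no a.e. choice is involved
   in the derivatives of its elements. *)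
Inductive deck_group : (Cbar -> Cbar) -> Prop :=
| deck_id : deck_group id
| deck_swap i j : deck_group (sheet_swap i j)
| deck_comp g h : deck_group g -> deck_group h -> deck_group (g \o h)
| deck_inv g h : deck_group g -> cancel g h -> cancel h g -> deck_group h.

Definition deck_act (g : Cbar -> Cbar) (f : Cbar -> C) (z : Cbar) : C :=
  f (g z) * cderiv g z ^+ 2.

Definition ruelle_op (f : Cbar -> C) (y : Cbar) : C :=
  \sum_(x \in [set x | Q x = y]) (f x / cderiv Q x ^+ 2).

(* The a.e. class [c] is that of [Q_g = g \o Q \o g^-1 = g \o Q]. *)
Definition conjugate_class (g : Cbar -> Cbar) (c : aemap (Leb R)) : Prop :=
  aerep c = g \o Q %[ae Leb R].

Definition deck_semigroup : Type :=
  gen_semigroup [set c | exists2 g, deck_group g & conjugate_class g c].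
HB.instance Definition _ := Semigroup.on deck_semigroup.

Definition ruelle_representation (A : set Cbar)
    (rho : deck_semigroup -> {linear L1space (Leb R) A -> L1space (Leb R) A}) :
    Prop :=
  is_representation rho /\
  forall g (s : deck_semigroup), deck_group g -> conjugate_class g (genval s) ->
    forall f : L1space (Leb R) A,
      L1rep (rho s f) = deck_act g (ruelle_op (L1rep f)) %[ae Leb R].

End Deck.

Definition lebesgue_measurable (A : set Cbar) : Prop :=
  completed_algebra_gen (Leb R) A.

Definition completely_invariant (A : set Cbar) : Prop :=
  {ae Leb R, forall z, (Q @^-1` A) z <-> A z}.

Definition invariant_beltrami (mu : Cbar -> C) : Prop :=
  [/\ measurable_cplx mu,
      exists K : R, {ae Leb R, forall z, cabs (mu z) <= K} &
      {ae Leb R, forall z, mu (Q z) * ((cderiv Q z)^* / cderiv Q z) = mu z}].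

Definition supports_beltrami (A : set Cbar) : Prop :=
  exists mu, [/\ invariant_beltrami mu,
    {ae Leb R, forall z, ~ A z -> mu z = 0} &
    ~ {ae Leb R, forall z, mu z = 0}].

End Sphere.

(* Main.v *)
(* Let s0 be the class of R itself in the semigroup, and let M be an ultrafilter
   limit of the averages of a function over the powers of s0.  For a bounded
   functional b' on L_1(A), L(b) = M(s |-> b'(rho(s) b)) is a bounded functional
   invariant under rho(s0) = R_*.  By duality L is integration against a bounded
   function m vanishing off A, and the change of variables y = R(x) on the
   inverse branches turns the invariance of L into m(R) conj(R')/R' = m.  Hence m
   is an invariant Beltrami differential supported on A, so m = 0 and L = 0.
   Thus M vanishes on all coefficients and all their translates, hence on the
   whole space Y_rho; on constants every mean is invariant. *)

From HB Require Import structures.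
Require Import Defs.
From mathcomp Require Import all_boot all_order all_algebra.
From mathcomp Require Import perm generic_quotient finmap complex.
From mathcomp Require Import all_classical all_reals all_analysis.
From mathcomp Require Import measurable_realfun ring lra zify.

Set Implicit Arguments.
Unset Strict Implicit.
Unset Printing Implicit Defensive.

Import Order.TTheory GRing.Theory Num.Theory numFieldNormedType.Exports.
Local Open Scope classical_set_scope.
Local Open Scope ring_scope.
Local Open Scope quotient_scope.

(** * Averages along the powers of one element *)

(** Left translation and averaging act on opposite sides. The translate by s of the coefficient of
    (b, b') is the coefficient of (b, b' o rho(s)), while the shift along the powers of s0 is
    absorbed by the vector b; so a mean built from one element serves all of S. Boundedness of L
    rests on the uniform boundedness of rho, itself part of the claim: R_* is a contraction by the
    triangle inequality in the fibres, and deck elements act isometrically, since they permute the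
    sheets with derivative R'/(R' o gamma). The analytic weight lies in the change of variables.
    Removing the arc, infinity, R(infinity) and their fibres leaves conformal bijections of plane
    open sets. The removed sets are null by Lipschitz coverings, and the area formula follows by
    comparing two measures on small similar rectangles. The relation m(R) conj(R')/R' = m is
    extracted by testing L on the weighted conjugate of the difference of its two sides: invariance
    then says that a weighted integral of a squared modulus is 0. *)

Section ComplexParts.
Context {R : realType}.
Implicit Types z w : Cplx R.

Lemma Cplx_eqP z w : reC z = reC w -> imC z = imC w -> z = w.
Proof. by case: z w => [a b] [c d] /= -> ->. Qed.

Lemma reCD z w : reC (z + w) = reC z + reC w.
Proof. by case: z w => [a b] [c d]. Qed.

Lemma imCD z w : imC (z + w) = imC z + imC w.
Proof. by case: z w => [a b] [c d]. Qed.

Lemma reCN z : reC (- z) = - reC z.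
Proof. by case: z. Qed.

Lemma imCN z : imC (- z) = - imC z.
Proof. by case: z. Qed.

Lemma reCM z w : reC (z * w) = reC z * reC w - imC z * imC w.
Proof. by case: z w => [a b] [c d]. Qed.

Lemma imCM z w : imC (z * w) = reC z * imC w + imC z * reC w.
Proof. by case: z w => [a b] [c d]. Qed.

Lemma ofrealD (x y : R) : ofreal (x + y) = ofreal x + ofreal y.
Proof. exact: (rmorphD (real_complex R)). Qed.

Lemma ofrealM (x y : R) : ofreal (x * y) = ofreal x * ofreal y.
Proof. exact: (rmorphM (real_complex R)). Qed.

Lemma ofreal_lt (x y : R) : (ofreal x < ofreal y) = (x < y).
Proof. exact: ltcR. Qed.

Lemma cabs_sqr z : cabs z ^+ 2 = reC z ^+ 2 + imC z ^+ 2.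
Proof. by rewrite cabs_sqrt sqr_sqrtr// addr_ge0// sqr_ge0. Qed.

Lemma cabsN z : cabs (- z) = cabs z.
Proof. by rewrite /cabs normrN. Qed.

Lemma cabsX z n : cabs (z ^+ n) = cabs z ^+ n.
Proof.
elim: n => [|n ih]; last by rewrite !exprS cabsM ih.
by rewrite !expr0 cabs_sqrt /reC /imC/= expr0n/= addr0 expr1n sqrtr1.
Qed.

Lemma ler_reC_cabs z : `|reC z| <= cabs z.
Proof.
by rewrite -(ler_pXn2r (n := 2))// ?nnegrE ?cabs_ge0//
  cabs_sqr real_normK ?num_real// lerDl sqr_ge0.
Qed.

Lemma ler_imC_cabs z : `|imC z| <= cabs z.
Proof.
by rewrite -(ler_pXn2r (n := 2))// ?nnegrE ?cabs_ge0//
  cabs_sqr real_normK ?num_real// lerDr sqr_ge0.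
Qed.

Lemma cabs_le_reC_imC z : cabs z <= `|reC z| + `|imC z|.
Proof.
rewrite -(ler_pXn2r (n := 2))// ?nnegrE ?cabs_ge0 ?addr_ge0//.
rewrite cabs_sqr sqrrD !real_normK ?num_real//.
by rewrite addrAC lerDl mulrn_wge0 ?mulr_ge0.
Qed.

Lemma cabs_ofreal (x : R) : cabs (ofreal x) = `|x|.
Proof. by rewrite cabs_sqrt /= expr0n/= addr0 sqrtr_sqr. Qed.

Lemma ler_cabs_dist z w : `|cabs z - cabs w| <= cabs (z - w).
Proof.
have h1 : cabs z <= cabs (z - w) + cabs w by rewrite -{1}(subrK w z) cabsD.
have h2 : cabs w <= cabs (z - w) + cabs z.
  by rewrite -(cabsN (z - w)) opprB -{1}(subrK z w) cabsD.
by rewrite ler_norml; apply/andP; split; lra.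
Qed.

Lemma cabs_gt0 z : z != 0 -> 0 < cabs z.
Proof.
move=> z0; rewrite lt_neqAle cabs_ge0 andbT eq_sym.
by apply: contra_neq z0 => /cabs_eq0.
Qed.

Lemma cabs_sum (I : Type) (r : seq I) (P : pred I) (F : I -> Cplx R) :
  cabs (\sum_(i <- r | P i) F i) <= \sum_(i <- r | P i) cabs (F i).
Proof.
apply: (big_ind2 (fun z x => cabs z <= x)) => //; first by rewrite cabs0.
by move=> z x w y zx wy; rewrite (le_trans (cabsD _ _))// lerD.
Qed.

Lemma ge0_Cplx z : 0 <= z -> 0 <= reC z /\ imC z = 0.
Proof. by case: z => a b; rewrite lecE /= => /andP[/eqP-> ->]. Qed.

End ComplexParts.

Section UltraLimit.
Context {R : realType}.

(** A fixed ultrafilter finer than the cofinite filter. Limits along it exist for all bounded real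
    sequences and are linear, but they are not shift invariant; invariance comes from taking Cesaro
    averages beforehand. *)
Definition nat_ultra : set_system nat :=
  sval (cid (@ultraFilterLemma nat _ eventually_filter)).

Lemma nat_ultraP : UltraFilter nat_ultra.
Proof. by rewrite /nat_ultra; case: cid => ? []. Qed.

Lemma eventually_nat_ultra : \oo `<=` nat_ultra.
Proof. by rewrite /nat_ultra; case: cid => ? []. Qed.

#[local] Instance nat_ultra_filter : ProperFilter nat_ultra.
Proof. by have [] := nat_ultraP. Qed.

Definition ulim (u : nat -> R) : R := lim (u @ nat_ultra).

(** Compactness of [[-K, K]] gives a cluster point [p] of the image filter. For a neighbourhood [B]
    of [p], the ultrafilter contains the preimage of [B] or of its complement, and the second case
    contradicts clustering at [p]. *)
Lemma ulim_cvg (u : nat -> R) (K : R) : (forall n, `|u n| <= K) ->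
  u @ nat_ultra --> ulim u.
Proof.
move=> uK; suff : cvg (u @ nat_ultra) by [].
have [|p [_ up]] := @segment_compact R (- K) K (u @ nat_ultra).
- by apply: (@filterS _ nat_ultra _ _ _ _ filterT) => n _ /=; rewrite in_itv/= -ler_norml.
apply/cvg_ex; exists p => B Bp.
have [//|uB] := in_ultra_setVsetC (u @^-1` B) nat_ultraP.
by have [x [nBx Bx]] := up (~` B) B uB Bp.
Qed.

Lemma ulim_eq (u : nat -> R) l : u @ nat_ultra --> l -> ulim u = l.
Proof. by move=> /cvg_lim; apply. Qed.

Lemma cvg_ulim (u : nat -> R) l : u @ \oo --> l -> ulim u = l.
Proof. by move=> ul; apply: ulim_eq => B /ul; exact: eventually_nat_ultra. Qed.

End UltraLimit.

Section CesaroMean.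
Context {R : realType} {S : semigroupType}.
Variable s0 : S.
Implicit Types phi psi : Linf R S.

#[local] Existing Instance nat_ultra_filter.

(** [spow k] has exponent [k + 1]: a semigroup offers no zeroth power. *)
Definition spow (k : nat) : S := iter k (fun s => s0 * s)%g s0.

Definition cesaro phi (n : nat) : Cplx R :=
  ofreal n.+1%:R^-1 * \sum_(k < n.+1) phi (spow k).

Lemma cesaro_bound phi K n : (forall s, cabs (phi s) <= K) ->
  cabs (cesaro phi n) <= K.
Proof.
move=> phiK; rewrite /cesaro cabsM cabs_ofreal ger0_norm//.
rewrite ler_pdivrMl//. apply: (le_trans (cabs_sum _ _ _)).
rewrite mulr_natl -[n.+1 in leRHS]card_ord -sumr_const.
by apply: ler_sum => k _.
Qed.

Definition cesaro_mean phi : Cplx R :=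
  Complex (ulim (reC \o cesaro phi)) (ulim (imC \o cesaro phi)).

Lemma cesaro_mean_cvg phi :
  reC \o cesaro phi @ nat_ultra --> reC (cesaro_mean phi) /\
  imC \o cesaro phi @ nat_ultra --> imC (cesaro_mean phi).
Proof.
have [K phiK] := LinfvalP phi.
split; apply: (@ulim_cvg _ _ K) => n /=.
  exact: le_trans (ler_reC_cabs _) (cesaro_bound n phiK).
exact: le_trans (ler_imC_cabs _) (cesaro_bound n phiK).
Qed.

Lemma cesaroE a phi psi n :
  cesaro (a *: phi + psi) n = a * cesaro phi n + cesaro psi n.
Proof.
rewrite /cesaro [in RHS]mulrCA -[RHS]mulrDr; congr (_ * _).
rewrite mulr_sumr -big_split/=.
by apply: eq_bigr => k _; rewrite mul1r addr0.
Qed.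

Lemma cesaro_mean_linear : linear cesaro_mean.
Proof.
move=> a phi psi; have [r1 i1] := cesaro_mean_cvg phi.
have [r2 i2] := cesaro_mean_cvg psi.
apply: Cplx_eqP.
  rewrite reCD reCM; apply: ulim_eq.
  rewrite (_ : _ \o _ = fun n => (reC a * (reC \o cesaro phi) n -
    imC a * (imC \o cesaro phi) n) + (reC \o cesaro psi) n).
    by apply: cvgD r2; apply: cvgB; exact: cvgMl_tmp.
  by apply/funext => n /=; rewrite cesaroE reCD reCM.
rewrite imCD imCM; apply: ulim_eq.
rewrite (_ : _ \o _ = fun n => (reC a * (imC \o cesaro phi) n +
  imC a * (reC \o cesaro phi) n) + (imC \o cesaro psi) n).
  by apply: cvgD i2; apply: cvgD; exact: cvgMl_tmp.
by apply/funext => n /=; rewrite cesaroE imCD imCM.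
Qed.

HB.instance Definition _ := GRing.isLinear.Build (Cplx R) (Linf R S) (Cplx R)
  *%R cesaro_mean cesaro_mean_linear.

(** Separate bounds on the two parts would lose a constant factor, and a mean must have norm exactly
    1; hence the limit is taken in the sum of the squares of the parts. *)
Lemma cesaro_mean_bound phi K : (forall s, cabs (phi s) <= K) ->
  cabs (cesaro_mean phi) <= K.
Proof.
move=> phiK; have K0 : 0 <= K by exact: le_trans (cabs_ge0 _) (phiK s0).
have [r i] := cesaro_mean_cvg phi.
rewrite -(ler_pXn2r (n := 2))// ?nnegrE ?cabs_ge0// cabs_sqr.
have h : (fun n => (reC \o cesaro phi) n ^+ 2 + (imC \o cesaro phi) n ^+ 2)
    @ nat_ultra --> reC (cesaro_mean phi) ^+ 2 + imC (cesaro_mean phi) ^+ 2.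
  by rewrite !expr2; apply: cvgD; apply: cvgM.
apply: (cvgr_to_le h); apply: (@filterS _ nat_ultra _ _ _ _ filterT) => n _ /=.
by rewrite -cabs_sqr ler_pXn2r// ?nnegrE ?cabs_ge0// cesaro_bound.
Qed.

Lemma cesaro_mean_const (c : Cplx R) : cesaro_mean (Linf_const S c) = c.
Proof.
have E n : cesaro (Linf_const S c) n = c.
  rewrite /cesaro /= sumr_const card_ord -[c *+ _]mulr_natl mulrA.
  rewrite (_ : n.+1%:R = ofreal n.+1%:R); last by rewrite [RHS](rmorph_nat (real_complex R)).
  by rewrite -ofrealM mulVf ?pnatr_eq0// mul1r.
by apply: Cplx_eqP; apply: ulim_eq; apply: cvg_near_cst; apply: (@filterS _ nat_ultra _ _ _ _ filterT)
  => n _ /=; rewrite E.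
Qed.

Lemma cesaro_mean_ge0 phi : (forall s, 0 <= phi s) -> 0 <= cesaro_mean phi.
Proof.
move=> phi0; have [r i] := cesaro_mean_cvg phi.
have c0 n : 0 <= cesaro phi n.
  rewrite /cesaro mulr_ge0 ?sumr_ge0//.
  by rewrite (_ : 0 = ofreal 0)// ofreal_le invr_ge0.
rewrite lecE; apply/andP; split.
  apply/eqP/ulim_eq; apply: cvg_near_cst; apply: (@filterS _ nat_ultra _ _ _ _ filterT) => n _ /=.
  by have [_] := ge0_Cplx (c0 n).
apply: (cvgr_to_ge r); apply: (@filterS _ nat_ultra _ _ _ _ filterT) => n _ /=.
by have [] := ge0_Cplx (c0 n).
Qed.

(** The difference of the two averages telescopes to a difference of two values divided by [n + 1],
    which tends to 0. Only values on the powers of [s0] enter an average, so the hypothesis concerns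
    them alone. *)
Lemma cesaro_mean_shift phi psi :
  (forall k, psi (spow k) = phi (spow k.+1)) -> cesaro_mean psi = cesaro_mean phi.
Proof.
move=> psiE; apply/eqP; rewrite -subr_eq0; apply/eqP.
rewrite -linearB/=; have [K phiK] := LinfvalP phi.
have dE n : cesaro (psi - phi) n =
    ofreal n.+1%:R^-1 * (phi (spow n.+1) - phi (spow 0)).
  rewrite /cesaro; congr (_ * _).
  rewrite -(big_mkord xpredT (fun k => (psi - phi) (spow k))).
  rewrite (_ : _ - phi (spow 0) = \sum_(0 <= k < n.+1)
    (phi (spow k.+1) - phi (spow k))); last by rewrite telescope_sumr.
  apply: eq_bigr => k _ /=.
  by rewrite psiE !mul1r addr0 mulN1r.
have dK n : cabs (cesaro (psi - phi) n) <= (K + K) * n.+1%:R^-1.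
  rewrite dE cabsM cabs_ofreal mulrC ger0_norm// ler_pM2r ?invr_gt0//.
  by rewrite (le_trans (cabsD _ _))// cabsN lerD.
have h0 : (fun n : nat => (K + K) * n.+1%:R^-1) @ \oo --> (0 : R).
  rewrite -[X in _ --> X](mulr0 (K + K)); apply: cvgMl_tmp; exact: cvg_harmonic.
apply: Cplx_eqP; apply: cvg_ulim => /=.
  apply/norm_cvg0P; apply: squeeze_cvgr (cvg_cst 0) h0.
  near=> n; rewrite normr_ge0/=.
  exact: le_trans (ler_reC_cabs _) (dK n).
apply/norm_cvg0P; apply: squeeze_cvgr (cvg_cst 0) h0.
near=> n; rewrite normr_ge0/=.
exact: le_trans (ler_imC_cabs _) (dK n).
Unshelve. all: by end_near. Qed.

End CesaroMean.

(** * Left amenability from the absence of invariant functionals *)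

Section AmenabilityCriterion.
Context {R : realType} {S : semigroupType}.

Lemma linear_cabs_bound (B : normedModType (Cplx R))
    (f : {linear B -> Cplx R}) : continuous f ->
  exists2 K : R, 0 <= K & forall b, `|f b| <= ofreal K * `|b|.
Proof.
move=> cf; have /linear_boundedP := continuous_linear_bounded 0 (cf 0).
move=> /pinfty_ex_gt0[K K0 fK]; exists (reC K); first by have [] := ge0_Cplx (ltW K0).
move=> b; rewrite (_ : ofreal (reC K) = K) ?fK//.
by apply: Cplx_eqP => //=; have [] := ge0_Cplx (ltW K0).
Qed.

Lemma Linf_norm_le (phi : Linf R S) (K : R) : 0 <= K ->
  `|phi| <= ofreal K <-> forall s, cabs (phi s) <= K.
Proof.
move=> K0; rewrite [ `|phi|]/(sup_norm phi) ofreal_le; split=> [h s|h].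
  exact: le_trans (sup_norm_ub phi s) h.
exact: sup_norm_le.
Qed.

Lemma cesaro_mean_is_mean (s0 : S) : is_mean (cesaro_mean s0 : {linear Linf R S -> Cplx R}).
Proof.
pose M : {linear Linf R S -> Cplx R} := cesaro_mean s0.
have Mle (phi : Linf R S) : `|M phi| <= `|phi|.
  rewrite cabsE [ `|phi|]/(sup_norm phi) ofreal_le.
  by apply: cesaro_mean_bound => s; exact: sup_norm_ub.
split.
- apply/bounded_linear_continuous/bounded_funP => r; exists r => x.
  exact: le_trans (Mle x).
- exact: cesaro_mean_ge0.
- have h1 : cabs (M (Linf_const S 1)) = 1.
    by rewrite /= cesaro_mean_const -[1]/(ofreal 1) cabs_ofreal normr1.
  have in1 : [set cabs (M phi) | phi in [set phi : Linf R S | `|phi| <= 1]] 1.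
    exists (Linf_const S 1) => //=.
    by apply/(@Linf_norm_le _ 1) => //= s; rewrite -[1]/(ofreal 1) cabs_ofreal normr1.
  have ub1 : ubound
      [set cabs (M phi) | phi in [set phi : Linf R S | `|phi| <= 1]] 1.
    move=> _ [phi /= phi1 <-]; rewrite -ofreal_le -cabsE.
    exact: le_trans (Mle phi) phi1.
  apply/eqP; rewrite eq_le; apply/andP; split.
    by apply: ge_sup => //; exists 1.
  by apply: ub_le_sup => //; exists 1.
- exact: cesaro_mean_const.
Qed.

Variables (B : normedModType (Cplx R)) (rho : S -> {linear B -> B}).
Hypotheses (rhoP : is_representation rho) (rho_bounded : uniformly_bounded rho).

Lemma coef_bounded (b' : {linear B -> Cplx R}) (b : B) : continuous b' ->
  bounded_pred (fun s => b' (rho s b)).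
Proof.
move=> /linear_cabs_bound[K' K'0 b'K]; have [K rhoK] := rho_bounded.
exists (K' * (K * reC `|b|)) => s.
rewrite -ofreal_le -cabsE; apply: (le_trans (b'K _)).
rewrite !ofrealM (_ : ofreal (reC `|b|) = `|b|).
  by rewrite ler_wpM2l// (_ : 0 = ofreal 0)// ofreal_le.
by apply: Cplx_eqP => //=; have [] := ge0_Cplx (normr_ge0 b).
Qed.

Variable s0 : S.
Hypothesis no_invariant : forall L : {linear B -> Cplx R}, continuous L ->
  (forall b, L (rho s0 b) = L b) -> forall b, L b = 0.

Lemma cesaro_mean_coef (b' : {linear B -> Cplx R}) (b : B) (phi : Linf R S) :
  continuous b' -> (forall s, phi s = b' (rho s b)) -> cesaro_mean s0 phi = 0.
Proof.
move=> cb' phiE.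
pose coef (b : B) : Linf R S := MkLinf (coef_bounded b cb').
pose L (b : B) : Cplx R := cesaro_mean s0 (coef b).
have linL : linear L.
  move=> a x y; rewrite /L -linearP; congr (cesaro_mean s0 _).
  by apply: LinfP => s /=; rewrite linearP/= linearP/= mul1r addr0.
pose LisL := GRing.isLinear.Build (Cplx R) B (Cplx R) *%R L linL.
pose L' : {linear B -> Cplx R} := HB.pack L LisL.
suff : L' b = 0.
  by move=> /= <-; rewrite /L; congr (cesaro_mean s0 _); apply: LinfP => s.
apply: no_invariant => [|c].
  have [K' K'0 b'K] := linear_cabs_bound cb'; have [K rhoK] := rho_bounded.
  apply/bounded_linear_continuous/bounded_funP => r.
  exists (ofreal (K' * (`|K| * `|reC r|))) => x xr.
  (* The bound [r] ranges over [Cplx R]; being above a norm makes it real. *)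
  have rE : r = ofreal (reC r).
    by apply: Cplx_eqP => //=; have [] := ge0_Cplx (le_trans (normr_ge0 x) xr).
  rewrite cabsE ofreal_le; apply: cesaro_mean_bound => s /=.
  rewrite -ofreal_le -cabsE; apply: (le_trans (b'K _)).
  rewrite ofrealM ler_wpM2l//; first by rewrite (_ : 0 = ofreal 0)// ofreal_le.
  apply: (le_trans (rhoK _ _)); rewrite ofrealM.
  apply: (@le_trans _ _ (ofreal `|K| * `|x|)).
    by rewrite ler_wpM2r// ofreal_le ler_norm.
  rewrite ler_wpM2l//; first by rewrite (_ : 0 = ofreal 0)// ofreal_le.
  by rewrite (le_trans xr)// [leLHS]rE ofreal_le ler_norm.
rewrite /= /L; apply: cesaro_mean_shift => k /=.
congr (b' _); rewrite -rhoP.2; congr (rho _ c).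
(* By associativity [spow k * s0] equals [spow k.+1], so the factor [s0] on the right acts as a
   shift along the powers. *)
by elim: k => //= k ih; rewrite -mulgA ih.
Qed.

(** Coefficients and their translates have mean 0, and linearity gives the span. For the closure, an
    [e]-approximation in sup norm bounds the mean by [e], and translation does not increase the sup
    norm. *)
Lemma cesaro_mean_Yspace (phi : Linf R S) (s : S) : Yspace rho phi ->
  cesaro_mean s0 phi = 0 /\ cesaro_mean s0 (ltrans s phi) = 0.
Proof.
have [rhoc rhoM] := rhoP => Yphi.
suff small e : 0 < e -> cabs (cesaro_mean s0 phi) <= e /\
    cabs (cesaro_mean s0 (ltrans s phi)) <= e.
  by split; apply: cabs_eq0; apply/eqP; rewrite eq_le cabs_ge0 andbT;
    apply/ler_addgt0Pr => e /small[]; rewrite add0r.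
move=> e0; have e0' : 0 < ofreal e by rewrite (_ : 0 = ofreal 0)// ofreal_lt.
have [psi [[n [a [f [fcoef psiE]]]] /ltW]] := Yphi _ (nbhsx_ballx phi _ e0').
rewrite -[ `|phi - psi|]/(sup_norm _) => /(Linf_norm_le _ (ltW e0)) pe.
have f0 i : cesaro_mean s0 (f i) = 0 /\ cesaro_mean s0 (ltrans s (f i)) = 0.
  have [b [b' [cb' fE]]] := fcoef i; split; first exact: cesaro_mean_coef fE.
  have lin' : linear (b' \o rho s).
    by move=> c x y /=; rewrite !linearP.
  pose lL := GRing.isLinear.Build (Cplx R) B (Cplx R) *%R _ lin'.
  (* The functional whose coefficient at [b] is the translate of [f i] by [s]. *)
  pose bs : {linear B -> Cplx R} := HB.pack (b' \o rho s) lL.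
  apply: (@cesaro_mean_coef bs b); last by move=> t; rewrite /= fE rhoM.
  by move=> x; apply: continuous_comp; [exact: rhoc|exact: cb'].
have psi0 : cesaro_mean s0 psi = 0.
  rewrite psiE linear_sum big1// => i _; rewrite linearZ/=.
  by rewrite (f0 i).1 mulr0.
have spsi0 : cesaro_mean s0 (ltrans s psi) = 0.
  rewrite (_ : ltrans s psi = \sum_(i < n) a i *: ltrans s (f i)).
    by rewrite linear_sum big1// => i _; rewrite linearZ/= (f0 i).2 mulr0.
  rewrite {}psiE; elim/big_ind2 : _ => [|x1 x2 y1 y2 <- <-|i _];
    by apply: LinfP => t.
split.
  rewrite -[cesaro_mean _ _]subr0 -psi0 -linearB; exact: cesaro_mean_bound.
rewrite -[cesaro_mean _ _]subr0 -spsi0 -linearB; apply: cesaro_mean_bound => t.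
exact: pe.
Qed.

Lemma left_amenable_of_no_invariant : left_amenable rho.
Proof.
split=> //; exists (cesaro_mean s0 : {linear Linf R S -> Cplx R}).
  exact: cesaro_mean_is_mean.
move=> _ [n [a [f [fX ->]]]] s.
rewrite (_ : ltrans s _ = \sum_(i < n) a i *: ltrans s (f i)).
  rewrite !linear_sum; apply: eq_bigr => i _; rewrite !linearZ/=.
  have [/(cesaro_mean_Yspace s)[-> ->]//|[c _ <-]] := fX i.
  by rewrite (_ : ltrans s _ = Linf_const S c)//; apply: LinfP => t.
by elim/big_ind2 : _ => [|x1 x2 y1 y2 <- <-|i _]; apply: LinfP => t.
Qed.

End AmenabilityCriterion.

(** * Duality between integrable and bounded functions *)

Lemma measurable_invr (R : realType) : measurable_fun [set: R] (@GRing.inv R).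
Proof.
rewrite -(setUv [set (0 : R)]); apply/measurable_funU => //.
  exact: measurableC.
split; first exact: measurable_fun_set1.
apply: open_continuous_measurable_fun.
  by apply: closed_openC; exact: closed_eq.
by move=> x /set_mem /= /eqP x0; exact: inv_continuous.
Qed.

Import HBNNSimple.

Section RealDuality.
Context d (T : measurableType d) (R : realType).

Section Functional.
Variable mu : {measure set T -> \bar R}.
Local Notation integ f := (mu.-integrable [set: T] (EFin \o f)).

(** A bounded functional on real L_1, acting on functions instead of classes: its values at
    non-integrable functions are arbitrary, and [bf_le] makes it blind to null sets. *)
Record bounded_functional (K : R) (Phi : (T -> R) -> R) : Prop := {
  bfD : forall f g, integ f -> integ g ->
    Phi (fun x => f x + g x) = Phi f + Phi g;
  bfZ : forall a f, integ f -> Phi (fun x => a * f x) = a * Phi f;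
  bf_le : forall f, integ f -> `|Phi f| <= K * \int[mu]_x `|f x| }.

Variables (K : R) (Phi : (T -> R) -> R).
Hypothesis PhiP : bounded_functional K Phi.

Lemma integ_measurable (f : T -> R) : integ f -> measurable_fun setT f.
Proof. by move=> /measurable_int /measurable_EFinP. Qed.

Lemma le_integ (f g : T -> R) : measurable_fun setT f -> integ g ->
  (forall x, `|f x| <= g x) -> integ f.
Proof.
move=> mf ig fg; apply: le_integrable ig => //; first exact/measurable_EFinP.
by move=> x _; rewrite /= lee_fin (le_trans (fg x))// ler_norm.
Qed.

Lemma integD (f g : T -> R) : integ f -> integ g -> integ (fun x => f x + g x).
Proof. by move=> fi gi; have := integrableD measurableT fi gi. Qed.

Lemma integZ a (f : T -> R) : integ f -> integ (fun x => a * f x).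
Proof. by move=> fi; have := integrableZl measurableT a fi. Qed.

Lemma integB (f g : T -> R) : integ f -> integ g -> integ (fun x => f x - g x).
Proof. by move=> fi gi; have := integrableB measurableT fi gi. Qed.

Lemma bfB f g : integ f -> integ g -> Phi (fun x => f x - g x) = Phi f - Phi g.
Proof.
move=> fi gi; have -> : (fun x => f x - g x) = (fun x => f x + -1 * g x).
  by apply/funext => x; rewrite mulN1r.
by rewrite (bfD PhiP) ?(bfZ PhiP) ?mulN1r//; exact: integZ.
Qed.

(** Dominated convergence turns pointwise convergence into convergence in the mean, and [bf_le]
    passes this on to [Phi]. *)
Lemma bf_cvg (f_ : nat -> T -> R) (f g : T -> R) :
  (forall n, measurable_fun setT (f_ n)) -> integ g ->
  (forall n x, `|f_ n x| <= g x) ->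
  (forall x, f_ n x @[n --> \oo] --> f x) ->
  Phi (f_ n) @[n --> \oo] --> Phi f.
Proof.
move=> mf ig fg ff.
have ifn n : integ (f_ n) by apply: le_integ ig _.
have mlim : measurable_fun setT f.
  by apply: measurable_fun_cvg => [n|x _]; [exact: mf|exact: ff].
have fi : integ f.
  apply: le_integ ig _ => // x.
  by apply: (cvgr_to_le (cvg_norm (ff x))); apply: nearW => n.
have ff' x : setT x -> (f_ n x)%:E @[n --> \oo] --> (f x)%:E.
  by move=> _; apply: cvg_EFin; [exact: nearW|exact: ff].
have [_ h _] := @dominated_convergence _ _ _ mu setT measurableT
  (fun n => EFin \o f_ n) (EFin \o f) (EFin \o g)
  (fun n => (measurable_EFinP _ _).2 (mf n)) ((measurable_EFinP _ _).2 mlim)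
  (aeW _ ff') ig
  (aeW _ (fun x n _ => (fg n x : (`|(f_ n x)%:E| <= (g x)%:E)%E))).
have h' : (K * \int[mu]_x `|f_ n x - f x|) @[n --> \oo] --> (0 : R).
  rewrite -[X in _ --> X](mulr0 K); apply: cvgMl_tmp.
  by move/fine_cvg : h.
apply/subr_cvg0/norm_cvg0P; apply: squeeze_cvgr (cvg_cst 0) h'.
near=> n; rewrite normr_ge0 -bfB//=.
exact: (bf_le PhiP (integB (ifn n) fi)).
Unshelve. all: by end_near. Qed.

(** On the set where [u] is positive its integral is both nonnegative and nonpositive, so that set
    is null. *)
Lemma ae_le0 (u : T -> R) : integ u ->
  (forall B, measurable B -> (\int[mu]_(x in B) (u x)%:E <= 0)%E) ->
  {ae mu, forall x, u x <= 0}.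
Proof.
move=> iu u0; pose B := [set x | 0 < u x].
have mu_ := integ_measurable iu.
have mB : measurable B.
  by rewrite -[B]setTI; exact: (measurable_fun_ltr (measurable_cst (0 : R)) mu_).
have : (\int[mu]_(x in B) `|(u x)%:E| = 0)%E.
  apply/eqP; rewrite eq_le integral_ge0// andbT.
  rewrite (eq_integral (fun x => (u x)%:E)) ?u0// => x /set_mem Bx.
  by rewrite gee0_abs// lee_fin ltW.
have mBu : measurable_fun B (EFin \o u).
  by apply/measurable_EFinP; exact: measurable_funTS.
move/(ae_eq_integral_abs mu mB mBu); apply: filterS => x ux.
by rewrite leNgt; apply/negP => ux0; have := ux ux0 => -[]; apply/eqP; rewrite gt_eqF.
Qed.

Variable w : T -> R.
Hypotheses (iw : integ w) (w0 : forall x, 0 < w x).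

(** Indicators may fail to be integrable when [mu] is infinite; multiplied by the positive
    integrable weight they are, and they still determine a bounded functional. *)
Lemma integ_indic (B : set T) : measurable B -> integ (fun x => w x * \1_B x).
Proof.
move=> mB; apply: le_integ iw _ => [|x].
  by apply: measurable_funM; [exact: integ_measurable|exact: measurable_indic].
rewrite normrM ger0_norm ?(ltW (w0 x))// indicE.
by rewrite ler_piMr ?(ltW (w0 x))// ger0_norm// lern1 leq_b1.
Qed.

Lemma bf_sum (n : nat) (c : 'I_n -> R) (f : 'I_n -> T -> R) :
  (forall i, integ (f i)) ->
  Phi (fun x => \sum_(i < n) c i * f i x) = \sum_(i < n) c i * Phi (f i) /\
  integ (fun x => \sum_(i < n) c i * f i x).
Proof.
move=> fi; elim: n c f fi => [|n ih] c f fi.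
  (* The empty sum is written as [0 * w] so that homogeneity of [Phi] gives the value 0. *)
  have E0 : (fun x => \sum_(i < 0) c i * f i x) = (fun x => 0 * w x).
    by apply/funext => x; rewrite big_ord0 mul0r.
  rewrite E0 (bfZ PhiP)// mul0r big_ord0; split=> //; exact: integZ.
have [ih1 ih2] := ih (fun i => c (lift ord0 i)) (fun i => f (lift ord0 i))
  (fun i => fi _).
have -> : (fun x => \sum_(i < n.+1) c i * f i x) = (fun x => c ord0 * f ord0 x +
    \sum_(i < n) c (lift ord0 i) * f (lift ord0 i) x).
  by apply/funext => x; rewrite big_ord_recl.
rewrite (bfD PhiP)//; last exact: integZ.
rewrite (bfZ PhiP)// ih1 big_ord_recl; split=> //.
by apply: integD => //; exact: integZ.
Qed.

(** For [f >= 0], approximate [f / w] from below by simple functions: multiplied by [w] they are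
    combinations of the [w * \1_B], dominated by [f] and converging to it, so [bf_cvg] applies. The
    general case splits [f] into positive and negative parts. *)
Lemma bf_eq0 : (forall B, measurable B -> Phi (fun x => w x * \1_B x) = 0) ->
  forall f, integ f -> Phi f = 0.
Proof.
move=> Phi0.
suff ge0 f : integ f -> (forall x, 0 <= f x) -> Phi f = 0.
  move=> f fi; rewrite -(funrposBneg f).
  have ip : integ f^\+ by exact: integrable_funrpos.
  have in_ : integ f^\- by exact: integrable_funrneg.
  by rewrite [LHS](bfB ip in_) !ge0 ?subrr.
move=> fi f0; pose h x := (f x / w x)%:E.
have mh : measurable_fun setT h.
  apply/measurable_EFinP; apply: measurable_funM; first exact: integ_measurable.
  by apply: measurableT_comp; [exact: measurable_invr|exact: integ_measurable].
pose s := nnsfun_approx measurableT mh.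
have h0 x : setT x -> (0 <= h x)%E by move=> _; rewrite lee_fin divr_ge0// ltW.
have sh x : (s n x)%:E @[n --> \oo] --> h x.
  exact: (cvg_nnsfun_approx measurableT mh h0).
have sf n : Phi (fun x => w x * s n x) = 0.
  pose c := fset_set (range (s n)).
  have -> : (fun x => w x * s n x) = (fun x => \sum_(i < size c)
      c`_i * (w x * \1_(s n @^-1` [set c`_i]) x)).
    apply/funext => x; rewrite fimfunEord mulr_sumr.
    by apply: eq_bigr => i _; rewrite mulrCA.
  have [] := @bf_sum (size c) (fun i => c`_i)
    (fun i x => w x * \1_(s n @^-1` [set c`_i]) x).
    by move=> i; exact: integ_indic.
  by move=> -> _; rewrite big1// => i _; rewrite Phi0 ?mulr0.
have : Phi (fun x => w x * s n x) @[n --> \oo] --> Phi f.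
  have swf n x : 0 <= w x * s n x <= f x.
    apply/andP; split; first by rewrite mulr_ge0// ltW.
    rewrite mulrC -ler_pdivlMr// -lee_fin.
    apply: (cvge_to_ge (sh x)); near=> m; rewrite lee_fin.
    have := nd_nnsfun_approx measurableT mh; move=> /(_ n m).
    have nm : (n <= m)%N by near: m; exact: nbhs_infty_ge.
    by move=> /(_ nm)/lefP; exact.
  apply: bf_cvg fi _ _ => [n|n x|x].
  - by apply: measurable_funM => //; exact: integ_measurable.
  - by have /andP[? ?] := swf n x; rewrite ger0_norm.
  - have -> : f x = w x * fine (h x) by rewrite /= mulrCA divff ?mulr1// gt_eqF.
    by apply: cvgMl_tmp; exact: fine_cvg (sh x).
by under eq_fun do rewrite sf; move=> /cvg_lim <-//; rewrite lim_cst.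
Unshelve. all: by end_near. Qed.
End Functional.

Variables (mu : {sigma_finite_measure set T -> \bar R}) (w : T -> R) (K : R).
Local Notation integ f := (mu.-integrable [set: T] (EFin \o f)).
Hypotheses (iw : integ w) (w0 : forall x, 0 < w x) (K0 : 0 <= K).

(* [m] is the Radon-Nikodym derivative of [B |-> Phi (w * \1_B)] with respect
   to [w * mu]; the weight makes both measures finite. *)
Lemma bounded_functional_repr (Phi : (T -> R) -> R) :
  bounded_functional mu K Phi ->
  exists m : T -> R, [/\ measurable_fun setT m, forall x, `|m x| <= K &
    forall f, integ f -> Phi f = \int[mu]_x (f x * m x)].
Proof.
move=> PhiP; have mw := integ_measurable iw.
pose kappa B := (Phi (fun x => w x * \1_B x))%:E.
have kappa0 : kappa set0 = 0%E.
  have E0 : (fun x => w x * \1_(set0 : set T) x) = (fun x => 0 * w x).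
    by apply/funext => x; rewrite indic0 mulr0 mul0r.
  by rewrite /kappa E0 (bfZ PhiP)// mul0r.
have kappa_fin B : measurable B -> kappa B \is a fin_num by [].
(* The partial sums of the indicators of disjoint sets converge to the indicator of the union and
   stay between 0 and 1, so [w] dominates and [bf_cvg] applies. *)
have kappa_sigma : semi_sigma_additive kappa.
  move=> F mF tF mUF.
  have -> : (fun n => \sum_(0 <= i < n) kappa (F i))%E =
      (fun n => (Phi (fun x => w x * \sum_(i < n) \1_(F i) x))%:E).
    apply/funext => n; rewrite big_mkord /kappa sumEFin; congr EFin.
    have [] := @bf_sum _ _ _ PhiP _ iw n (fun=> 1) (fun i x => w x * \1_(F i) x).
      by move=> i; exact: integ_indic.
    move=> h _; rewrite -[RHS](_ : Phi (fun x => \sum_(i < n) 1 * (w x * \1_(F i) x)) = _).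
      by rewrite h; apply: eq_bigr => i _; rewrite mul1r.
    congr Phi; apply/funext => x; rewrite mulr_sumr.
    by apply: eq_bigr => i _; rewrite mul1r.
  have s1 n x : 0 <= \sum_(i < n) (\1_(F i) x : R) <= 1.
    apply/andP; split; first by apply: sumr_ge0 => i _; rewrite indicE.
    have [[i Fix]|nFx] := pselect (exists i : 'I_n, F i x).
      rewrite (bigD1 i)//= big1 ?addr0 ?indicE ?lern1 ?leq_b1// => j ji.
      rewrite indicE memNset// => Fjx; move/eqP: ji; apply; apply/val_inj.
      by apply: (tF j i Logic.I Logic.I); exists x.
    rewrite big1// => i _; rewrite indicE memNset// => Fix.
    by apply: nFx; exists i.
  apply: cvg_EFin; first exact: nearW.
  apply: (bf_cvg PhiP _ iw) => [n|n x|x].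
  - apply: measurable_funM => //; apply: measurable_sum => i.
    exact: measurable_indic.
  - have /andP[s0 s1'] := s1 n x.
    by rewrite normrM !ger0_norm ?(ltW (w0 x))// ler_piMr// ltW.
  - apply: cvgMl_tmp.
    have [[i _ Fix]|nFx] := pselect ((\bigcup_i F i) x).
      rewrite indicE mem_set; last by exists i.
      apply: cvg_near_cst; exists i.+1 => // n /= ni.
      rewrite (bigD1 (Ordinal ni))//= big1 ?addr0 ?indicE ?mem_set// => j ji.
      rewrite indicE memNset// => Fjx; move/eqP: ji; apply; apply/val_inj.
      by apply: (tF j i Logic.I Logic.I); exists x.
    rewrite indicE memNset//; apply: cvg_near_cst; apply: nearW => n.
    rewrite big1// => i _; rewrite indicE memNset// => Fix.
    by apply: nFx; exists i.
pose nu : {charge set T -> \bar R} :=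
  HB.pack kappa (isCharge.Build _ _ _ kappa kappa0 kappa_fin kappa_sigma).
have kappaK B : measurable B -> `|Phi (fun x => w x * \1_B x)| <=
    K * \int[mu]_x (w x * \1_B x).
  move=> mB; rewrite (le_trans (bf_le PhiP (integ_indic iw w0 mB)))//.
  rewrite (@eq_Rintegral _ _ _ mu _ (fun x => w x * \1_B x))// => x _.
  by rewrite ger0_norm// mulr_ge0 ?(ltW (w0 x))// indicE.
have int_indic (f : T -> R) B : measurable B ->
    (\int[mu]_x (f x * \1_B x)%:E = \int[mu]_(x in B) (f x)%:E)%E.
  move=> mB; rewrite [RHS]integral_mkcond; apply: eq_integral => x _.
  by rewrite patchE indicE; case: ifPn => xB; rewrite ?mulr1// mulr0.
have nu_mu : nu `<< mu.
  apply/null_content_dominatesP => B mB muB0; congr EFin; apply/normr0_eq0.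
  apply/eqP; rewrite eq_le normr_ge0 andbT (le_trans (kappaK _ mB))//.
  rewrite /Rintegral int_indic// null_set_integral ?mulr0//.
  by apply/measurable_EFinP; exact: measurable_funTS.
pose g := Radon_Nikodym nu mu.
have gfin x : g x \is a fin_num by exact: Radon_Nikodym_fin_num.
have ig : integ (fine \o g).
  rewrite (_ : EFin \o _ = g); first exact: Radon_Nikodym_integrable.
  by apply/funext => x /=; rewrite fineK.
have mg := integ_measurable ig.
have PhiB B : measurable B -> Phi (fun x => w x * \1_B x) =
    \int[mu]_x (fine (g x) * \1_B x).
  move=> mB; apply: EFin_inj; rewrite /Rintegral int_indic// fineK.
    rewrite -[LHS]/(nu B) (Radon_Nikodym_integral nu_mu mB).
    by apply: eq_integral => x _; rewrite fineK.
  by apply: integrable_fin_num => //; exact: integrableS ig.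
(* The choices 1 and -1 of [c] yield [|g| <= K * w] almost everywhere: over every measurable [B] the
   integral of [c * g - K * w] is at most 0 by [kappaK]. *)
have gw (c : R) : `|c| = 1 -> {ae mu, forall x, c * fine (g x) <= K * w x}.
  move=> c1.
  have iu : integ (fun x => c * fine (g x) - K * w x).
    by apply: integB; exact: integZ.
  suff : {ae mu, forall x, c * fine (g x) - K * w x <= 0}.
    by apply: filterS => x; rewrite subr_le0.
  apply: (ae_le0 iu) => B mB.
  rewrite -int_indic// -[leLHS]fineK; last first.
    rewrite int_indic//; apply: integrable_fin_num => //; exact: integrableS iu.
  rewrite lee_fin -[fine _]/(\int[mu]_x ((c * fine (g x) - K * w x) * \1_B x)).
  have -> : (fun x => (c * fine (g x) - K * w x) * \1_B x) =
      (fun x => c * (fine (g x) * \1_B x) - K * (w x * \1_B x)).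
    by apply/funext => x; rewrite mulrBl !mulrA.
  have i1 : integ (fun x => fine (g x) * \1_B x).
    apply: le_integ (integrable_norm ig) _ => [|x].
      by apply: measurable_funM => //; exact: measurable_indic.
    by rewrite normrM ler_piMr// indicE ger0_norm// lern1 leq_b1.
  have i2 := integ_indic iw w0 mB.
  rewrite RintegralB//; [|exact: integZ..].
  rewrite !RintegralZl// -PhiB// subr_le0 (le_trans _ (kappaK _ mB))//.
  by rewrite (le_trans (ler_norm _))// normrM c1 mul1r.
(* Truncation to [[-K, K]] makes the bound hold at every point; by [gw] it alters [g / w] on a null
   set only. *)
pose m x := Num.max (- K) (Num.min K (fine (g x) / w x)).
have mm : measurable_fun setT m.
  apply: measurable_maxr => //; apply: measurable_minr => //.
  apply: measurable_funM => //; apply: measurableT_comp => //.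
  exact: measurable_invr.
have mK x : `|m x| <= K.
  rewrite ler_norml /m le_max lexx/= ge_max ge_min lexx/= andbT.
  by rewrite (le_trans _ K0)// oppr_le0.
have mE : {ae mu, forall x, fine (g x) = w x * m x}.
  have h1 := gw 1 (normr1 _); have h2 := gw (-1) (normrN1 _).
  apply: filterS2 h1 h2 => x; rewrite mul1r mulN1r => h1 h2.
  rewrite /m; have -> : Num.min K (fine (g x) / w x) = fine (g x) / w x.
    by apply/min_idPr; rewrite ler_pdivrMr.
  have -> : Num.max (- K) (fine (g x) / w x) = fine (g x) / w x.
    by apply/max_idPr; rewrite ler_pdivlMr// mulNr lerNl.
  by rewrite mulrCA divff ?mulr1// gt_eqF.
exists m; split=> // f fi.
have im h : integ h -> integ (fun x => h x * m x).
  move=> hi; apply: (le_integ _ (integZ K (integrable_norm hi))) => [|x].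
    by apply: measurable_funM; [exact: (integ_measurable hi)|exact: mm].
  by rewrite normrM mulrC ler_pM.
(* The error functional is bounded, with constant [K + K], and vanishes on the functions [w * \1_B];
   by [bf_eq0] it vanishes on all integrable functions. *)
pose Lam (h : T -> R) := Phi h - \int[mu]_x (h x * m x).
have LamP : bounded_functional mu (K + K) Lam.
  split=> [h1 h2 i1 i2|a h hi|h hi]; rewrite /Lam.
  - rewrite (bfD PhiP)//.
    under eq_Rintegral do rewrite mulrDl.
    by rewrite RintegralD//; [rewrite opprD addrACA|exact: im|exact: im].
  - rewrite (bfZ PhiP)//; under eq_Rintegral do rewrite -mulrA.
    by rewrite RintegralZl//; [rewrite mulrBr|exact: im].
  - rewrite (le_trans (ler_normB _ _))// mulrDl lerD//; first exact: (bf_le PhiP hi).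
    rewrite (le_trans (le_normr_Rintegral measurableT (im _ hi)))//.
    rewrite -RintegralZl//; last exact: integrable_norm.
    apply: le_Rintegral => //; first exact: (integrable_norm (im _ hi)).
      exact: (integZ _ (integrable_norm hi)).
    by move=> x _; rewrite normrM mulrC ler_pM.
apply/eqP; rewrite -subr_eq0; apply/eqP/(bf_eq0 LamP iw w0 _ fi) => B mB.
rewrite /Lam PhiB//; apply/eqP; rewrite subr_eq0; apply/eqP; congr fine.
apply: ae_eq_integral => //.
- apply/measurable_EFinP; apply: measurable_funM => //; exact: measurable_indic.
- apply/measurable_EFinP; apply: measurable_funM => //.
  by apply: measurable_funM => //; exact: measurable_indic.
- by apply: filterS mE => x -> _; rewrite mulrAC.
Qed.

End RealDuality.

Section ComplexDuality.
Context d (T : measurableType d) (R : realType).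
Variables (mu : {sigma_finite_measure set T -> \bar R}) (A : set T).
Implicit Types (h : T -> Cplx R) (f : T -> R).
Local Notation integ f := (mu.-integrable [set: T] (EFin \o f)).

Definition toL1 h : L1space mu A :=
  if pselect (L1_pred mu A h) is left H then \pi_(L1space mu A) (MkL1fun H)
  else 0.

Lemma toL1E h : L1_pred mu A h -> L1rep (toL1 h) = h %[ae mu].
Proof. by rewrite /toL1; case: pselect => // H _; exact: L1pi. Qed.

Lemma toL1_comb a h1 h2 : L1_pred mu A h1 -> L1_pred mu A h2 ->
  toL1 (fun x => a * h1 x + h2 x) = a *: toL1 h1 + toL1 h2.
Proof.
move=> H1 H2; apply/L1space_eqP.
have H12 : L1_pred mu A (fun x => a * h1 x + h2 x) by exact: L1_pred_comb.
near=> x => Ix.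
rewrite (near (toL1E H12) x)// (near (L1addE (a *: toL1 h1) (toL1 h2)) x)//.
rewrite (near (L1scaleE a (toL1 h1)) x)//.
by rewrite (near (toL1E H1) x)// (near (toL1E H2) x).
Unshelve. all: by end_near. Qed.

Lemma L1_integ h : L1_pred mu A h -> integ (cabs \o h).
Proof.
move=> [mh ih _]; apply/integrableP; split; first exact: measurable_cabs.
under eq_integral => x _ do rewrite gee0_abs ?lee_fin ?cabs_ge0//.
exact: ih.
Qed.

Lemma toL1_norm h : L1_pred mu A h ->
  `|toL1 h| = ofreal (\int[mu]_x cabs (h x)).
Proof.
move=> H; rewrite -[LHS]/(ofreal _); congr (ofreal (fine _)).
apply: eq_int_cabs; last exact: toL1E.
  by have [] := L1repP (toL1 h).
by have [] := H.
Qed.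

Variables (w : T -> R) (A0 : set T).
Hypotheses (iw : integ w) (w0 : forall x, 0 < w x) (mA0 : measurable A0).
Hypothesis AA0 : {ae mu, forall x, A x <-> A0 x}.

(** [A0] is a measurable replacement of [A]: the embedded function is measurable and vanishes off
    [A] almost everywhere. The cases [c = 1] and [c = i] carry the real and imaginary parts. *)
Let emb (c : Cplx R) f x : Cplx R := c * ofreal (f x * \1_A0 x).

Let indic_le (f : T -> R) x : `|f x * \1_A0 x| <= `|f x|.
Proof. by rewrite normrM ler_piMr// indicE ger0_norm// lern1 leq_b1. Qed.

Let emb_L1 c f : integ f -> L1_pred mu A (emb c f).
Proof.
move=> fi; have mf := integ_measurable fi.
have mf1 : measurable_fun setT (fun x => f x * \1_A0 x).
  by apply: measurable_funM => //; exact: measurable_indic.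
have memb : measurable_cplx (emb c f).
  split.
    rewrite (_ : _ \o _ = fun x => reC c * (f x * \1_A0 x)).
      exact: measurable_funM.
    by apply/funext => x; rewrite /= reCM /= mulr0 subr0.
  rewrite (_ : _ \o _ = fun x => imC c * (f x * \1_A0 x)).
    exact: measurable_funM.
  by apply/funext => x; rewrite /= imCM /= mulr0 add0r.
split => //.
  have /integrableP[_] := integZ (cabs c) (integrable_norm fi).
  apply: le_lt_trans; apply: ge0_le_integral => //.
  - by move=> x _; rewrite lee_fin cabs_ge0.
  - exact: measurable_cabs.
  - apply: measurableT_comp => //; apply/measurable_EFinP.
    by apply: measurable_funM => //; exact: measurableT_comp.
  - move=> x _ /=; rewrite lee_fin /emb cabsM cabs_ofreal.
    by apply: (le_trans _ (ler_norm _)); rewrite ler_wpM2l ?cabs_ge0// indic_le.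
apply: filterS AA0 => x AA x0; rewrite /emb indicE memNset ?mulr0//; last by move/AA.
Qed.

(** If [m1] and [m2] represent the real functionals [Re L(f)] and [Re L(i f)] of a real function
    [f], then on [A0] the density [m = m1 - i m2] satisfies [Re(f m) = Re f * m1 + Im f * m2] for
    complex [f]. The imaginary part of [L] is recovered from the real part at [i f]. *)
Lemma L1_dual_repr (L : {linear L1space mu A -> Cplx R}) : continuous L ->
  exists m : T -> Cplx R, [/\ measurable_cplx m,
    exists K : R, forall x, cabs (m x) <= K, forall x, ~ A0 x -> m x = 0 &
    forall f : L1space mu A, reC (L f) = \int[mu]_x reC (f x * m x)].
Proof.
move=> /linear_cabs_bound[K K0 LK].
pose Phi c f := reC (L (toL1 (emb c f))).
have PhiP c : cabs c = 1 -> bounded_functional mu K (Phi c).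
  move=> c1; split=> [f g fi gi|a f fi|f fi]; rewrite /Phi.
  - rewrite (_ : emb c _ = fun x => 1 * emb c f x + emb c g x).
      by rewrite toL1_comb ?scale1r ?linearD ?reCD//; exact: emb_L1.
    by apply/funext => x; rewrite mul1r /emb mulrDl ofrealD mulrDr.
  - rewrite (_ : emb c _ = fun x => ofreal a * emb c f x + emb c (fun=> 0) x).
      have i0 : integ (fun=> 0 : R).
        by rewrite (_ : EFin \o _ = cst 0%E)//; exact: integrable0.
      rewrite toL1_comb; [|exact: emb_L1..].
      have -> : toL1 (emb c (fun=> 0)) = 0.
        apply/L1space_eqP; have := toL1E (emb_L1 c i0).
        apply: filterS2 (@L1zeroE _ _ _ mu A) => x z h Ix; rewrite h// z//.
        by rewrite /emb mul0r (_ : ofreal 0 = 0)// mulr0.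
      by rewrite addr0 linearZ/= reCM/= mul0r subr0.
    apply/funext => x; rewrite /emb mul0r (_ : ofreal 0 = 0)// mulr0 addr0.
    by rewrite mulrCA -ofrealM mulrA.
  - rewrite (le_trans (ler_reC_cabs _))// -ofreal_le -cabsE (le_trans (LK _))//.
    rewrite toL1_norm; last exact: emb_L1.
    rewrite -ofrealM ofreal_le ler_wpM2l// le_Rintegral//.
    + exact: (L1_integ (emb_L1 c fi)).
    + exact: integrable_norm.
    + by move=> x _; rewrite /emb cabsM c1 mul1r cabs_ofreal indic_le.
have c1 : cabs (1 : Cplx R) = 1 by rewrite -[1]/(ofreal 1) cabs_ofreal normr1.
have ci : cabs (Complex 0 1 : Cplx R) = 1.
  by rewrite cabs_sqrt/= expr0n/= add0r expr1n sqrtr1.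
have [m1 [mm1 m1K m1E]] := bounded_functional_repr iw w0 K0 (PhiP _ c1).
have [m2 [mm2 m2K m2E]] := bounded_functional_repr iw w0 K0 (PhiP _ ci).
pose m x : Cplx R := Complex (m1 x * \1_A0 x) (- (m2 x * \1_A0 x)).
exists m; split.
- split.
    rewrite -[_ \o _]/(fun x => m1 x * \1_A0 x).
    by apply: measurable_funM => //; exact: measurable_indic.
  rewrite -[_ \o _]/(fun x => - (m2 x * \1_A0 x)).
  apply: measurableT_comp => //.
  by apply: measurable_funM => //; exact: measurable_indic.
- exists (K + K) => x; rewrite (le_trans (cabs_le_reC_imC _))// lerD//.
    by rewrite (le_trans (indic_le _ _)).
  by rewrite /= normrN (le_trans (indic_le _ _)).
- by move=> x x0; rewrite /m indicE memNset// !mulr0 oppr0.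
move=> f; have [[mfr mfi] Hf2 Hf0] := L1repP f.
have Hf := L1repP f.
have ir : integ (reC \o f).
  apply: (@le_integ _ _ _ mu _ (cabs \o f) mfr (L1_integ Hf)) => x; exact: ler_reC_cabs.
have ii : integ (imC \o f).
  apply: (@le_integ _ _ _ mu _ (cabs \o f) mfi (L1_integ Hf)) => x; exact: ler_imC_cabs.
have fE : f = toL1 (emb 1 (reC \o f)) + toL1 (emb (Complex 0 1) (imC \o f)).
  rewrite -[X in X + _]scale1r -toL1_comb; [|exact: emb_L1..].
  have H : L1_pred mu A (fun x => 1 * emb 1 (reC \o f) x +
      emb (Complex 0 1) (imC \o f) x).
    exact: (L1_pred_comb 1 (emb_L1 1 ir) (emb_L1 (Complex 0 1) ii)).
  apply/L1space_eqP; near=> x => Ix.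
  rewrite (near (toL1E H) x)// !mul1r /emb.
  have AAx : A x <-> A0 x by near: x; exact: AA0.
  have Ax0 : ~ A x -> f x = 0 by near: x; exact: Hf0.
  have [A0x|nA0x] := pselect (A0 x).
    rewrite indicE mem_set// !mulr1.
    by apply: Cplx_eqP; rewrite ?reCD ?imCD ?reCM ?imCM /=; ring.
  rewrite indicE memNset// !mulr0 addr0.
  by apply: Ax0 => /AAx.
rewrite {1}fE linearD reCD -/(Phi _ _) -/(Phi _ _) m1E// m2E//.
have im (g : T -> R) (n : T -> R) : integ g -> measurable_fun setT n ->
    (forall x, `|n x| <= K) -> integ (fun x => g x * n x).
  move=> gi mn nK; apply: (le_integ _ (integZ K (integrable_norm gi))) => [|x].
    by apply: measurable_funM => //; exact: (integ_measurable gi).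
  by rewrite normrM mulrC ler_pM.
have i1 := im _ _ ir mm1 m1K; have i2 := im _ _ ii mm2 m2K.
rewrite -RintegralD//; congr fine; apply: ae_eq_integral => //.
- exact: (measurable_int _ (integD i1 i2)).
- apply/measurable_EFinP.
  rewrite (_ : (fun x => _) = fun x => (reC \o f) x * (m1 x * \1_A0 x) +
      (imC \o f) x * (m2 x * \1_A0 x)).
    by apply: measurable_funD; apply: measurable_funM => //;
      apply: measurable_funM => //; exact: measurable_indic.
  by apply/funext => x; rewrite reCM /= mulrN opprK.
- near=> x => _; congr EFin.
  have AAx : A x <-> A0 x by near: x; exact: AA0.
  have Ax0 : ~ A x -> f x = 0 by near: x; exact: Hf0.
  rewrite reCM /= mulrN opprK.
  have [A0x|nA0x] := pselect (A0 x).
    by rewrite indicE mem_set// !mulr1.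
  by rewrite /= Ax0 ?mul0r// => /AAx.
Unshelve. all: by end_near. Qed.

End ComplexDuality.

(** * Change of variables in the plane *)

Section PlaneLebesgue.
Context {R : realType}.
Local Notation P := (measurableTypeR R * measurableTypeR R)%type.
Local Notation leb := (@lebesgue_measure R).
Local Notation leb2 := (leb \x leb)%E.

(** Scaling of area is formulated through preimages: in this form it composes and can be checked by
    uniqueness of measures. *)
Definition dilates (c : R) (f : P -> P) : Prop :=
  [/\ measurable_fun setT f, 0 <= c &
      forall B, measurable B -> (leb2 B = c%:E * leb2 (f @^-1` B))%E].

Lemma dilates_comp c1 c2 (f1 f2 : P -> P) : dilates c1 f1 -> dilates c2 f2 ->
  dilates (c1 * c2) (f1 \o f2).
Proof.
move=> [m1 c10 E1] [m2 c20 E2]; split.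
- exact: measurableT_comp.
- exact: mulr_ge0.
move=> B mB; rewrite comp_preimage E1// (E2 (f1 @^-1` B)) ?muleA//.
by rewrite -[X in measurable X]setTI; exact: m1.
Qed.

(** Uniqueness of Lebesgue measure reduces this to half-open intervals; a negative slope exchanges
    the open and the closed end, which does not affect length. *)
Lemma lebesgue_affine (p s : R) (B : set (measurableTypeR R)) : p != 0 ->
  measurable B -> (leb B = `|p|%:E * leb ((fun x => (p * x + s)%R) @^-1` B))%E.
Proof.
move=> p0 mB.
have mf : measurable_fun [set: measurableTypeR R] (fun x : measurableTypeR R => p * x + s : measurableTypeR R).
  by apply: measurable_funD => //; exact: measurable_funM.
pose nu := mscale (NngNum (normr_ge0 p)) (measure_function_pushforward__canonical__measure_function_Measure leb mf).
rewrite (@lebesgue_measure_unique _ nu)// => X [[a b] _ <-] /=.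
rewrite /nu /mscale/= /pushforward.
have [p_gt0|p_lt0] : 0 < p \/ p < 0 by apply/orP; rewrite -neq_lt eq_sym.
- rewrite (_ : _ @^-1` _ = `](a - s) / p, (b - s) / p]%classic); last first.
    apply/seteqP; split=> x /=; rewrite !in_itv/= ltr_pdivrMr// ler_pdivlMr//;
      by rewrite ltrBlDr lerBrDr (mulrC x).
  rewrite !lebesgue_measure_itv/= !lte_fin ltr_pM2r ?invr_gt0// ltrD2r.
  case: ifPn => ab; last by rewrite mule0.
  by rewrite -!EFinB -EFinM gtr0_norm//; congr EFin; field; rewrite gt_eqF.
- rewrite (_ : _ @^-1` _ = `[(b - s) / p, (a - s) / p[%classic); last first.
    apply/seteqP; split=> x /=; rewrite !in_itv/= ltr_ndivlMr// ler_ndivrMr//;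
      by rewrite ltrBlDr lerBrDr (mulrC x) andbC.
  rewrite !lebesgue_measure_itv/= !lte_fin ltr_nM2r ?invr_lt0// ltrD2r.
  case: ifPn => ab; last by rewrite mule0.
  by rewrite -!EFinB -EFinM ltr0_norm//; congr EFin; field; rewrite lt_eqF.
Qed.

Lemma dilates_diag (p q s t : R) : p != 0 -> q != 0 ->
  dilates (`|p| * `|q|) (fun z : P => (p * z.1 + s, q * z.2 + t) : P).
Proof.
move=> p0 q0.
have mf : measurable_fun setT (fun z : P => (p * z.1 + s, q * z.2 + t) : P).
  by apply/measurable_fun_pairP; split;
    apply: measurable_funD => //; apply: measurable_funM.
split=> // B mB.
pose nu := mscale (NngNum (mulr_ge0 (normr_ge0 p) (normr_ge0 q)))
  (measure_function_pushforward__canonical__measure_function_Measure leb2 mf).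
rewrite (@product_measure_unique _ _ _ _ _ _ _ nu)// => X Y mX mY.
transitivity ((`|p| * `|q|)%:E * leb2 (((fun x => p * x + s)%R @^-1` X)
  `*` ((fun x => q * x + t)%R @^-1` Y)))%E; first by [].
have mpre (u v : R) (Z : set (measurableTypeR R)) : measurable Z ->
    measurable ((fun x : measurableTypeR R => u * x + v : measurableTypeR R) @^-1` Z).
  move=> mZ; rewrite -[X in measurable X]setTI.
  by apply: measurable_funD => //; exact: measurable_funM.
rewrite product_measure1E; [|exact: mpre..].
rewrite EFinM muleACA; congr (_ * _)%E; apply/esym; exact: lebesgue_affine.
Qed.

Lemma dilates_swap : dilates 1 (fun z : P => (z.2, z.1) : P).
Proof.
have mf : measurable_fun setT (fun z : P => (z.2, z.1) : P).
  by apply/measurable_fun_pairP; split; [exact: measurable_snd|exact: measurable_fst].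
split=> // B mB; rewrite mul1e.
pose nu := measure_function_pushforward__canonical__measure_function_Measure leb2 mf.
rewrite (@product_measure_unique _ _ _ _ _ _ _ nu)// => X Y mX mY.
transitivity (leb2 (Y `*` X)).
  by congr (leb2 _); apply/seteqP; split=> -[x y] [].
by rewrite product_measure1E// muleC.
Qed.

(** Each vertical section is merely translated, so integrating the lengths of the sections gives the
    same area. *)
Lemma dilates_shear (k : R) :
  dilates 1 (fun z : P => (z.1, k * z.1 + z.2) : P).
Proof.
have mf : measurable_fun setT (fun z : P => (z.1, k * z.1 + z.2) : P).
  apply/measurable_fun_pairP; split; first exact: measurable_fst.
  apply: measurable_funD; last exact: measurable_snd.
  by apply: measurable_funM => //; exact: measurable_fst.
split=> // B mB; rewrite mul1e /product_measure1; apply: eq_integral => x _ /=.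
rewrite (lebesgue_affine (k * x) (oner_neq0 R)) ?normr1 ?mul1e; last first.
  exact: measurable_xsection.
congr (leb _); apply/seteqP; split=> y; rewrite /xsection/= !inE/=.
  by rewrite mul1r addrC.
by rewrite mul1r addrC.
Qed.

Definition cplx_mul (a b : R) (z : P) : P := (a * z.1 - b * z.2, b * z.1 + a * z.2).

(** Gaussian elimination: for [a <> 0] the matrix of multiplication by a + ib is a lower shear by
    [b / a], times the diagonal matrix with entries [a] and [(a^2 + b^2) / a], times an upper shear
    by [- b / a]. An upper shear is a lower one conjugated by the swap. *)
Lemma dilates_cplx_mul (a b : R) : a ^+ 2 + b ^+ 2 != 0 ->
  dilates (a ^+ 2 + b ^+ 2) (cplx_mul a b).
Proof.
move=> ab0; have [a0|a0] := eqVneq a 0.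
  have b0 : b != 0 by apply: contra_neq ab0 => ->; rewrite a0 expr0n/= addr0.
  have := dilates_comp (@dilates_diag (- b) b 0 0 _ b0) dilates_swap.
  rewrite oppr_eq0 => /(_ b0).
  rewrite mulr1 a0 expr0n/= add0r normrN -expr2 real_normK ?num_real//.
  congr (dilates _ _); apply/funext => -[x y]; rewrite /cplx_mul /=.
  by rewrite !mul0r !addr0 sub0r mulNr.
pose k := b / a; pose q := (a ^+ 2 + b ^+ 2) / a.
have q0 : q != 0 by rewrite mulf_neq0// invr_neq0.
have := dilates_comp (dilates_shear k) (dilates_comp (@dilates_diag a q 0 0 a0 q0)
  (dilates_comp dilates_swap (dilates_comp (dilates_shear (- k)) dilates_swap))).
rewrite !(mulr1, mul1r) -normrM [a * q]mulrC divfK// ger0_norm ?addr_ge0 ?sqr_ge0//.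
congr (dilates _ _); apply/funext => -[x y]; rewrite /cplx_mul /=.
by rewrite /k /q; congr pair; field.
Qed.

End PlaneLebesgue.

(** * Rectangles determine measures on plane open sets *)

Section PlaneRectangles.
Context {R : realType}.
Local Notation P := (measurableTypeR R * measurableTypeR R)%type.
Local Notation leb := (@lebesgue_measure R).
Local Notation leb2 := (leb \x leb)%E.

(** Half-open rectangles tile without overlap and are stable under intersection; the closed [ccrect]
    supply compactness. *)
Definition ocrect (a b c d : R) : set P := `]a, b]%classic `*` `]c, d]%classic.
Definition ccrect (a b c d : R) : set P := `[a, b]%classic `*` `[c, d]%classic.

Lemma measurable_ocrect a b c d : measurable (ocrect a b c d).
Proof. by apply: measurableX. Qed.

Lemma leb2_itv (i j : interval R) :
  leb2 ([set` i] `*` [set` j] : set P) = (leb [set` i] * leb [set` j])%E.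
Proof. by rewrite product_measure1E. Qed.

Lemma leb2_ocrect a b c d : a <= b -> c <= d ->
  leb2 (ocrect a b c d) = ((b - a) * (d - c))%:E.
Proof.
move=> ab cd; rewrite leb2_itv !lebesgue_measure_itv/= !lte_fin EFinM.
by move: ab cd; rewrite !le_eqVlt => /predU1P[->|->] /predU1P[->|->];
  rewrite ?ltxx ?subrr ?mul0e ?mule0.
Qed.

Definition plane_open (O : set P) : Prop := forall w, O w ->
  exists2 e : R, 0 < e & forall w' : P,
    `|w'.1 - w.1| < e -> `|w'.2 - w.2| < e -> O w'.

Definition ocrects : set (set P) :=
  [set X | exists a b c d : R, X = ocrect a b c d].

(** The preimages of []a, b]] under the two projections generate the product sigma-algebra, and each
    is a countable union of bounded bands. *)
Lemma measurable_ocrectsE : @measurable _ P = <<s ocrects >>.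
Proof.
apply/seteqP; split; last first.
  apply: smallest_sub; first exact: sigma_algebra_measurable.
  by move=> _ [a [b [c [d ->]]]]; exact: measurable_ocrect.
pose band (a b : R) n : set P := ocrect a b (- n%:R) n%:R.
pose band' (a b : R) n : set P := ocrect (- n%:R) n%:R a b.
have ex_n (x : R) : exists n : nat, `](- n%:R), n%:R]%classic x.
  have [n xn] : exists n : nat, `|x| < n%:R.
    exists (Num.truncn `|x|).+1; exact: truncnS_gt.
  by exists n; rewrite /= in_itv/= -ltrNl (le_lt_trans (ler_norm _)) ?normrN//=
    (le_trans (ler_norm _))// ltW.
apply: smallest_sub; first exact: smallest_sigma_algebra.
have sig : sigma_algebra [set: P] <<s ocrects >> := smallest_sigma_algebra _ _.
have [_ _ sigU] := sig.
rewrite subUset; split.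
- move=> _ [B mB <-]; rewrite setTI.
  have : image_set_system setT (fst : P -> _) <<s ocrects >> B; last first.
    by rewrite /image_set_system/= setTI.
  move: B mB; apply: smallest_sub.
    exact: sigma_algebra_image.
  move=> _ [[a b] _ <-] /=; rewrite /image_set_system/= setTI.
  rewrite (_ : _ @^-1` _ = \bigcup_n band a b n).
    by apply: sigU => n; apply: sub_gen_smallest; exists a, b, (- n%:R), n%:R.
  apply/seteqP; split=> [[x y] /= xab|[x y] [n _ []]//].
  by have [n yn] := ex_n y; exists n.
- move=> _ [B mB <-]; rewrite setTI.
  have : image_set_system setT (snd : P -> _) <<s ocrects >> B; last first.
    by rewrite /image_set_system/= setTI.
  move: B mB; apply: smallest_sub.
    exact: sigma_algebra_image.
  move=> _ [[a b] _ <-] /=; rewrite /image_set_system/= setTI.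
  rewrite (_ : _ @^-1` _ = \bigcup_n band' a b n).
    by apply: sigU => n; apply: sub_gen_smallest; exists (- n%:R), n%:R, a, b.
  apply/seteqP; split=> [[x y] /= xab|[x y] [n _ []]//].
  by have [n yn] := ex_n x; exists n.
Qed.

Lemma ocrectI a b c d a' b' c' d' : ocrect a b c d `&` ocrect a' b' c' d' =
  ocrect (Num.max a a') (Num.min b b') (Num.max c c') (Num.min d d').
Proof.
apply/seteqP; split=> -[x y]; rewrite /ocrect /= !in_itv/= !gt_max !le_min.
  by move=> [[/andP[-> ->] /andP[-> ->]] [/andP[-> ->] /andP[-> ->]]].
by move=> [/andP[/andP[-> ->] /andP[-> ->]] /andP[/andP[-> ->] /andP[-> ->]]].
Qed.

Lemma ocrect_measure_unique (m1 m2 : {measure set P -> \bar R}) a b c d :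
  (m1 (ocrect a b c d) < +oo)%E ->
  (forall a' b' c' d', a <= a' -> b' <= b -> c <= c' -> d' <= d ->
    m1 (ocrect a' b' c' d') = m2 (ocrect a' b' c' d')) ->
  forall B, measurable B -> B `<=` ocrect a b c d -> m1 B = m2 B.
Proof.
move=> fin m12 B mB BS.
have mS := measurable_ocrect a b c d.
have -> : m1 B = mrestr m1 mS B by rewrite /mrestr setIidl.
have -> : m2 B = mrestr m2 mS B by rewrite /mrestr setIidl.
apply: (@measure_unique _ _ _ ocrects (fun n => ocrect (- n%:R) n%:R (- n%:R) n%:R)) => //.
- exact: measurable_ocrectsE.
- move=> _ _ [a1 [b1 [c1 [d1 ->]]]] [a2 [b2 [c2 [d2 ->]]]].
  by rewrite ocrectI; do 4 eexists.
- by move=> n; do 4 eexists.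
- rewrite -subTset => -[x y] _.
  pose n := (Num.truncn (`|x| + `|y|)).+1.
  have xyn : `|x| + `|y| < n%:R by exact: truncnS_gt.
  exists n => //; rewrite /ocrect /= !in_itv/=.
  have xn : `|x| < n%:R by rewrite (le_lt_trans _ xyn)// lerDl.
  have yn : `|y| < n%:R by rewrite (le_lt_trans _ xyn)// lerDr.
  by move: xn yn; rewrite !ltr_norml => /andP[-> /ltW->] /andP[-> /ltW->].
- move=> _ [a1 [b1 [c1 [d1 ->]]]] /=; rewrite /mrestr ocrectI m12//.
  - by rewrite le_max lexx orbT.
  - by rewrite ge_min lexx orbT.
  - by rewrite le_max lexx orbT.
  - by rewrite ge_min lexx orbT.
- move=> n; rewrite /= /mrestr (le_lt_trans _ fin)// le_measure ?inE//.
  by apply: measurableI => //; exact: measurable_ocrect.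
Qed.

(** Rational vertices leave countably many candidates. A number that codes none of them, or one
    whose closure leaves [O], receives the empty rectangle with bounds 1 and 0. *)
Lemma plane_open_cover (O : set P) : plane_open O ->
  exists F : nat -> R * R * R * R, let r n := ocrect (F n).1.1.1 (F n).1.1.2 (F n).1.2 (F n).2 in
    O = \bigcup_n r n /\
    forall n, ccrect (F n).1.1.1 (F n).1.1.2 (F n).1.2 (F n).2 `<=` O.
Proof.
move=> oO.
pose good (k : rat * rat * rat * rat) := `[< ccrect (ratr k.1.1.1) (ratr k.1.1.2)
  (ratr k.1.2) (ratr k.2) `<=` O >].
pose F n : R * R * R * R := if (choice.unpickle n : option (rat * rat * rat * rat)) is Some k then
  if good k then (ratr k.1.1.1, ratr k.1.1.2, ratr k.1.2, ratr k.2)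
  else (1, 0, 1, 0) else (1, 0, 1, 0).
exists F => r.
have e0 : ccrect 1 0 1 0 `<=` O.
  by move=> -[x y] [] /=; rewrite in_itv/= => /andP[/le_trans h /h]; rewrite ler10.
have gF n : ccrect (F n).1.1.1 (F n).1.1.2 (F n).1.2 (F n).2 `<=` O.
  by rewrite /F; case: choice.unpickle => // k; case: ifPn => // /asboolP.
split=> //; apply/seteqP; split; last first.
  move=> -[x y] [n _ [/=]]; rewrite !in_itv/= => /andP[x1 x2] /andP[y1 y2].
  by apply: (gF n); split; rewrite /= in_itv/= ?x2 ?y2 ltW.
move=> -[x y] Oxy; have [e e0' eO] := oO _ Oxy.
have [a] := @rat_in_itvoo R (x - e) x ltac:(by rewrite gtrBl).
have [b] := @rat_in_itvoo R x (x + e) ltac:(by rewrite ltrDl).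
have [c] := @rat_in_itvoo R (y - e) y ltac:(by rewrite gtrBl).
have [d] := @rat_in_itvoo R y (y + e) ltac:(by rewrite ltrDl).
rewrite !in_itv/= => /andP[d1 d2] /andP[c1 c2] /andP[b1 b2] /andP[a1 a2].
have gd : good (a, b, c, d).
  apply/asboolP => -[x' y'] [/=]; rewrite !in_itv/= => /andP[x1 x2] /andP[y1 y2].
  apply: eO; rewrite /= ltr_distl; apply/andP; split.
  - exact: lt_le_trans x1.
  - exact: le_lt_trans b2.
  - exact: lt_le_trans y1.
  - exact: le_lt_trans d2.
exists (choice.pickle (a, b, c, d)); first by [].
rewrite /r /F choice.pickleK gd.
by split; rewrite /= in_itv/= ?a2 ?c2 ltW.
Qed.

Lemma plane_open_measurable (O : set P) : plane_open O -> measurable O.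
Proof.
move=> /plane_open_cover[F [-> _]].
by apply: bigcup_measurable => n _; exact: measurable_ocrect.
Qed.

(** The covering rectangles are made disjoint by [seqDU]. In each of them the two measures are
    finite and agree on all subrectangles, hence on all measurable subsets. *)
Lemma plane_open_measure_unique (O : set P) (m1 m2 : {measure set P -> \bar R}) :
  plane_open O ->
  (forall a b c d, ccrect a b c d `<=` O ->
    m1 (ocrect a b c d) = m2 (ocrect a b c d) /\ (m1 (ocrect a b c d) < +oo)%E) ->
  forall B, measurable B -> m1 (B `&` O) = m2 (B `&` O).
Proof.
move=> /plane_open_cover[F]; set r := (fun n => _); rewrite /= -/r => -[OE FO] m12 B mB.
have mr n : measurable (r n) by exact: measurable_ocrect.
have E n X : measurable X -> X `<=` r n -> m1 X = m2 X.
  apply: ocrect_measure_unique; first by have [] := m12 _ _ _ _ (FO n).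
  move=> a b c d a' b' c' d'; apply: (m12 a b c d _).1.
  apply: subset_trans (FO n) => -[x y] [/=]; rewrite !in_itv/=.
  move=> /andP[x1 x2] /andP[y1 y2]; split; rewrite /= in_itv/=.
    by rewrite (le_trans a')// (le_trans x2).
  by rewrite (le_trans c')// (le_trans y2).
pose S := seqDU r.
have mS n : measurable (S n) by exact: seqDU_measurable.
have BE : B `&` O = \bigcup_n (B `&` S n).
  by rewrite OE seqDU_bigcup_eq setI_bigcupr.
have tBS : trivIset setT (fun n => B `&` S n).
  by apply: trivIset_setIl; exact: trivIset_seqDU.
rewrite BE !measure_bigcup//; try by move=> n _; exact: measurableI.
apply: eq_eseriesr => n _; apply: (E n); first exact: measurableI.
by move=> w [_ Sw]; exact: (@subset_seqDU _ r n w Sw).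
Qed.

End PlaneRectangles.

Section RectangleGrid.
Context {R : realType}.
Local Notation P := (measurableTypeR R * measurableTypeR R)%type.

Lemma ocrect_split1 (m : {measure set P -> \bar R}) (u : nat -> R) c d n :
  {homo u : i j / (i <= j)%N >-> i <= j} ->
  m (ocrect (u 0%N) (u n) c d) =
  (\sum_(i < n) m (ocrect (u i) (u i.+1) c d))%E.
Proof.
move=> u_le; elim: n => [|n ih].
  by rewrite big_ord0 /ocrect set_itv_ge ?set0X ?measure0// -leNgt.
rewrite big_ord_recr/= -ih -measureU; [|exact: measurable_ocrect..|].
  congr (m _); apply/seteqP; split=> -[x y]; rewrite /ocrect/= !in_itv/=.
    move=> [/andP[x1 x2] ->]; have [xn|xn] := leP x (u n).
      by left; rewrite x1.
    by right.
  move=> [|] [/andP[x1 x2] ->]; split=> //; apply/andP; split=> //.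
    by rewrite (le_trans x2)// u_le.
  by rewrite (le_lt_trans _ x1)// u_le.
rewrite -subset0 => -[x y] []; rewrite /ocrect/= !in_itv/=.
by move=> [/andP[_ x1] _] [/andP[x2 _] _]; have := le_lt_trans x1 x2; rewrite ltxx.
Qed.

Lemma ocrect_split2 (m : {measure set P -> \bar R}) (v : nat -> R) a b n :
  {homo v : i j / (i <= j)%N >-> i <= j} ->
  m (ocrect a b (v 0%N) (v n)) =
  (\sum_(i < n) m (ocrect a b (v i) (v i.+1)))%E.
Proof.
move=> v_le; elim: n => [|n ih].
  by rewrite big_ord0 /ocrect [X in _ `*` X]set_itv_ge ?setX0 ?measure0// -leNgt.
rewrite big_ord_recr/= -ih -measureU; [|exact: measurable_ocrect..|].
  congr (m _); apply/seteqP; split=> -[x y]; rewrite /ocrect/= !in_itv/=.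
    move=> [-> /andP[y1 y2]]; have [yn|yn] := leP y (v n).
      by left; rewrite y1.
    by right.
  move=> [|] [-> /andP[y1 y2]]; split=> //; apply/andP; split=> //.
    by rewrite (le_trans y2)// v_le.
  by rewrite (le_lt_trans _ y1)// v_le.
rewrite -subset0 => -[x y] []; rewrite /ocrect/= !in_itv/=.
by move=> [_ /andP[_ x1]] [_ /andP[x2 _]]; have := le_lt_trans x1 x2; rewrite ltxx.
Qed.

(** The half-sides are [t] times the full sides of the given rectangle: the shape is kept, and the
    tiles of an [n] by [n] grid have [t = 1 / (2n)]. *)
Definition scaled_rect (a b c d : R) (x y t : R) : set P :=
  ocrect (x - t * (b - a)) (x + t * (b - a)) (y - t * (d - c)) (y + t * (d - c)).

(** By compactness the local estimate holds for a single mesh at all centres at once. The tiles of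
    that grid are similar to the original rectangle, and their estimates add up. *)
Lemma ocrect_le_local (m1 m2 : {measure set P -> \bar R}) (K a b c d : R) :
  0 <= K -> a < b -> c < d ->
  (forall w : P, ccrect a b c d w -> exists2 e : R, 0 < e &
    forall x y t, `|x - w.1| < e -> `|y - w.2| < e -> 0 < t < e ->
    (m1 (scaled_rect a b c d x y t) <= K%:E * m2 (scaled_rect a b c d x y t))%E) ->
  (m1 (ocrect a b c d) <= K%:E * m2 (ocrect a b c d))%E.
Proof.
move=> K0 ab cd loc.
pose est (n : nat) (w : R * R) := (m1 (scaled_rect a b c d w.1 w.2 (2 * n.+1%:R)^-1)
  <= K%:E * m2 (scaled_rect a b c d w.1 w.2 (2 * n.+1%:R)^-1))%E.
have cK : compact (`[a, b]%classic `*` `[c, d]%classic : set (R * R)).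
  by apply: compact_setX; exact: segment_compact.
have [N _ /(_ N (leqnn N)) HN] : \forall n \near \oo,
    (`[a, b]%classic `*` `[c, d]%classic : set (R * R)) `<=` est n.
  move/compact_near_coveringP : cK; apply=> w Kw.
  have [e e0 he] := loc w Kw.
  have [N] : exists N, forall n, (N <= n)%N -> (2 * n.+1%:R)^-1 < e.
    exists (Num.truncn e^-1) => n Nn; rewrite -[ltRHS]invrK ltf_pV2 ?posrE ?invr_gt0//.
    rewrite (lt_le_trans (truncnS_gt _))// (@le_trans _ _ n.+1%:R)//.
      by rewrite ler_nat.
    by rewrite ler_peMl// ler1n.
  move=> hN.
  exists ([set w' : R * R | `|w'.1 - w.1| < e /\ `|w'.2 - w.2| < e],
          [set n | (N <= n)%N]) => /=.
    split; last by exists N.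
    exists (ball w.1 e, ball w.2 e) => /=.
      by split; exact: nbhsx_ballx.
    by move=> [x y] [/=]; rewrite /ball/= !(distrC w.1) !(distrC w.2).
  move=> [w' n] [/= [w1 w2] Nn]; apply: he => //.
  by rewrite hN// andbT invr_gt0 mulr_gt0.
pose u (i : nat) := a + i%:R * ((b - a) / N.+1%:R).
pose v (i : nat) := c + i%:R * ((d - c) / N.+1%:R).
have u_le : {homo u : i j / (i <= j)%N >-> i <= j}.
  move=> i j ij; rewrite lerD2l ler_wpM2r ?ler_nat//.
  by rewrite divr_ge0// subr_ge0 ltW.
have v_le : {homo v : i j / (i <= j)%N >-> i <= j}.
  move=> i j ij; rewrite lerD2l ler_wpM2r ?ler_nat//.
  by rewrite divr_ge0// subr_ge0 ltW.
have N0 : N.+1%:R != 0 :> R by rewrite pnatr_eq0.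
have u0 : u 0%N = a by rewrite /u mul0r addr0.
have v0 : v 0%N = c by rewrite /v mul0r addr0.
have uN : u N.+1 = b by rewrite /u mulrC divfK// addrC subrK.
have vN : v N.+1 = d by rewrite /v mulrC divfK// addrC subrK.
rewrite -[in ocrect a b c d]u0 -[in ocrect _ b c d]uN.
rewrite -[in ocrect _ _ c d]v0 -[in ocrect _ _ _ d]vN.
rewrite !ocrect_split1// ge0_sume_distrr//.
apply: lee_sum => i _; rewrite !ocrect_split2// ge0_sume_distrr//.
apply: lee_sum => j _.
pose x := (u i + u i.+1) / 2; pose y := (v j + v j.+1) / 2.
have -> : ocrect (u i) (u i.+1) (v j) (v j.+1) =
    scaled_rect a b c d x y (2 * N.+1%:R)^-1.
  rewrite /scaled_rect /x /y /u /v -!natr1.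
  by congr ocrect; field; rewrite ?natr1 ?N0.
apply: (HN (x, y)); split; rewrite /= in_itv/=.
  have := u_le 0%N i (leq0n _); have := u_le i i.+1 (leqnSn _).
  have := u_le i.+1 N.+1 (ltn_ord i); rewrite u0 uN /x.
  by move=> h1 h2 h3; apply/andP; split; lra.
have := v_le 0%N j (leq0n _); have := v_le j j.+1 (leqnSn _).
have := v_le j.+1 N.+1 (ltn_ord j); rewrite v0 vN /y.
by move=> h1 h2 h3; apply/andP; split; lra.
Qed.

End RectangleGrid.

Section EstimateArithmetic.
Context {R : realType}.
Implicit Types (x y r th al eta : R).

(** The fourth power collects two factors from the squared derivative and two from the sides of a
    rectangle. With [t = eta / 16] the excess [4t + 6t^2 + 4t^3 + t^4] is at most [15t], whence the
    16. *)
Lemma pow4_upper eta : 0 < eta <= 1 -> (1 + eta / 16) ^+ 4 <= 1 + eta.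
Proof.
move=> /andP[eta0 eta1]; pose t := eta / 16.
have t0 : 0 < t by rewrite divr_gt0.
have et : eta = 16 * t by rewrite /t mulrC divfK// pnatr_eq0.
have t1 : t <= 1 by lra.
rewrite -/t et.
have t2 : t ^+ 2 <= t by rewrite expr2 -[leRHS]mul1r ler_pM2r.
have t3 : t ^+ 3 <= t by rewrite exprS -[leRHS]mulr1 ler_pM2l// expr_le1// ltW.
have t4 : t ^+ 4 <= t by rewrite exprS -[leRHS]mulr1 ler_pM2l// expr_le1// ltW.
have -> : (1 + t) ^+ 4 = 1 + 4 * t + 6 * t ^+ 2 + 4 * t ^+ 3 + t ^+ 4 by ring.
by lra.
Qed.

Lemma pow4_lower eta : 0 < eta <= 1 -> 1 <= (1 + eta) * (1 - eta / 16) ^+ 4.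
Proof.
move=> /andP[eta0 eta1]; pose t := eta / 16.
have t0 : 0 < t by rewrite divr_gt0.
have et : eta = 16 * t by rewrite /t mulrC divfK// pnatr_eq0.
have t1 : t <= 1 / 16 by rewrite /t ler_pM2r ?invr_gt0.
rewrite -/t; have h : 1 - 4 * t <= (1 - t) ^+ 4.
  have -> : (1 - t) ^+ 4 = 1 - 4 * t + t ^+ 2 * (6 - 4 * t + t ^+ 2) by ring.
  rewrite lerDl mulr_ge0 ?sqr_ge0//; have := sqr_ge0 t; lra.
apply: (@le_trans _ _ ((1 + eta) * (1 - 4 * t))); last first.
  by rewrite ler_wpM2l// addr_ge0// ltW.
rewrite et; have : t * t <= t * (1 / 16) by rewrite ler_pM2l.
by lra.
Qed.

Lemma ler_norm_shift x y r th : `|x| <= r -> `|x - y| <= th * r ->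
  `|y| <= (1 + th) * r.
Proof.
move=> xr xyr; have -> : y = x - (x - y) by ring.
by rewrite (le_trans (ler_normB _ _))// mulrDl mul1r lerD.
Qed.

Lemma ltr_norm_shift x y r th : `|x| < (1 - th) * r -> `|y - x| <= th * r ->
  `|y| < r.
Proof.
move=> xr xyr; have -> : y = (y - x) + x by ring.
rewrite (le_lt_trans (ler_normD _ _))//.
have -> : r = th * r + (1 - th) * r by ring.
exact: ler_ltD.
Qed.

Lemma sqr_rel_bounds x al th : 0 <= x -> 0 <= al -> 0 <= th <= 1 ->
  `|x - al| < th * al ->
  ((1 - th) * al) ^+ 2 <= x ^+ 2 <= ((1 + th) * al) ^+ 2.
Proof.
move=> x0 al0 /andP[th0 th1]; rewrite ltr_distl => /andP[h1 h2].
have p1 : 0 <= (1 - th) * al by rewrite mulr_ge0// subr_ge0.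
have p2 : 0 <= (1 + th) * al by rewrite mulr_ge0// addr_ge0.
by rewrite !ler_sqr ?nnegrE//; apply/andP; split; lra.
Qed.

Lemma itv_norm_le x y r : x - r < y <= x + r -> `|y - x| <= r.
Proof. by move=> /andP[h1 h2]; rewrite ler_distl h2 ltW. Qed.

Lemma norm_lt_itv x y r : `|y - x| < r -> x - r < y <= x + r.
Proof. by rewrite ltr_distl => /andP[-> /ltW]. Qed.

(** Absorption: an error [w] of at most half of [u] is moved to the left-hand side. *)
Lemma le_twice (u v w s e : R) : 0 <= u -> u <= v + w -> w <= e * u -> e <= 1 / 2 ->
  v <= s -> u <= 2 * s.
Proof.
move=> u0 uv we e2 vs; have : e * u <= 1 / 2 * u by rewrite ler_wpM2r.
by lra.
Qed.

End EstimateArithmetic.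

(** * Area formula for a conformal bijection *)

Section PlaneChangeOfVariables.
Context {R : realType}.
Local Notation P := (measurableTypeR R * measurableTypeR R)%type.
Local Notation C := (Cplx R).
Local Notation leb := (@lebesgue_measure R).
Local Notation leb2 := (leb \x leb)%E.

Definition toC (w : P) : C := Complex w.1 w.2.
Definition ofC (z : C) : P := (reC z, imC z).

Lemma ofCK z : toC (ofC z) = z. Proof. by case: z. Qed.
Definition c_open (O : set C) : Prop := forall z, O z ->
  exists2 e : R, 0 < e & forall z', cabs (z' - z) < e -> O z'.

Lemma cabs_toCB_le (w w' : P) :
  cabs (toC w' - toC w) <= `|w'.1 - w.1| + `|w'.2 - w.2|.
Proof. by rewrite (le_trans (cabs_le_reC_imC _))// reCD imCD reCN imCN. Qed.

Lemma c_open_plane (O : set C) : c_open O -> plane_open (toC @^-1` O).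
Proof.
move=> oO w /oO[e e0 he]; exists (e / 2); first by rewrite divr_gt0.
move=> w' h1 h2; apply: he; rewrite (le_lt_trans (cabs_toCB_le _ _))//.
by rewrite [ltRHS]splitr ltrD.
Qed.

Lemma plane_measurable_fun (O : set P) (f : P -> R) : plane_open O ->
  (forall w, O w -> forall e : R, 0 < e -> exists2 k : R, 0 < k & forall w' : P,
    `|w'.1 - w.1| < k -> `|w'.2 - w.2| < k -> `|f w' - f w| < e) ->
  measurable_fun O f.
Proof.
move=> oO cf; move: (plane_open_measurable oO) => /[swap] _ mO.
apply: (measurability _ (RGenOInfty.measurableE R)) => //.
move=> _ [_ [t ->] <-]; apply: plane_open_measurable => w [Ow /=].
rewrite in_itv/= andbT => tw.
have [e1 e10 h1] := oO w Ow.
have [e2 e20 h2] := cf w Ow (f w - t) ltac:(by rewrite subr_gt0).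
exists (Num.min e1 e2); first by rewrite lt_min e10.
move=> w'; rewrite !lt_min => /andP[x1 x2] /andP[y1 y2]; split; first exact: h1.
have := h2 w' x2 y2; rewrite /= in_itv/= andbT ltr_distl => /andP[+ _].
by rewrite opprB addrCA subrr addr0.
Qed.

Lemma measurable_fun_plane d (T : measurableType d) (O : set T)
    (f1 f2 : T -> measurableTypeR R) :
  measurable_fun O f1 -> measurable_fun O f2 ->
  measurable_fun O (fun w => (f1 w, f2 w) : P).
Proof.
move=> m1 m2 mO; apply: (measurability _ measurable_ocrectsE) => //.
move=> _ [_ [a [b [c [d' ->]]]] <-].
rewrite (_ : O `&` _ = (O `&` f1 @^-1` `]a, b]%classic) `&`
    (O `&` f2 @^-1` `]c, d']%classic)).
  by apply: measurableI; [exact: m1|exact: m2].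
by rewrite setIACA setIid.
Qed.

Variables (D U : set C) (q dq h : C -> C).

(* [cp_strict] is strict differentiability: the linearisation at [z] controls
   differences between any two points near [z]. *)
Record conformal_pair : Prop := {
  cp_openD : c_open D;
  cp_openU : c_open U;
  cp_map : forall z, D z -> U (q z) /\ h (q z) = z;
  cp_inv : forall y, U y -> D (h y) /\ q (h y) = y;
  cp_inv_cont : forall y, U y -> forall e : R, 0 < e -> exists2 k : R, 0 < k &
    forall y', U y' -> cabs (y' - y) < k -> cabs (h y' - h y) < e;
  cp_strict : forall z, D z -> forall e : R, 0 < e -> exists2 k : R, 0 < k &
    forall z1 z2, cabs (z1 - z) < k -> cabs (z2 - z) < k ->
      cabs (q z1 - q z2 - dq z * (z1 - z2)) <= e * cabs (z1 - z2);
  cp_deriv_cont : forall z, D z -> forall e : R, 0 < e -> exists2 k : R, 0 < k &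
    forall z', cabs (z' - z) < k -> cabs (dq z' - dq z) < e;
  cp_deriv_neq0 : forall z, D z -> dq z != 0 }.

Hypothesis cp : conformal_pair.

Let D' : set P := toC @^-1` D.
Let qP (w : P) : P := ofC (q (toC w)).
Let g (w : P) : R := cabs (dq (toC w)) ^+ 2.

Lemma cp_cont z : D z -> forall e : R, 0 < e -> exists2 k : R, 0 < k &
  forall z', cabs (z' - z) < k -> cabs (q z' - q z) < e.
Proof.
move=> Dz e e0; have [k k0 hk] := cp_strict cp Dz ltr01.
pose M := 1 + cabs (dq z).
have M0 : 0 < M by rewrite ltr_pwDl// cabs_ge0.
exists (Num.min k (e / M)); first by rewrite lt_min k0 divr_gt0.
move=> z'; rewrite lt_min => /andP[z'k z'e].
have := hk z' z z'k; rewrite subrr cabs0 => /(_ k0) h1.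
rewrite -[q z' - q z](subrK (dq z * (z' - z))) (le_lt_trans (cabsD _ _))//.
rewrite (@le_lt_trans _ _ (M * cabs (z' - z)))//.
  by rewrite cabsM mulrDl lerD.
by rewrite mulrC -ltr_pdivlMr.
Qed.

Let oD' : plane_open D'. Proof. exact/c_open_plane/(cp_openD cp). Qed.
Let mD' : measurable D'. Proof. exact: plane_open_measurable. Qed.

Let cabs_near (f : C -> C) (w : P) (e k : R) :
  (forall z', cabs (z' - toC w) < k -> cabs (f z' - f (toC w)) < e) ->
  forall w' : P, `|w'.1 - w.1| < k / 2 -> `|w'.2 - w.2| < k / 2 ->
  cabs (f (toC w') - f (toC w)) < e.
Proof.
move=> hf w' h1 h2; apply: hf; rewrite (le_lt_trans (cabs_toCB_le _ _))//.
by rewrite [ltRHS]splitr ltrD.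
Qed.

Let mqP : measurable_fun D' qP.
Proof.
apply: measurable_fun_plane; apply: plane_measurable_fun => // w Dw e e0;
  have [k k0 /cabs_near hk] := cp_cont Dw e0;
  (exists (k / 2); first by rewrite divr_gt0) => w' h1 h2;
  apply: le_lt_trans (hk w' h1 h2).
  by rewrite -[_ - _]/(reC (q (toC w')) - reC (q (toC w))) -reCN -reCD ler_reC_cabs.
by rewrite -[_ - _]/(imC (q (toC w')) - imC (q (toC w))) -imCN -imCD ler_imC_cabs.
Qed.

Let mg : measurable_fun D' g.
Proof.
apply: measurable_funX; apply: plane_measurable_fun => // w Dw e e0.
have [k k0 /cabs_near hk] := cp_deriv_cont cp Dw e0.
exists (k / 2); first by rewrite divr_gt0.
move=> w' h1 h2; apply: le_lt_trans (hk w' h1 h2).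
exact: ler_cabs_dist.
Qed.

(** Push-forward under [q] of the measure with density [|q'|^2] on [D]; the goal is that it
    coincides with Lebesgue measure restricted to [U]. *)
Definition cp_measure (B : set P) : \bar R :=
  (\int[leb2]_(w in D' `&` qP @^-1` B) (g w)%:E)%E.

Let mpre (B : set P) : measurable B -> measurable (D' `&` qP @^-1` B).
Proof. by move=> mB; exact: mqP. Qed.

Let mgE (X : set P) : X `<=` D' -> measurable_fun X (EFin \o g).
Proof. by move=> XD; apply/measurable_EFinP; apply: measurable_funS mg. Qed.

Let cp_measure0 : cp_measure set0 = 0%E.
Proof. by rewrite /cp_measure preimage_set0 setI0 integral_set0. Qed.

Let cp_measure_ge0 B : (0 <= cp_measure B)%E.
Proof. by apply: integral_ge0 => w _; rewrite lee_fin sqr_ge0. Qed.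

Let cp_measure_sigma : semi_sigma_additive cp_measure.
Proof.
move=> F mF tF mUF; rewrite /cp_measure preimage_bigcup setI_bigcupr.
rewrite ge0_integral_bigcup//=.
- apply: is_cvg_ereal_nneg_natsum_cond => n _ _.
  by apply: integral_ge0 => w _; rewrite lee_fin sqr_ge0.
- by move=> n; exact: mpre.
- by apply: mgE => w [n _ []].
- by move=> w _; rewrite lee_fin sqr_ge0.
- apply/trivIsetP => i j _ _ ij; rewrite setIACA setIid -preimage_setI.
  by move/trivIsetP : tF => /(_ i j Logic.I Logic.I ij) ->; rewrite preimage_set0 setI0.
Qed.

HB.instance Definition _ := isMeasure.Build _ P R cp_measure
  cp_measure0 cp_measure_ge0 cp_measure_sigma.

(** The linear part of [q] at [z0], recentred at [zc], which will be the preimage of the centre of a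
    small rectangle. *)
Let T (z0 zc : C) (w : P) : P := ofC (dq z0 * (toC w - zc)).

Let dilates_T (z0 zc : C) : D z0 -> dilates (cabs (dq z0) ^+ 2) (T z0 zc).
Proof.
move=> Dz; rewrite cabs_sqr.
have n0 : reC (dq z0) ^+ 2 + imC (dq z0) ^+ 2 != 0.
  rewrite -cabs_sqr sqrf_eq0; apply/eqP => /cabs_eq0 /eqP.
  by apply/negP; exact: (cp_deriv_neq0 cp).
have := dilates_comp (dilates_cplx_mul n0)
  (@dilates_diag R 1 1 (- reC zc) (- imC zc) (oner_neq0 _) (oner_neq0 _)).
rewrite !normr1 !mulr1; congr dilates; apply/funext => -[x y].
rewrite /T /ofC /cplx_mul /= reCM imCM !reCD !imCD !reCN !imCN /= !mul1r.
by congr pair; rewrite addrC.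
Qed.

Let leb2_centered (r1 r2 : R) : 0 <= r1 -> 0 <= r2 ->
  leb2 (ccrect (- r1) r1 (- r2) r2) = ((2 * r1) * (2 * r2))%:E /\
  leb2 (`](- r1), r1[%classic `*` `](- r2), r2[%classic : set P) =
    ((2 * r1) * (2 * r2))%:E.
Proof.
move=> r10 r20; rewrite /ccrect !leb2_itv !lebesgue_measure_itv/= !lte_fin.
have e (r : R) : 0 <= r ->
    (if (- r < r)%R then (r%:E - (- r)%:E)%E else 0%E) = (2 * r)%:E.
  rewrite le_eqVlt => /predU1P[<-|r0]; first by rewrite oppr0 ltxx mulr0.
  by rewrite gtrN// -EFinB opprK -mulr2n mulr_natl.
by rewrite !e// -EFinM.
Qed.

(* On a small rectangle [q] is uniformly close to the affine map with derivative
   [dq z0], so the preimage of the rectangle lies between two preimages of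
   slightly rescaled rectangles under that affine map. *)
Lemma cp_local_estimate (a b c d eta : R) (y0 : P) : a < b -> c < d ->
  0 < eta <= 1 -> U (toC y0) ->
  exists2 e : R, 0 < e &
    forall x y t, `|x - y0.1| < e -> `|y - y0.2| < e -> 0 < t < e ->
    let S := scaled_rect a b c d x y t in
    ((cp_measure S <= (1 + eta)%:E * leb2 S)%E /\
     (leb2 S <= (1 + eta)%:E * cp_measure S)%E).
Proof.
move=> ab cd /andP[eta0 eta1] Uy0.
have [Dz0 hz0] := cp_inv cp Uy0; set z0 := h (toC y0) in Dz0 hz0.
pose al := cabs (dq z0).
have al0 : 0 < al by apply: cabs_gt0; exact: (cp_deriv_neq0 cp).
(* The relative error allowed in each of the four factors handled by [pow4_upper] and
   [pow4_lower]. *)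
pose th := eta / 16.
have th0 : 0 < th by rewrite divr_gt0.
have th1 : th <= 1 / 16 by rewrite /th ler_pM2r ?invr_gt0.
pose A := b - a; pose B := d - c.
have A0 : 0 < A by rewrite subr_gt0.
have B0 : 0 < B by rewrite subr_gt0.
(* Controls the eccentricity: the sum of the sides is at most [M] times either side, so an error
   relative to the diameter becomes one relative to each side. *)
pose M := (A + B) / Num.min A B.
have min0 : 0 < Num.min A B by rewrite lt_min A0.
have MA : A + B <= M * A.
  rewrite /M mulrAC ler_pdivlMr// (ler_wpM2l (ltW (addr_gt0 A0 B0)))//.
  by rewrite ge_min lexx.
have MB : A + B <= M * B.
  rewrite /M mulrAC ler_pdivlMr// (ler_wpM2l (ltW (addr_gt0 A0 B0)))//.
  by rewrite ge_min lexx orbT.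
have M1 : 1 <= M.
  rewrite -(@ler_pM2r _ A)// mul1r (le_trans _ MA)// lerDl ltW//.
have M0 : 0 < M by rewrite (lt_le_trans ltr01).
(* The linear part [u] of the displacement will be at most [2 (r1 + r2)], hence at most [2 M r1] and
   [2 M r2]; a relative linearisation error [ep] then costs at most [th * r1] and [th * r2] in the
   coordinates. *)
pose ep := th / (2 * M).
have ep0 : 0 < ep by rewrite divr_gt0// mulr_gt0.
have epM : ep * (2 * M) = th by rewrite divfK// gt_eqF// mulr_gt0.
have ep12 : ep <= 1 / 2.
  have e1 : ep * 1 <= ep * M by rewrite ler_pM2l.
  have e2 : ep * M * 2 = th by rewrite -epM; ring.
  by lra.
have [k1 k10 strict] := cp_strict cp Dz0 (mulr_gt0 ep0 al0).
have [k2 k20 dqc] := cp_deriv_cont cp Dz0 (mulr_gt0 th0 al0).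
have [k3 k30 Dk] := cp_openD cp Dz0.
have [k [k0 kk1 kk2 kk3]] : exists k, [/\ 0 < k, k <= k1, k <= k2 & k <= k3].
  exists (Num.min k1 (Num.min k2 k3)); split.
  - by rewrite !lt_min k10 k20.
  - by rewrite ge_min lexx.
  - by rewrite !ge_min lexx orbT.
  - by rewrite !ge_min lexx !orbT.
have [k4 k40 hc] := cp_inv_cont cp Uy0 (divr_gt0 k0 (ltr0n _ 2)).
have [k5 k50 Uk] := cp_openU cp Uy0.
(* [k4] keeps the values of [h] near [z0] and [k5] keeps points inside [U]; [al * k / 2] forces
   points with small linear part to lie within [k / 2] of [zc]. *)
pose e1 := Num.min (Num.min k4 k5) (al * k / 2).
have e10 : 0 < e1 by rewrite !lt_min k40 k50 divr_gt0// mulr_gt0.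
(* Budget for [r1 + r2 + 2 rho < e1] with [rho = e1 / s]: the half-sides use [A + B] units, the
   displaced centre two, and one more makes the inequality strict. *)
pose s := 3 + A + B.
have s0 : 0 < s by rewrite /s; lra.
exists (e1 / s); first by rewrite divr_gt0.
move=> x y t xe ye /andP[t0 te] S.
pose r1 := t * A; pose r2 := t * B.
have r10 : 0 < r1 by rewrite mulr_gt0.
have r20 : 0 < r2 by rewrite mulr_gt0.
have rA : r1 + r2 <= M * r1 by rewrite /r1 /r2 -mulrDr mulrCA ler_pM2l.
have rB : r1 + r2 <= M * r2 by rewrite /r1 /r2 -mulrDr mulrCA ler_pM2l.
pose yc : C := Complex x y.
pose rho := e1 / s.
have rho0 : 0 < rho by rewrite divr_gt0.
have rhoE : rho * (3 + A + B) = e1 by rewrite /rho divfK// gt_eqF.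
have rS : r1 + r2 + rho + rho < e1.
  have -> : e1 = (rho * (A + B) + rho + rho) + rho by rewrite -rhoE; ring.
  rewrite /r1 /r2 -mulrDr (@lt_trans _ _ (rho * (A + B) + rho + rho))//.
    by rewrite !ltrD2r ltr_pM2r// addr_gt0.
  by rewrite ltrDl.
have near_y y' : cabs (y' - yc) <= r1 + r2 -> cabs (y' - toC y0) < e1.
  move=> yr; rewrite -(subrK yc y') -addrA (le_lt_trans (cabsD _ _))//.
  apply: le_lt_trans rS; rewrite -addrA lerD//.
  rewrite (le_trans (cabs_le_reC_imC _))// reCD imCD reCN imCN.
  by rewrite lerD// ltW.
have near_U y' : cabs (y' - yc) <= r1 + r2 ->
    U y' /\ cabs (h y' - z0) < k / 2.
  move=> /near_y; rewrite !lt_min => /andP[/andP[y4 y5] _].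
  by split; [exact: Uk|apply: hc => //; exact: Uk].
have [Uyc hyc] := near_U yc ltac:(by rewrite subrr cabs0 addr_ge0// ltW).
have [Dzc qzc] := cp_inv cp Uyc; set zc := h yc in hyc Dzc qzc.
have k2k : k / 2 < k by rewrite ltr_pdivrMr// ltr_pMr// ltr1n.
have zck : cabs (zc - z0) < k by rewrite (lt_trans hyc).
have lin z : cabs (z - z0) < k ->
    cabs (q z - yc - dq z0 * (z - zc)) <= ep * cabs (dq z0 * (z - zc)).
  move=> zk; rewrite cabsM mulrA -qzc.
  by apply: strict; [exact: lt_le_trans kk1|exact: lt_le_trans kk1].
have th1' : th <= 1 by rewrite (le_trans th1)// ler_pdivrMr// mul1r ler1n.
have gbound z : cabs (z - z0) < k ->
    ((1 - th) * al) ^+ 2 <= cabs (dq z) ^+ 2 <= ((1 + th) * al) ^+ 2.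
  move=> zk; have := dqc z (lt_le_trans zk kk2).
  move/(le_lt_trans (ler_cabs_dist _ _)).
  by apply: sqr_rel_bounds; rewrite ?cabs_ge0 ?(ltW al0) ?(ltW th0).
have leS : leb2 S = ((2 * r1) * (2 * r2))%:E.
  rewrite /S /scaled_rect leb2_ocrect; first by congr EFin; rewrite /r1 /r2 /A /B; ring.
    by rewrite lerD2l -/A -/r1 (@le_trans _ _ 0)// ?oppr_le0 ltW.
  by rewrite lerD2l -/B -/r2 (@le_trans _ _ 0)// ?oppr_le0 ltW.
have inS z : S (ofC z) -> `|reC (z - yc)| <= r1 /\ `|imC (z - yc)| <= r2.
  rewrite /S /scaled_rect /ocrect /ofC /= !in_itv/= -/A -/B -/r1 -/r2.
  by rewrite reCD imCD reCN imCN => -[/itv_norm_le + /itv_norm_le].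
have mS : measurable S by exact: measurable_ocrect.
have pre_le (X : set P) : X `<=` (fun w => cabs (toC w - z0) < k) ->
    measurable X ->
    ((((1 - th) * al) ^+ 2)%:E * leb2 X <= \int[leb2]_(w in X) (g w)%:E <=
     (((1 + th) * al) ^+ 2)%:E * leb2 X)%E.
  move=> Xk mX; have XD : X `<=` D'.
    by move=> w /Xk wk; apply: Dk; exact: lt_le_trans wk kk3.
  rewrite -!integral_cst//; apply/andP; split; apply: ge0_le_integral => //.
  - by move=> w _; rewrite lee_fin sqr_ge0.
  - exact: mgE.
  - by move=> w /Xk/gbound/andP[]; rewrite lee_fin.
  - by move=> w _; rewrite lee_fin sqr_ge0.
  - exact: mgE.
  - by move=> w /Xk/gbound/andP[_]; rewrite lee_fin.
have [mT _ leT] := dilates_T zc Dz0.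
have mpreT X : measurable X -> measurable (T z0 zc @^-1` X).
  by move=> mX; rewrite -[X in measurable X]setTI; exact: mT.
have fE f : 0 <= f -> (f * al) ^+ 2 = f ^+ 2 * al ^+ 2 by rewrite exprMn.
split.
(* Upper bound: the preimage of [S] under [q] lies in the affine preimage of the rectangle enlarged
   by [1 + th]. *)
- pose Ep : set P := ccrect (- ((1 + th) * r1)) ((1 + th) * r1)
    (- ((1 + th) * r2)) ((1 + th) * r2).
  have mEp : measurable Ep by apply: measurableX.
  pose X := D' `&` qP @^-1` S.
  have mX : measurable X by exact: mpre.
  have Xk w : X w -> cabs (toC w - z0) < k /\ (T z0 zc @^-1` Ep) w.
    move=> [Dw Sw]; have [Uw hw] := cp_map cp Dw.
    have [v1 v2] := inS _ Sw.
    have vr : cabs (q (toC w) - yc) <= r1 + r2.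
      by rewrite (le_trans (cabs_le_reC_imC _))// lerD.
    have [_] := near_U _ vr; rewrite hw => wk2.
    have wk : cabs (toC w - z0) < k by exact: lt_trans k2k.
    split=> //.
    set v := q (toC w) - yc in v1 v2 vr *.
    set u := dq z0 * (toC w - zc); have := lin _ wk; rewrite -/v -/u => vu.
    (* Only [v] is bounded a priori; [|v - u| <= ep |u|] with [ep <= 1/2] transfers the bound to [u]
       at the price of a factor 2. *)
    have uv : cabs u <= 2 * (r1 + r2).
      apply: (le_twice (cabs_ge0 u) _ vu ep12 vr).
      by rewrite -lerBlDl (le_trans _ (ler_cabs_dist v u))// distrC ler_norm.
    have vu1 : cabs (v - u) <= th * r1.
      rewrite (le_trans vu)// (@le_trans _ _ (ep * (2 * (M * r1))))//.
        by rewrite ler_pM2l// (le_trans uv)// ler_pM2l.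
      by rewrite -epM le_eqVlt; apply/orP; left; apply/eqP; ring.
    have vu2 : cabs (v - u) <= th * r2.
      rewrite (le_trans vu)// (@le_trans _ _ (ep * (2 * (M * r2))))//.
        by rewrite ler_pM2l// (le_trans uv)// ler_pM2l.
      by rewrite -epM le_eqVlt; apply/orP; left; apply/eqP; ring.
    have := le_trans (ler_reC_cabs (v - u)) vu1.
    have := le_trans (ler_imC_cabs (v - u)) vu2.
    rewrite reCD imCD reCN imCN => i1 i2.
    rewrite /Ep /ccrect /T /ofC /= !in_itv/= -/u -!ler_norml.
    by split; [exact: ler_norm_shift v1 i2|exact: ler_norm_shift v2 i1].
  have /andP[_ up] := pre_le X (fun w Xw => (Xk w Xw).1) mX.
  apply: (le_trans up).
  have XE : (leb2 X <= leb2 (T z0 zc @^-1` Ep))%E.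
    by apply: le_measure; rewrite ?inE//; [exact: mpreT|move=> w /Xk[]].
  apply: (@le_trans _ _ ((((1 + th) * al) ^+ 2)%:E * leb2 (T z0 zc @^-1` Ep))%E).
    by apply: lee_wpmul2l => //; rewrite lee_fin sqr_ge0.
  rewrite exprMn EFinM -muleA -/al -leT//.
  have th1p : 0 <= 1 + th by rewrite addr_ge0// ltW.
  have [-> _] := @leb2_centered ((1 + th) * r1) ((1 + th) * r2)
    ltac:(by rewrite mulr_ge0// ltW) ltac:(by rewrite mulr_ge0// ltW).
  rewrite leS -!EFinM lee_fin.
  have -> : (1 + th) ^+ 2 * (2 * ((1 + th) * r1) * (2 * ((1 + th) * r2))) =
    (1 + th) ^+ 4 * (2 * r1 * (2 * r2)) by ring.
  by rewrite ler_wpM2r ?pow4_upper ?eta0// !mulr_ge0// ltW.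
(* Lower bound: the affine preimage of the rectangle shrunk by [1 - th] is contained in the preimage
   of [S] under [q]. *)
- pose Em : set P := `](- ((1 - th) * r1)), ((1 - th) * r1)[%classic `*`
    `](- ((1 - th) * r2)), ((1 - th) * r2)[%classic.
  have mEm : measurable Em by apply: measurableX.
  pose X := T z0 zc @^-1` Em.
  have mX : measurable X by exact: mpreT.
  have Xk w : X w -> cabs (toC w - z0) < k /\ S (qP w).
    rewrite /X /Em /T /ofC /= !in_itv/= -!ltr_norml.
    set u := dq z0 * (toC w - zc) => -[u1 u2].
    have sub1 r : 0 < r -> (1 - th) * r <= r.
      by move=> r0; rewrite ler_piMl ?(ltW r0)// gerBl ltW.
    have ur : cabs u <= r1 + r2.
      rewrite (le_trans (cabs_le_reC_imC _))// lerD// ltW//.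
        exact: lt_le_trans (sub1 _ r10).
      exact: lt_le_trans (sub1 _ r20).
    have wzc : cabs (toC w - zc) < k / 2.
      rewrite -(ltr_pM2l al0) -cabsM (le_lt_trans ur)//.
      rewrite (lt_le_trans (y := e1))//; last by rewrite ge_min mulrA lexx orbT.
      by rewrite (le_lt_trans _ rS)// -addrA lerDl addr_ge0// ltW.
    have wk : cabs (toC w - z0) < k.
      rewrite -(subrK zc (toC w)) -addrA (le_lt_trans (cabsD _ _))//.
      by rewrite [ltRHS]splitr ltrD.
    split=> //; have := lin _ wk; set v := q (toC w) - yc => vu.
    have half r : 0 < r -> ep * (M * r) <= th * r.
      move=> r0; rewrite -epM mulrA ler_pM2r// ler_pM2l//.
      by rewrite ler_peMl ?(ltW M0)// ler1n.
    have vu1 : cabs (v - u) <= th * r1.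
      by rewrite (le_trans vu)// (le_trans _ (half _ r10))// ler_pM2l// (le_trans ur).
    have vu2 : cabs (v - u) <= th * r2.
      by rewrite (le_trans vu)// (le_trans _ (half _ r20))// ler_pM2l// (le_trans ur).
    have := le_trans (ler_reC_cabs (v - u)) vu1.
    have := le_trans (ler_imC_cabs (v - u)) vu2.
    rewrite (reCD v) (imCD v) reCN imCN => i1 i2.
    have := ltr_norm_shift u1 i2; have := ltr_norm_shift u2 i1.
    rewrite reCD imCD reCN imCN => /norm_lt_itv n2 /norm_lt_itv n1.
    by split; rewrite /= in_itv.
  have XS : X `<=` D' `&` qP @^-1` S.
    move=> w /Xk[wk Sw]; split=> //; apply: Dk; exact: lt_le_trans wk kk3.
  have cpX : (\int[leb2]_(w in X) (g w)%:E <= cp_measure S)%E.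
    apply: ge0_subset_integral => //; first exact: mpre.
      by apply: mgE => w [].
    by move=> w _; rewrite lee_fin sqr_ge0.
  have /andP[lo _] := pre_le X (fun w Xw => (Xk w Xw).1) mX.
  have eta1' : (0 <= (1 + eta)%:E)%E by rewrite lee_fin addr_ge0// ltW.
  apply: le_trans (lee_wpmul2l eta1' (le_trans lo cpX)).
  rewrite exprMn EFinM -(muleA _ (al ^+ 2)%:E) -/al -leT//.
  have th1m : 0 <= 1 - th by rewrite subr_ge0.
  have [_ ->] := @leb2_centered ((1 - th) * r1) ((1 - th) * r2)
    ltac:(by rewrite mulr_ge0// ltW) ltac:(by rewrite mulr_ge0// ltW).
  rewrite leS -!EFinM lee_fin.
  have -> : (1 + eta) * ((1 - th) ^+ 2 * (2 * ((1 - th) * r1) * (2 * ((1 - th) * r2)))) =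
    ((1 + eta) * (1 - th) ^+ 4) * (2 * r1 * (2 * r2)) by ring.
  by rewrite ler_peMl ?pow4_lower ?eta0// !mulr_ge0// ltW.
Qed.

(** The grid argument globalises the local estimates into two inequalities up to a factor [1 + eta];
    then [eta] tends to 0. *)
Let cp_rect a b c d : a < b -> c < d -> ccrect a b c d `<=` toC @^-1` U ->
  leb2 (ocrect a b c d) = cp_measure (ocrect a b c d).
Proof.
move=> ab cd SU; set S := ocrect a b c d.
have Sfin : leb2 S = ((b - a) * (d - c))%:E by rewrite leb2_ocrect// ltW.
have eta_le eta : 0 < eta <= 1 -> ((cp_measure S <= (1 + eta)%:E * leb2 S) /\
    (leb2 S <= (1 + eta)%:E * cp_measure S))%E.
  move=> etaP; have eta1 : 0 <= 1 + eta.
    by case/andP: etaP => /ltW e0 _; rewrite addr_ge0.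
  split; apply: ocrect_le_local => // w /SU Uw;
    have [e e0 he] := cp_local_estimate ab cd etaP Uw;
    by exists e => // x y t xe ye te; have [] := he x y t xe ye te.
have cfin : cp_measure S \is a fin_num.
  rewrite ge0_fin_numE//; have [h1 _] := eta_le 1 ltac:(by rewrite ltr01 lexx).
  by rewrite (le_lt_trans h1)// Sfin -EFinM ltry.
move: eta_le; rewrite -(fineK cfin) Sfin => eta_le; congr EFin.
set x := _ * _ in eta_le *; set y := fine _ in eta_le *.
have x0 : 0 <= x by rewrite mulr_ge0// subr_ge0 ltW.
have y0 : 0 <= y by rewrite fine_ge0.
have small (u v : R) : 0 <= v -> (forall eta, 0 < eta <= 1 -> u <= (1 + eta) * v) -> u <= v.
  move=> v0 huv; apply/ler_addgt0Pr => e e0.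
  (* Chosen so that [eta * v <= e]; the 1 added to [v] avoids a division by 0. *)
  pose eta := Num.min 1 (e / (v + 1)).
  have v1 : 0 < v + 1 by rewrite ltr_wpDl.
  have etaP : 0 < eta <= 1 by rewrite lt_min ltr01 divr_gt0//= ge_min lexx.
  apply: (le_trans (huv _ etaP)); rewrite mulrDl mul1r lerD2l.
  apply: (@le_trans _ _ (e / (v + 1) * v)).
    by rewrite ler_wpM2r// ge_min lexx orbT.
  by rewrite mulrAC ler_pdivrMr// ler_pM2l// lerDl.
by apply/eqP; rewrite eq_le; apply/andP; split; apply: small => // eta /eta_le[];
  rewrite -!EFinM !lee_fin.
Qed.

Lemma cp_measurable_preimage (B : set P) : measurable B ->
  measurable (toC @^-1` D `&` (fun w => ofC (q (toC w))) @^-1` B).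
Proof. exact: mpre. Qed.

Lemma cp_measurable_deriv :
  measurable_fun (toC @^-1` D) (reC \o dq \o toC) /\
  measurable_fun (toC @^-1` D) (imC \o dq \o toC).
Proof.
split; apply: plane_measurable_fun => // w Dw e e0;
  have [k k0 /cabs_near hk] := cp_deriv_cont cp Dw e0;
  (exists (k / 2); first by rewrite divr_gt0) => w' h1 h2;
  apply: le_lt_trans (hk w' h1 h2) => /=.
  by rewrite -reCN -reCD ler_reC_cabs.
by rewrite -imCN -imCD ler_imC_cabs.
Qed.

Lemma cp_measurable_inv :
  measurable_fun (toC @^-1` U) (fun w => ofC (h (toC w))).
Proof.
have oU := c_open_plane (cp_openU cp).
have near w : (toC @^-1` U) w -> forall e : R, 0 < e -> exists2 k : R, 0 < k &
    forall w' : P, `|w'.1 - w.1| < k -> `|w'.2 - w.2| < k ->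
    cabs (h (toC w') - h (toC w)) < e.
  move=> Uw e e0; have [k1 k10 hk1] := cp_inv_cont cp Uw e0.
  have [k2 k20 hk2] := oU w Uw.
  exists (Num.min (k1 / 2) k2); first by rewrite lt_min divr_gt0.
  move=> w'; rewrite !lt_min => /andP[x1 x2] /andP[y1 y2].
  apply: hk1; first exact: hk2.
  by rewrite (le_lt_trans (cabs_toCB_le _ _))// [ltRHS]splitr ltrD.
apply: measurable_fun_plane; apply: plane_measurable_fun => // w Uw e e0;
  have [k k0 hk] := near w Uw e e0; exists k => // w' h1 h2;
  apply: le_lt_trans (hk w' h1 h2).
  by rewrite -reCN -reCD ler_reC_cabs.
by rewrite -imCN -imCD ler_imC_cabs.
Qed.

Lemma plane_change_of_variables (B : set P) : measurable B ->
  leb2 (B `&` toC @^-1` U) = cp_measure B.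
Proof.
move=> mB; have oU := c_open_plane (cp_openU cp).
rewrite (@plane_open_measure_unique R _ leb2 cp_measure oU _ B mB).
  rewrite /cp_measure; congr integral; apply/seteqP; split=> w [Dw].
    by case.
  by move=> qw; do 2 split=> //; rewrite /= ofCK; have [] := cp_map cp Dw.
move=> a b c d SU.
have [ab|ba] := ltP a b; last first.
  by rewrite /ocrect set_itv_ge ?set0X ?measure0// -leNgt.
have [cd|dc] := ltP c d; last first.
  by rewrite /ocrect [X in _ `*` X]set_itv_ge ?setX0 ?measure0// -leNgt.
split; first exact: cp_rect.
apply: (@le_lt_trans _ _ ((b - a) * (d - c))%:E); last exact: ltry.
by rewrite -(leb2_ocrect (ltW ab) (ltW cd)).
Qed.

End PlaneChangeOfVariables.

(** * Complex derivatives and null sets *)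

Section ComplexSlopes.
Context {R : realType}.
Local Notation C := (Cplx R).

Lemma nbhs_cabsP (z : C) (A : set C) : nbhs z A <->
  exists2 e : R, 0 < e & forall z', cabs (z' - z) < e -> A z'.
Proof.
split=> [/nbhs_ballP[e /= e0 eA]|[e e0 eA]].
  have [re0 ie0] := ge0_Cplx (ltW e0).
  have eE : e = ofreal (reC e) by exact: Cplx_eqP.
  exists (reC e); first by move: e0; rewrite eE (_ : 0 = ofreal 0)// ofreal_lt.
  by move=> z' zz'; apply: eA; rewrite /ball/= eE distrC cabsE ofreal_lt.
apply/nbhs_ballP; exists (ofreal e) => /=.
  by rewrite (_ : 0 = ofreal 0)// ofreal_lt.
by move=> z'; rewrite /ball/= distrC cabsE ofreal_lt; exact: eA.
Qed.

Lemma cvg_cabsP (T : Type) (F : set_system T) (FF : Filter F) (f : T -> C) (l : C) :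
  f x @[x --> F] --> l <->
  forall e : R, 0 < e -> \forall x \near F, cabs (f x - l) < e.
Proof.
split=> [fl e e0|h B /nbhs_cabsP[e e0 eB]].
  by apply: (fl [set z | cabs (z - l) < e]); apply/nbhs_cabsP; exists e.
by apply: filterS (h e e0) => x; exact: eB.
Qed.

(** Caratheodory's form of differentiability: the difference quotient at [z] is a function
    continuous there. *)
Lemma derive1_slope (f phi : C -> C) (z a : C) : {for z, continuous phi} ->
  phi z = a -> (\forall z' \near z, f z' - f z = phi z' * (z' - z)) ->
  derivable f z 1 /\ derive1 f z = a.
Proof.
move=> cphi <- fE.
have h : (fun k : C => k^-1 *: (f (k + z) - f z)) @ 0^' --> phi z.
  have c0 : (fun k : C => k + z) @ 0^' --> z.
    apply: cvg_within_filter.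
    have : (fun k : C => k + z) @ nbhs (0 : C) --> 0 + z.
      by apply: cvgD; [exact: cvg_id|exact: cvg_cst].
    by rewrite add0r.
  have : (fun k : C => phi (k + z)) @ 0^' --> phi z by exact: (@cvg_comp _ _ _ (fun k : C => k + z) phi _ _ _ c0 cphi).
  apply: cvg_trans; apply: near_eq_cvg.
  have fE' : \forall k \near 0^', f (k + z) - f z = phi (k + z) * ((k + z) - z).
    exact: c0 fE.
  near=> k; have -> : f (k + z) - f z = phi (k + z) * ((k + z) - z) by near: k.
  have k0 : k != 0 by near: k; exact: nbhs_dnbhs_neq.
  by rewrite addrK [_ * k]mulrC scalerA mulVf// scale1r.
split; last exact: cvg_lim.
rewrite /derivable (_ : (fun k => _) = fun k : C => k^-1 *: (f (k + z) - f z)).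
  by apply/cvg_ex; exists (phi z); exact: h.
by apply/funext => k /=; rewrite [k%:A]mulr1.
Unshelve. all: by end_near. Qed.

Lemma horner_continuous (p : {poly C}) : continuous (horner p).
Proof.
elim/poly_ind: p => [|p c ih] z.
  rewrite (_ : horner 0 = cst 0); first exact: cst_continuous.
  by apply/funext => x; rewrite horner0.
rewrite (_ : horner _ = fun x => p.[x] * x + c); last first.
  by apply/funext => x; rewrite !hornerE.
by apply: (@cvgD _ _ _ (nbhs z)); [apply: cvgM; [exact: ih|exact: cvg_id]|exact: cvg_cst].
Qed.

(** The divided difference, built along Horner's scheme. Continuity in both points jointly is what
    later gives strict differentiability. *)
Lemma poly_slope (p : {poly C}) : exists s : C * C -> C, [/\ continuous s,
  forall z1 z2, p.[z1] - p.[z2] = s (z1, z2) * (z1 - z2) &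
  forall z, s (z, z) = p^`().[z] ].
Proof.
elim/poly_ind: p => [|p c [s [cs sE sd]]].
  exists (cst 0); split=> [z|z1 z2|z]; first exact: cvg_cst.
    by rewrite !horner0 subrr mul0r.
  by rewrite deriv0 horner0.
exists (fun w => s w * w.1 + p.[w.2]); split=> [w|z1 z2|z] /=.
- apply: cvgD; first by apply: cvgM; [exact: cs|exact: cvg_fst].
  by apply: continuous_comp; [exact: cvg_snd|exact: horner_continuous].
- rewrite !hornerE mulrDl mulrAC -sE; ring.
- by rewrite sd derivD derivM derivX derivC mulr1 addr0 !hornerE.
Qed.

Lemma quotient_slope (n d : {poly C}) : exists s : C * C -> C, [/\
  forall z1 z2, d.[z1] != 0 -> d.[z2] != 0 -> {for (z1, z2), continuous s},
  forall z1 z2, d.[z1] != 0 -> d.[z2] != 0 ->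
    n.[z1] / d.[z1] - n.[z2] / d.[z2] = s (z1, z2) * (z1 - z2) &
  forall z, s (z, z) = (n^`() * d - n * d^`()).[z] / d.[z] ^+ 2 ].
Proof.
have [sn [csn snE snd]] := poly_slope n; have [sd [csd sdE sdd]] := poly_slope d.
exists (fun w => (sn w * d.[w.2] - n.[w.2] * sd w) / (d.[w.1] * d.[w.2])).
have ch (p : {poly C}) (w : C * C) : p.[w'.2] @[w' --> w] --> p.[w.2].
  by apply: continuous_comp; [exact: cvg_snd|exact: horner_continuous].
have ch1 (p : {poly C}) (w : C * C) : p.[w'.1] @[w' --> w] --> p.[w.1].
  by apply: continuous_comp; [exact: cvg_fst|exact: horner_continuous].
split=> [z1 z2 d1 d2|z1 z2 d1 d2|z].
- apply: cvgM.
    apply: cvgB; apply: cvgM; [exact: csn|exact: ch|exact: ch|exact: csd].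
  apply: cvgV; first by rewrite mulf_neq0.
  by apply: cvgM; [exact: ch1|exact: ch].
- rewrite /= mulrAC mulrBl [_ * d.[z2] * _]mulrAC -snE -[n.[z2] * _ * _]mulrA -sdE.
  by field; rewrite d1 d2.
- by rewrite /= snd sdd !hornerE expr2 //.
Qed.

End ComplexSlopes.

Lemma negligible_of_small d (T : measurableType d) (R : realType)
    (mu : {measure set T -> \bar R}) (E : set T) :
  (forall e : R, 0 < e ->
    exists X, [/\ measurable X, E `<=` X & (mu X <= e%:E)%E]) ->
  mu.-negligible E.
Proof.
move=> small.
have /choice[X XP] : forall n : nat, exists X, [/\ measurable X, E `<=` X &
    (mu X <= (n.+1%:R^-1)%:E)%E] by move=> n; apply: small; rewrite invr_gt0.
have mX n : measurable (X n) by have [] := XP n.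
exists (\bigcap_n X n); split.
- exact: bigcapT_measurable.
- apply/eqP; rewrite eq_le measure_ge0 andbT; apply/lee_addgt0Pr => e e0.
  rewrite add0e; pose n := Num.truncn e^-1.
  apply: (@le_trans _ _ (mu (X n))).
    apply: le_measure; rewrite ?inE//; first exact: bigcapT_measurable.
    exact: bigcap_inf.
  have [_ _ /le_trans] := XP n; apply; rewrite lee_fin -[leRHS]invrK.
  by rewrite lef_pV2 ?posrE ?invr_gt0// ltW// truncnS_gt.
- by move=> x Ex n _; have [_ + _] := XP n; exact.
Qed.

(** * Null sets from Lipschitz parametrisations *)

Section PlaneNullSets.
Context {R : realType}.
Local Notation P := (measurableTypeR R * measurableTypeR R)%type.
Local Notation C := (Cplx R).
Local Notation leb := (@lebesgue_measure R).
Local Notation leb2 := (measure_function.Measure.clone _ _ _ (leb \x leb)%E _).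

(* A set that is Lipschitz parametrised by a subset of [0, 1] is covered by [n]
   squares of side [O(1/n)]. *)
Lemma negligible_lipschitz_param (E : set P) (tau : P -> R) (K k : R) :
  0 < k -> 0 < K -> (forall w, E w -> 0 <= tau w <= 1) ->
  (forall w w', E w -> E w' -> `|tau w - tau w'| < k ->
    cabs (toC w - toC w') <= K * `|tau w - tau w'|) ->
  (leb \x leb)%E.-negligible E.
Proof.
move=> k0 K0 tau01 tauK; apply: negligible_of_small => e e0.
(* Large enough for [1 / n < k], and for the total area [(n + 1) (2K / n)^2 <= 8 K^2 / n] of the
   boxes to be at most [e]. *)
pose n := (Num.truncn (Num.max k^-1 (8 * K ^+ 2 / e))).+1.
have nE : Num.max k^-1 (8 * K ^+ 2 / e) < n%:R by exact: truncnS_gt.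
have n0 : 0 < n%:R :> R by rewrite ltr0n.
have nk : n%:R^-1 < k.
  rewrite -[ltRHS]invrK ltf_pV2 ?posrE ?invr_gt0// (le_lt_trans _ nE)//.
  by rewrite le_max lexx.
have ne : 8 * K ^+ 2 / n%:R <= e.
  rewrite ler_pdivrMr// [e * _]mulrC -ler_pdivrMr// (le_trans _ (ltW nE))//.
  by rewrite le_max lexx orbT.
pose piece (i : nat) := [set w | E w /\ Num.truncn (n%:R * tau w) = i].
pose r := K / n%:R.
have r0 : 0 < r by rewrite divr_gt0.
(* A square of half-side [K / n] around an arbitrarily chosen point of the piece; an empty piece
   gets the empty set. *)
pose box (i : nat) : set P := if pselect (exists w, piece i w) is left H then
  let w := sval (cid H) in ccrect (w.1 - r) (w.1 + r) (w.2 - r) (w.2 + r) else set0.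
have mbox i : measurable (box i).
  by rewrite /box; case: pselect => // H; apply: measurableX.
have lebbox i : ((leb \x leb) (box i) <= ((2 * r) * (2 * r))%:E)%E.
  rewrite /box; case: pselect => [H|_]; last first.
    by rewrite measure0 lee_fin !mulr_ge0// ltW.
  rewrite leb2_itv !lebesgue_measure_itv/= !lte_fin.
  have e' (x : R) : (if (x - r < x + r)%R then ((x + r)%:E - (x - r)%:E)%E else 0%E) = (2 * r)%:E.
    rewrite ltrD2l gtrN// -EFinB; congr EFin; ring.
  by rewrite !e' -EFinM.
exists (\big[setU/set0]_(i < n.+1) box i); split.
- exact: bigsetU_measurable.
- move=> w Ew; have /andP[t0 t1] := tau01 w Ew.
  pose i := Num.truncn (n%:R * tau w).
  have tr w' : E w' -> (Num.truncn (n%:R * tau w'))%:R <= n%:R * tau w' <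
      (Num.truncn (n%:R * tau w')).+1%:R.
    move=> Ew'; apply: truncn_itv; rewrite mulr_ge0//.
    by have /andP[] := tau01 w' Ew'.
  have iN : (i < n.+1)%N.
    rewrite -(ltr_nat R); have /andP[h _] := tr w Ew.
    by rewrite (le_lt_trans h)// (@le_lt_trans _ _ n%:R)// ?ltr_nat// ler_piMr// ltW.
  rewrite -bigcup_mkord; exists i => //; rewrite /box.
  case: pselect => [H|]; last by case; exists w.
  case: cid => w' [Ew' w'i] /=.
  have d : `|tau w - tau w'| < n%:R^-1.
    have /andP[h1 h2] := tr w Ew; have /andP[h3 h4] := tr w' Ew'.
    rewrite w'i in h3 h4; rewrite -(ltr_pM2l n0) mulfV ?gt_eqF//.
    rewrite -[X in X * _](gtr0_norm n0) -normrM mulrBr.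
    move: h1 h2 h3 h4; rewrite -/i -natr1 => h1 h2 h3 h4.
    by rewrite ltr_norml; apply/andP; split; lra.
  have := tauK w w' Ew Ew' (lt_trans d nk).
  move=> /le_trans/(_ (_ : _ <= r)) ww'.
  have {}ww' : cabs (toC w - toC w') <= r by apply: ww'; rewrite ler_pM2l// ltW.
  have := le_trans (ler_reC_cabs _) ww'; have := le_trans (ler_imC_cabs _) ww'.
  rewrite reCD imCD reCN imCN /= => h1 h2.
  by split; rewrite /= in_itv/= -ler_distl.
- apply: (le_trans (Boole_inequality _ _)) => //.
  apply: (@le_trans _ _ (\sum_(i < n.+1) ((2 * r) * (2 * r))%:E)%E).
    by apply: lee_sum => i _; exact: lebbox.
  rewrite sumEFin lee_fin sumr_const card_ord -[_ *+ n.+1]mulr_natr.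
  apply: (le_trans _ ne); rewrite /r.
  have -> : 2 * (K / n%:R) * (2 * (K / n%:R)) * n.+1%:R =
    4 * K ^+ 2 / n%:R * (n.+1%:R / n%:R) by field; rewrite gt_eqF.
  have -> : 8 * K ^+ 2 / n%:R = 4 * K ^+ 2 / n%:R * 2 by field; rewrite gt_eqF.
  rewrite ler_wpM2l//; first by rewrite divr_ge0 ?mulr_ge0 ?sqr_ge0// ltW.
  by rewrite ler_pdivrMr// -natrM ler_nat; lia.
Qed.

Lemma negligible_point (z : C) : (leb \x leb)%E.-negligible [set w : P | toC w = z].
Proof.
apply: (@negligible_lipschitz_param _ (fun=> 0) 1 1) => //.
  by move=> w _; rewrite lexx ler01.
by move=> w w' -> -> _; rewrite !subrr cabs0 normr0 mulr0.
Qed.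

Lemma negligible_roots (p : {poly C}) : p != 0 ->
  (leb \x leb)%E.-negligible [set w : P | p.[toC w] = 0].
Proof.
move=> p0; have [rs pE] := closed_field_poly_normal p.
apply: (@negligibleS _ _ _ _ (\bigcup_i [set w : P | toC w = rs`_i])).
  move=> w /= /rootP; rewrite {1}pE rootZ ?lead_coef_eq0// root_prod_XsubC.
  by move=> /(nthP 0)[i _ iE]; exists i.
by apply: negligible_bigcup => i; exact: negligible_point.
Qed.

(* The parameter of a point, and hence the point itself, depends on the image
   under [psi] in a Lipschitz way on each of the countably many pieces. *)
Lemma negligible_curve_preimage (gam : R -> C) (I : set R) (psi : C -> C)
    (G : set C) : I `<=` `[0, 1]%classic ->
  (forall t, I t -> exists k : nat, forall t', I t' -> `|t' - t| < k.+1%:R^-1 ->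
     cabs (gam t' - gam t) <= k.+1%:R * `|t' - t|) ->
  (forall z, G z -> exists k : nat, forall z1 z2,
     cabs (z1 - z) < k.+1%:R^-1 -> cabs (z2 - z) < k.+1%:R^-1 ->
     cabs (z1 - z2) <= k.+1%:R * cabs (psi z1 - psi z2)) ->
  (leb \x leb)%E.-negligible
    [set w : P | G (toC w) /\ exists2 t, I t & gam t = psi (toC w)].
Proof.
move=> I01 gamL psiL.
(* Cells of side [1 / (2 (j + 1))]: two points of one cell are closer than [1 / (j + 1)], the radius
   in the expansion property of [psi]. *)
pose cell (j : nat) (w : P) := (Num.floor (w.1 * (2 * j.+1%:R)), Num.floor (w.2 * (2 * j.+1%:R))).
pose tau (w : P) : R := xget 0 [set t | I t /\ gam t = psi (toC w)].
(* On each piece the constants are uniform: [k] for the curve, [j] for [psi], and the cell brings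
   points close together. For parameters closer than [1 / (k + 1)] this gives [|w - w'| <= (j+1)
   |psi w - psi w'| <= (j+1) (k+1) |tau w - tau w'|]. *)
pose F (x : nat * nat * (int * int)) : set P := [set w |
  [/\ I (tau w), gam (tau w) = psi (toC w), cell x.1.2 w = x.2,
    forall t', I t' -> `|t' - tau w| < x.1.1.+1%:R^-1 ->
     cabs (gam t' - gam (tau w)) <= x.1.1.+1%:R * `|t' - tau w| &
    forall z1 z2, cabs (z1 - toC w) < x.1.2.+1%:R^-1 ->
     cabs (z2 - toC w) < x.1.2.+1%:R^-1 ->
     cabs (z1 - z2) <= x.1.2.+1%:R * cabs (psi z1 - psi z2)]].
pose E n : set P := if (choice.unpickle n : option (nat * nat * (int * int))) is Some x
  then F x else set0.
apply: (@negligibleS _ _ _ _ (\bigcup_n E n)).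
  move=> w [Gw [t0 It0 gt0]].
  have [It gt] : [set t | I t /\ gam t = psi (toC w)] (tau w).
    by apply: xgetPex; exists t0.
  have [k hk] := gamL _ It; have [j hj] := psiL _ Gw.
  by exists (choice.pickle (k, j, cell j w)) => //; rewrite /E choice.pickleK.
apply: negligible_bigcup => n; rewrite /E; case: choice.unpickle => [|]; last first.
  exact: negligible_set0.
move=> [[k j] c].
apply: (@negligible_lipschitz_param _ tau (j.+1%:R * k.+1%:R) k.+1%:R^-1).
- by rewrite invr_gt0.
- by rewrite mulr_gt0.
- by move=> w [/I01]; rewrite /= in_itv/=.
move=> w w' [It gt] /= cw hk hj [It' gt'] /= cw' _ _ ww'.
have cabs_cell : cabs (toC w' - toC w) < j.+1%:R^-1.
  have fl (x y : R) : Num.floor (x * (2 * j.+1%:R)) = Num.floor (y * (2 * j.+1%:R)) ->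
      `|x - y| < j.+1%:R^-1 / 2.
    have m0 : 0 < 2 * j.+1%:R :> R by rewrite mulr_gt0.
    move=> fxy; rewrite -invfM mulrC -(ltr_pM2r m0) mulVf ?gt_eqF//.
    rewrite -[X in _ * X](gtr0_norm m0) -normrM mulrBl.
    have /andP[h1 h2] := floor_itv (x * (2 * j.+1%:R)).
    have /andP[h3 h4] := floor_itv (y * (2 * j.+1%:R)).
    rewrite -fxy in h3 h4; move: h2 h4; rewrite !intrD => h2 h4.
    by rewrite ltr_norml; apply/andP; split; lra.
  apply: (le_lt_trans (cabs_toCB_le _ _)).
  have [c1 c2] : cell j w' = cell j w by rewrite cw.
  by rewrite [ltRHS]splitr ltrD// fl.
have := hj (toC w) (toC w'); rewrite subrr cabs0 invr_gt0 ltr0Sn => /(_ isT cabs_cell).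
move=> /le_trans; apply; rewrite -mulrA ler_pM2l// -gt -gt'.
by rewrite -cabsN opprB distrC; apply: hk; rewrite // distrC.
Qed.

End PlaneNullSets.

Section ChangeOfVariables.
Context d (T : measurableType d) (R : realType).
Variables (mu : {measure set T -> \bar R}) (D U : set T) (q : T -> T) (g : T -> R).
Hypotheses (mD : measurable D) (mU : measurable U).
Hypotheses (mq : measurable_fun D q) (mg : measurable_fun D g).
Hypothesis g0 : forall z, 0 <= g z.
Hypothesis cov : forall B, measurable B ->
  mu (B `&` U) = (\int[mu]_(z in D `&` q @^-1` B) (g z)%:E)%E.

Local Open Scope ereal_scope.

Lemma ge0_change_of_variables (G : T -> \bar R) : measurable_fun setT G ->
  (forall y, 0 <= G y) ->
  \int[mu]_(y in U) G y = \int[mu]_(z in D) (G (q z) * (g z)%:E).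
Proof.
move=> mG G0; pose s := nnsfun_approx measurableT mG.
have mEg : measurable_fun D (EFin \o g) by apply/measurable_EFinP.
have sG y : (s n y)%:E @[n --> \oo] --> G y.
  by apply: (cvg_nnsfun_approx measurableT mG) => // x _; exact: G0.
have nd y : {homo (fun n => (s n y)%:E) : a b / (a <= b)%N >-> a <= b}.
  by move=> a b ab; rewrite lee_fin; exact/lefP/(nd_nnsfun_approx measurableT mG).
have msq n : measurable_fun D (fun z => (s n (q z))%:E).
  by apply/measurable_EFinP; apply: measurableT_comp.
have simple n : \int[mu]_(y in U) (s n y)%:E =
    \int[mu]_(z in D) ((s n (q z))%:E * (g z)%:E).
  pose c := fset_set (range (s n)); pose B i := s n @^-1` [set c`_i]%R.
  have c0 (i : 'I_(size c)) : (0 <= c`_i)%R.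
    have : (c`_i)%R \in c by apply: mem_nth.
    by rewrite /c in_fset_set// => /set_mem[x _ <-].
  have mB i : measurable (B i) by rewrite /B -[X in measurable X]setTI; exact: measurable_funP.
  have sE y : s n y = (\sum_(i < size c) c`_i * \1_(B i) y)%R by exact: fimfunEord.
  have ind_int (V : set T) (f : T -> R) i : measurable V -> measurable_fun V f ->
      (forall x, (0 <= f x)%R) -> measurable (V `&` B i) ->
      \int[mu]_(y in V) (\1_(B i) y * f y)%:E = \int[mu]_(y in V `&` B i) (f y)%:E.
    move=> mV mf f0 mVB; rewrite integral_mkcondr; apply: eq_integral => y _.
    rewrite patchE indicE; by case: ifPn => _; rewrite ?mul1r ?mul0r.
  transitivity (\sum_(i < size c) (c`_i)%:E * mu (B i `&` U)).
    under eq_integral do rewrite sE -sumEFin.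
    rewrite ge0_integral_sum//=; last 2 first.
    - move=> i; apply/measurable_EFinP; apply: measurable_funM; first exact: measurable_cst.
      by apply: measurable_funTS; exact: measurable_indic.
    - by move=> i x _; rewrite lee_fin mulr_ge0// c0.
    apply: eq_bigr => i _; under eq_integral do rewrite EFinM.
    rewrite ge0_integralZl//; try by [rewrite lee_fin c0 |
      apply/measurable_EFinP; apply: measurable_funTS; exact: measurable_indic].
    by rewrite integral_indic.
  transitivity (\sum_(i < size c) (c`_i)%:E * \int[mu]_(z in D `&` q @^-1` (B i)) (g z)%:E).
    by apply: eq_bigr => i _; rewrite cov.
  under [RHS]eq_integral do rewrite sE -EFinM mulr_suml -sumEFin.
  have mqB i : measurable (D `&` q @^-1` B i) by exact: mq.
  have mi i : measurable_fun D (fun z => \1_(B i) (q z) : R).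
    by apply: measurableT_comp => //; exact: measurable_indic.
  rewrite ge0_integral_sum//=; last 2 first.
  - move=> i; apply/measurable_EFinP; apply: measurable_funM => //.
    by apply: measurable_funM.
  - by move=> i x _; rewrite lee_fin !mulr_ge0// c0.
  apply: eq_bigr => i _; under [RHS]eq_integral do rewrite -mulrA EFinM.
  rewrite ge0_integralZl//; try by [rewrite lee_fin c0 |
    move=> x _; rewrite lee_fin mulr_ge0 |
    apply/measurable_EFinP; exact: measurable_funM].
  congr (_ * _); rewrite integral_mkcondr; apply: eq_integral => z _.
  rewrite patchE indicE.
  have -> : (z \in q @^-1` B i) = (q z \in B i) by apply/idP/idP; rewrite !inE.
  by case: ifPn => _; rewrite ?mul1r ?mul0r.
have GE y : G y = limn (fun n => (s n y)%:E) by apply/esym/cvg_lim.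
have GqE z : G (q z) * (g z)%:E = limn (fun n => (s n (q z))%:E * (g z)%:E).
  by apply/esym/cvg_lim => //; apply: cvgeZr => //; exact: sG.
under eq_integral do rewrite GE; under [RHS]eq_integral do rewrite GqE.
rewrite monotone_convergence//; try by [move=> x _; exact: nd |
  move=> n x _; rewrite lee_fin; exact: fun_ge0 |
  move=> n; apply/measurable_EFinP; exact: measurable_funTS].
rewrite monotone_convergence//; try by [move=> n; apply: emeasurable_funM |
  move=> n x _; rewrite mule_ge0// lee_fin |
  move=> x _ a b ab; rewrite lee_wpmul2r ?lee_fin// -lee_fin nd].
by congr (limn _); apply/funext => n; exact: simple.
Qed.

End ChangeOfVariables.

(** * Lebesgue measure of the sphere *)

Section SigmaFiniteOf.
Context d (T : measurableType d) (R : realType) (mu : {measure set T -> \bar R}).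
Hypothesis sf : sigma_finite setT mu.

(** An alias convertible to [mu] that carries the sigma-finite structure, so that statements about
    the two are interchangeable. *)
Definition sigma_finite_of & sigma_finite setT mu : set T -> \bar R := mu.

Local Notation nu := (sigma_finite_of sf).

HB.instance Definition _ := Measure.copy nu mu.

HB.instance Definition _ := Measure_isSigmaFinite.Build _ _ _ nu sf.

End SigmaFiniteOf.

Section SphereMeasureTheory.
Context {R : realType}.
Local Notation C := (Cplx R).
Local Notation P := (measurableTypeR R * measurableTypeR R)%type.
Local Notation leb := (@lebesgue_measure R).

Definition sphere_of_plane (N : set P) : set (sphere R) :=
  [set y | if y is Some z then N (ofC z) else False].

Lemma plane_of_sphereK (N : set P) :
  @plane_to_sphere R @^-1` sphere_of_plane N = N.
Proof. by apply/seteqP; split=> -[]. Qed.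

Lemma measurable_plane_of_sphere (B : set (sphere R)) :
  measurable B <-> measurable (@plane_to_sphere R @^-1` B).
Proof. by []. Qed.

(** Infinity is null because [plane_to_sphere] omits it; adding it to the covering set costs
    nothing. *)
Lemma negligible_sphere (X : set (sphere R)) :
  (leb \x leb)%E.-negligible (@plane_to_sphere R @^-1` X) ->
  (Leb R).-negligible X.
Proof.
move=> [N [mN N0 XN]]; exists (sphere_of_plane N `|` [set None]); split.
- by apply/measurable_plane_of_sphere; rewrite preimage_setU plane_of_sphereK
    (_ : _ @^-1` [set None] = set0) ?setU0//; apply/seteqP; split.
- by rewrite LebE preimage_setU plane_of_sphereK
    (_ : _ @^-1` [set None] = set0) ?setU0//; apply/seteqP; split.
- move=> [z|] Xz; last by right.
  by left; apply: XN; rewrite /= /plane_to_sphere; case: z Xz.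
Qed.

Lemma ge0_integral_Leb (D : set (sphere R)) (f : sphere R -> \bar R) :
  measurable D -> measurable_fun D f -> (forall y, (0 <= f y)%E) ->
  (\int[Leb R]_(y in D) f y =
   \int[leb \x leb]_(w in @plane_to_sphere R @^-1` D) f (plane_to_sphere w))%E.
Proof.
move=> mD mf f0.
exact: (ge0_integral_pushforward (@measurable_plane_to_sphere R) (leb \x leb)%E mD mf
  (fun y _ => f0 y)).
Qed.

Let Leb_sigma_finite : sigma_finite setT (Leb R).
Proof.
pose F n : set P := ocrect (- n%:R) n%:R (- n%:R) n%:R.
exists (fun n => sphere_of_plane (F n) `|` [set None]).
  apply/esym; rewrite -subTset => -[z|] _; last by exists 0%N => //; right.
  pose n := (Num.truncn (`|reC z| + `|imC z|)).+1.
  have zn : `|reC z| + `|imC z| < n%:R by exact: truncnS_gt.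
  exists n => //; left; rewrite /sphere_of_plane /F /ocrect /= !in_itv/=.
  have : `|reC z| < n%:R by rewrite (le_lt_trans _ zn)// lerDl.
  have : `|imC z| < n%:R by rewrite (le_lt_trans _ zn)// lerDr.
  by rewrite !ltr_norml => /andP[-> /ltW->] /andP[-> /ltW->].
move=> n.
have E : @plane_to_sphere R @^-1` (sphere_of_plane (F n) `|` [set None]) = F n.
  rewrite preimage_setU plane_of_sphereK (_ : _ @^-1` [set None] = set0) ?setU0//.
  by apply/seteqP; split.
split; last by rewrite LebE E leb2_ocrect ?ltry// (@le_trans _ _ 0)// oppr_le0.
by apply: (measurable_plane_of_sphere _).2; rewrite E; exact: measurable_ocrect.
Qed.

Definition Leb_sf : {sigma_finite_measure set (sphere R) -> \bar R} :=
  sigma_finite_of Leb_sigma_finite.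

(* Any positive integrable function would do. *)
Definition weight (y : sphere R) : R :=
  if y is Some z then normal_pdf 0 1 (reC z) * normal_pdf 0 1 (imC z) else 1.

Lemma weight_gt0 y : 0 < weight y.
Proof.
have pos x : 0 < normal_pdf 0 1 x :> R.
  by rewrite normal_pdfE ?oner_neq0// mulr_gt0 ?expR_gt0 ?normal_peak_gt0 ?oner_neq0.
by case: y => [z|] //=; rewrite mulr_gt0.
Qed.

Lemma integrable_weight : (Leb R).-integrable setT (EFin \o weight).
Proof.
have mpdf : measurable_fun setT (normal_pdf 0 1 : measurableTypeR R -> R).
  exact: measurable_normal_pdf.
have mw : measurable_fun setT (fun w : P => normal_pdf 0 1 w.1 * normal_pdf 0 1 w.2 : R).
  apply: measurable_funM; apply: measurableT_comp => //.
have mw' : measurable_fun setT weight.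
  move=> _ B mB; rewrite setTI; apply/measurable_plane_of_sphere.
  by have := mw measurableT B mB; rewrite setTI.
apply/integrableP; split; first exact/measurable_EFinP.
under eq_integral => y _ do rewrite gee0_abs ?lee_fin ?(ltW (weight_gt0 y))//.
rewrite ge0_integral_Leb//; last 2 first.
- exact/measurable_EFinP.
- by move=> y; rewrite lee_fin ltW ?weight_gt0.
rewrite preimage_setT fubini_tonelli1; last 2 first.
- exact/measurable_EFinP.
- by move=> w; rewrite lee_fin ltW ?weight_gt0.
apply: (@le_lt_trans _ _ (\int[leb]_x (normal_pdf 0 1 x)%:E)%E); last first.
  by rewrite integral_normal_pdf ltry.
rewrite le_eqVlt; apply/orP; left; apply/eqP; apply: eq_integral => x _.
rewrite /fubini_F /=; under eq_integral do rewrite EFinM.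
rewrite ge0_integralZl//; try by [apply/measurable_EFinP |
  move=> y _; rewrite lee_fin normal_pdf_ge0 | rewrite lee_fin normal_pdf_ge0].
by rewrite integral_normal_pdf mule1.
Qed.

End SphereMeasureTheory.

(** * Sheets of a rational map *)

Section RationalMap.
Context {R : realType} (Q : ratmap R).
Local Notation C := (Cplx R).
Local Notation P := (measurableTypeR R * measurableTypeR R)%type.
Local Notation leb := (@lebesgue_measure R).
Local Notation n := (rnum Q).
Local Notation d := (rden Q).

Definition ratC (z : C) : C := n.[z] / d.[z].

Lemma rat_finite z : d.[z] != 0 -> Q (Some z) = Some (ratC z).
Proof. by move=> /negPf dz; rewrite /ratfun dz. Qed.

Lemma rat_pole z : d.[z] = 0 -> Q (Some z) = None.
Proof. by move=> dz; rewrite /ratfun dz eqxx. Qed.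

Lemma affine_rat z : affine (Q (Some z)) = ratC z.
Proof.
rewrite /ratfun /ratC; case: ifPn => //= /eqP ->.
by rewrite invr0 mulr0.
Qed.

Definition wronskian : {poly C} := n^`() * d - n * d^`().

Lemma rat_slope : exists s : C * C -> C, [/\
  forall z1 z2, d.[z1] != 0 -> d.[z2] != 0 -> {for (z1, z2), continuous s},
  forall z1 z2, d.[z1] != 0 -> d.[z2] != 0 ->
    ratC z1 - ratC z2 = s (z1, z2) * (z1 - z2) &
  forall z, s (z, z) = wronskian.[z] / d.[z] ^+ 2 ].
Proof. exact: quotient_slope. Qed.

Lemma near_den z : d.[z] != 0 -> \forall z' \near z, d.[z'] != 0.
Proof.
move=> dz; have /cvg_cabsP/(_ _ (cabs_gt0 dz)) : d.[z'] @[z' --> z] --> d.[z].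
  exact: horner_continuous.
apply: filterS => z' h; apply/eqP => dz'.
by move: h; rewrite dz' sub0r cabsN ltxx.
Qed.

Lemma derive_ratC z : d.[z] != 0 ->
  derivable ratC z 1 /\ derive1 ratC z = wronskian.[z] / d.[z] ^+ 2.
Proof.
move=> dz; have [s [cs sE sd]] := rat_slope.
apply: (@derive1_slope _ _ (fun z' => s (z', z))).
- have h : (fun z' : C => (z', z)) @ z --> (z, z).
    exact: (@cvg_pair C C C (nbhs z) (nbhs z) (nbhs z) _ _ _ id (cst z)
      cvg_id (cvg_cst z)).
  exact: (continuous_comp h (cs z z dz dz)).
- exact: sd.
- by apply: filterS (near_den dz) => z' dz'; exact: sE.
Qed.

(** The divided difference is jointly continuous at [(z, z)], where it equals the derivative; the
    error is [s (z1, z2) - s (z, z)] times [z1 - z2]. *)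
Lemma ratC_strict z : d.[z] != 0 -> forall e : R, 0 < e ->
  exists2 k : R, 0 < k & forall z1 z2, cabs (z1 - z) < k -> cabs (z2 - z) < k ->
    cabs (ratC z1 - ratC z2 - derive1 ratC z * (z1 - z2)) <= e * cabs (z1 - z2).
Proof.
move=> dz e e0; have [s [cs sE sd]] := rat_slope.
have [_ ->] := derive_ratC dz; rewrite -sd.
have /cvg_cabsP/(_ e e0) [[A B] [/= nA nB] AB] := cs z z dz dz.
have [k1 k10 h1] := (nbhs_cabsP _ _).1 nA.
have [k2 k20 h2] := (nbhs_cabsP _ _).1 nB.
have [k3 k30 h3] := (nbhs_cabsP _ _).1 (near_den dz).
exists (Num.min k1 (Num.min k2 k3)); first by rewrite !lt_min k10 k20.
move=> z1 z2; rewrite !lt_min => /and3P[a1 a2 a3] /and3P[b1 b2 b3].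
rewrite sE; [|exact: h3|exact: h3]; rewrite -mulrBl cabsM.
rewrite ler_wpM2r ?cabs_ge0// ltW//.
by apply: (AB (z1, z2)); split; [exact: h1|exact: h2].
Qed.

Lemma ratC_deriv_cont z : d.[z] != 0 -> forall e : R, 0 < e ->
  exists2 k : R, 0 < k & forall z', cabs (z' - z) < k ->
    cabs (derive1 ratC z' - derive1 ratC z) < e.
Proof.
move=> dz e e0; apply/nbhs_cabsP.
have c : (fun z' => wronskian.[z'] / (d.[z'] * d.[z'])) z' @[z' --> z] -->
    wronskian.[z] / (d.[z] * d.[z]).
  have cw : wronskian.[z'] @[z' --> z] --> wronskian.[z] by exact: horner_continuous.
  apply: (cvgM cw).
  have cd : d.[z'] @[z' --> z] --> d.[z] by exact: horner_continuous.
  by apply: cvgV; [rewrite mulf_neq0|exact: (cvgM cd cd)].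
have /cvg_cabsP/(_ e e0) := c.
rewrite (derive_ratC dz).2 expr2; apply: filterS2 (near_den dz) => z' dz'.
by rewrite (derive_ratC dz').2 expr2.
Qed.

(** A linearisation error of half the derivative leaves the other half as a lower bound. One integer
    gives both the radius and the constant, as the countable decomposition in
    [negligible_curve_preimage] requires. *)
Lemma ratC_expanding z : d.[z] != 0 -> derive1 ratC z != 0 ->
  exists k : nat, forall z1 z2,
    cabs (z1 - z) < k.+1%:R^-1 -> cabs (z2 - z) < k.+1%:R^-1 ->
    cabs (z1 - z2) <= k.+1%:R * cabs (ratC z1 - ratC z2).
Proof.
move=> dz d0; pose a := cabs (derive1 ratC z).
have a0 : 0 < a by exact: cabs_gt0.
have [k k0 hk] := ratC_strict dz (divr_gt0 a0 (ltr0n _ 2)).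
pose m := Num.truncn (Num.max k^-1 (2 / a)).
have mE : Num.max k^-1 (2 / a) < m.+1%:R by exact: truncnS_gt.
have mk : m.+1%:R^-1 < k.
  rewrite -[ltRHS]invrK ltf_pV2 ?posrE ?invr_gt0// (le_lt_trans _ mE)//.
  by rewrite le_max lexx.
have ma : 2 / a < m.+1%:R by rewrite (le_lt_trans _ mE)// le_max lexx orbT.
exists m => z1 z2 h1 h2; have := hk z1 z2 (lt_trans h1 mk) (lt_trans h2 mk).
set u := derive1 ratC z * (z1 - z2); set v := ratC z1 - ratC z2 => vu.
have uE : cabs u = a * cabs (z1 - z2) by rewrite /u cabsM.
have := ler_cabs_dist v u; move=> /le_trans/(_ vu); rewrite ler_distl => /andP[+ _].
rewrite uE lerBlDr => h.
have {}h : a / 2 * cabs (z1 - z2) <= cabs v by lra.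
rewrite -(ler_pM2l (divr_gt0 a0 (ltr0n _ 2))) (le_trans h)//.
rewrite mulrA ler_peMl ?cabs_ge0// mulrC -ler_pdivrMr ?divr_gt0//.
by rewrite mul1r invf_div ltW.
Qed.

(** If it vanished, then [n' d = n d'] and coprimality would give that [d] divides [d'] and [n]
    divides [n']. In characteristic 0 a polynomial dividing its derivative is constant, so the
    degree of [Q] would be 0. *)
Lemma wronskian_neq0 : (0 < ratdeg Q)%N -> wronskian != 0.
Proof.
rewrite /ratdeg => deg; apply/eqP => /eqP; rewrite subr_eq0 => /eqP W0.
have cop := rnum_rden_coprime Q.
have size0 (p : {poly C}) : p %| p^`() -> (size p <= 1)%N.
  move=> pp; have [p'0|p'0] := eqVneq p^`() 0.
    rewrite leqNgt; apply/negP => p1.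
    have : p^`()`_(size p).-2 = 0 by rewrite p'0 coef0.
    rewrite coef_deriv prednK -?subn1 ?subn_gt0// subn1 => /eqP.
    rewrite mulrn_eq0 -lead_coefE lead_coef_eq0 -size_poly_eq0 => /orP[|] /eqP h.
      by move: p1 h; case: (size p) => [|[|m]].
    by rewrite h in p1.
  have := dvdp_leq p'0 pp; rewrite leqNgt lt_size_deriv//.
  by apply: contra_neq p'0 => ->; rewrite deriv0.
have dn : (size d <= 1)%N.
  apply: size0; rewrite -(Gauss_dvdpr _ (_ : coprimep d n)) 1?coprimep_sym//.
  by rewrite -W0 dvdp_mull.
have nn : (size n <= 1)%N.
  apply: size0; rewrite -(Gauss_dvdpl _ cop) W0 dvdp_mulr//.
move: deg; rewrite -subn1 subn_gt0 ltnNge geq_max.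
by rewrite nn dn.
Qed.

Lemma negligible_irregular : (0 < ratdeg Q)%N -> (leb \x leb)%E.-negligible
  [set w : P | ~ (d.[toC w] != 0 /\ derive1 ratC (toC w) != 0)].
Proof.
move=> deg; have d0 : d != 0.
  apply/eqP => d0; have := wronskian_neq0 deg.
  by rewrite /wronskian d0 deriv0 !mulr0 subrr eqxx.
have W0 := wronskian_neq0 deg.
apply: negligibleS (negligible_roots (mulf_neq0 W0 d0)) => w /= h.
rewrite hornerM; have [->|dw] := eqVneq d.[toC w] 0; first by rewrite mulr0.
have [->|Ww] := eqVneq wronskian.[toC w] 0; first by rewrite mul0r.
by exfalso; apply: h; split=> //; rewrite (derive_ratC dw).2 mulf_neq0// invr_neq0// expf_neq0.
Qed.

End RationalMap.

(** * Analytic arcs: null preimages and open complement *)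

Section AnalyticArc.
Context {R : realType} (sigma : set (sphere R)).
Local Notation C := (Cplx R).
Local Notation P := (measurableTypeR R * measurableTypeR R)%type.
Local Notation leb := (@lebesgue_measure R).
Hypothesis arc : analytic_arc sigma.

Lemma derivable_lipschitz (f : C -> C) (a : C) : derivable f a 1 ->
  exists k : nat, forall z, cabs (z - a) < k.+1%:R^-1 ->
    cabs (f z - f a) <= k.+1%:R * cabs (z - a).
Proof.
move=> /cvg_ex[l /cvg_cabsP/(_ 1 ltr01)]; rewrite /dnbhs /within /=.
move=> /nbhs_cabsP[e e0 he].
pose k := Num.truncn (Num.max e^-1 (1 + cabs l)).
have kE : Num.max e^-1 (1 + cabs l) < k.+1%:R by exact: truncnS_gt.
have ke : k.+1%:R^-1 < e.
  rewrite -[ltRHS]invrK ltf_pV2 ?posrE ?invr_gt0// (le_lt_trans _ kE)//.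
  by rewrite le_max lexx.
have kl : 1 + cabs l < k.+1%:R by rewrite (le_lt_trans _ kE)// le_max lexx orbT.
exists k => z za; have [->|zNa] := eqVneq z a; first by rewrite !subrr cabs0 mulr0.
have h0 : z - a != 0 by rewrite subr_eq0.
have := he (z - a); rewrite subr0 => /(_ (lt_trans za ke) h0).
rewrite /shift/= [(z - a)%:A]mulr1 subrK => hl.
have fE : f z - f a = (z - a) * ((z - a)^-1 *: (f z - f a)).
  by rewrite [_ *: _]/(_ * _) mulrA mulfV// mul1r.
rewrite fE cabsM mulrC ler_wpM2r ?cabs_ge0// (le_trans _ (ltW kl))//.
by rewrite -[X in cabs X](subrK l) (le_trans (cabsD _ _))// lerD2r ltW.
Qed.

(** Applied to the identity for the arc itself and to [ratC] for its preimage. A holomorphic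
    parametrisation has a Lipschitz bound at each parameter, which is the regularity that
    [negligible_curve_preimage] asks of the curve. *)
Lemma negligible_arc_preimage (psi : C -> C) (G : set C) :
  (forall z, G z -> exists k : nat, forall z1 z2,
     cabs (z1 - z) < k.+1%:R^-1 -> cabs (z2 - z) < k.+1%:R^-1 ->
     cabs (z1 - z2) <= k.+1%:R * cabs (psi z1 - psi z2)) ->
  (leb \x leb)%E.-negligible
    [set w : P | G (toC w) /\ sigma (Some (psi (toC w)))].
Proof.
move=> Gpsi; have [V [phi [oV IV hol inj sE]]] := arc.
pose gam (t : R) := affine (phi (Some (ofreal t))).
(* Parameters sent to infinity are removed, since [affine] returns the default value 0 there. *)
pose I := [set t : R | `[0, 1]%classic t /\ phi (Some (ofreal t)) <> None].
apply: negligibleS (@negligible_curve_preimage R gam I psi G _ _ Gpsi).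
- move=> w [Gw]; rewrite sE => -[t It phit]; split=> //; exists t.
    by split=> //; rewrite phit.
  by rewrite /gam phit.
- by move=> t [].
- move=> t [It phit]; have [_] := hol _ (IV t It).
  have -> : local_rep phi (Some (ofreal t)) = (@affine R) \o phi \o Some.
    rewrite /local_rep; apply/funext => z /=.
    by case: (phi (Some (ofreal t))) phit.
  move=> /derivable_lipschitz[k hk]; exists k => t' [It' _] tt'.
  have tE : cabs (ofreal t' - ofreal t) = `|t' - t|.
    by rewrite -cabs_ofreal; congr cabs; apply: Cplx_eqP => /=; rewrite ?subr0.
  by have := hk (ofreal t'); rewrite tE; exact.
Qed.

Let gamma_cont (V : set (sphere R)) (phi : sphere R -> sphere R) (t : R) :
  V (Some (ofreal t)) -> holomorphic_on V phi ->
  (fun t => phi (Some (ofreal t))) @ t --> phi (Some (ofreal t)).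
Proof.
move=> Vt hol; have [cphi _] := hol _ Vt.
have c1 : (fun t : R => ofreal t) @ t --> ofreal t.
  apply/cvg_cabsP => e e0; apply/nbhs_ballP; exists e => //= t'.
  rewrite /ball/= distrC -(cabs_ofreal (t' - t)).
  by congr (_ < _); congr cabs; apply: Cplx_eqP => /=; rewrite ?subr0.
have c2 : (fun t : R => Some (ofreal t) : sphere R) @ t --> (Some (ofreal t) : sphere R).
  by move=> A /= /c1.
by move=> A /cphi /c2.
Qed.

(** Near each parameter the curve avoids some fixed ball around [v]; by compactness of [[0, 1]] one
    radius serves the whole arc. *)
Lemma c_open_arcC : c_open [set v | ~ sigma (Some v)].
Proof.
move=> v /= vs; have [V [phi [oV IV hol inj sE]]] := arc.
pose Pn (n : nat) (t : R) := forall v', cabs (v' - v) < n.+1%:R^-1 ->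
  phi (Some (ofreal t)) <> Some v'.
have small e : 0 < e -> \forall n \near \oo, n.+1%:R^-1 < e :> R.
  move=> e0; exists (Num.truncn e^-1) => // n /= en.
  rewrite -[ltRHS]invrK ltf_pV2 ?posrE ?invr_gt0// (lt_le_trans (truncnS_gt _))//.
  by rewrite ler_nat.
have [N _ /(_ N (leqnn N)) HN] : \forall n \near \oo, `[0, 1]%classic `<=` Pn n.
  apply: ((compact_near_coveringP _).1 (@segment_compact R 0 1)) => t It.
  have ct := gamma_cont (IV t It) hol.
  have ph : phi (Some (ofreal t)) <> Some v.
    by move=> ph; apply: vs; rewrite sE; exists t.
  move: ct ph; case: (phi (Some (ofreal t))) => [u|] ct ph.
    have r0 : 0 < cabs (u - v) / 2.
      rewrite divr_gt0// cabs_gt0// subr_eq0.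
      by apply/eqP => uv; apply: ph; rewrite uv.
    have nu : nbhs (Some u : sphere R) (Some @` [set u' | cabs (u' - u) < cabs (u - v) / 2]).
      apply: one_point_compactification_some_nbhs; apply/nbhs_cabsP.
      by exists (cabs (u - v) / 2).
    have nt := ct _ nu.
    exists ([set t' | (Some @` [set u' | cabs (u' - u) < cabs (u - v) / 2]) (phi (Some (ofreal t')))],
      [set n | n.+1%:R^-1 < cabs (u - v) / 2]) => /=; first by split=> //; exact: small.
    move=> [t' n] [/= [u' uu' pu'] nr] v' vv'; rewrite -pu' => -[u'v'].
    have : cabs (u - v) < cabs (u - v).
      have -> : u - v = - (u' - u) + (v' - v) by rewrite u'v'; ring.
      rewrite (le_lt_trans (cabsD _ _))// cabsN.
      have -> : - (u' - u) + (v' - v) = u - v by rewrite u'v'; ring.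
      by rewrite [ltRHS]splitr ltrD// (lt_trans vv').
    by rewrite ltxx.
  (* When the curve passes through infinity, nearby parameters are sent outside this compact square,
     which contains the unit ball around [v]. *)
  pose sq := (fun w : R * R => Complex w.1 w.2 : C) @`
    (`[reC v - 1, reC v + 1]%classic `*` `[imC v - 1, imC v + 1]%classic).
  have csq : compact sq.
    apply: continuous_compact; last first.
      by apply: compact_setX; exact: segment_compact.
    apply: continuous_subspaceT => w; apply/cvg_cabsP => e e0.
    have e2 : 0 < e / 2 by rewrite divr_gt0.
    exists (ball w.1 (e / 2), ball w.2 (e / 2)) => /=.
      by split; exact: nbhsx_ballx.
    move=> [x y] [/=]; rewrite /ball/= !(distrC w.1) !(distrC w.2) => h1 h2.
    rewrite (le_lt_trans (cabs_le_reC_imC _))// reCD imCD reCN imCN /=.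
    by rewrite [ltRHS]splitr ltrD.
  have clsq : closed sq by apply: compact_closed => //; exact: norm_hausdorff.
  have nN : nbhs (None : sphere R) (Some @` (~` sq) `|` [set None]) by exists sq.
  have nt := ct _ nN.
  exists ([set t' | (Some @` (~` sq) `|` [set None]) (phi (Some (ofreal t')))],
      [set n | (n.+1%:R^-1 : R) < 1]) => /=; first by split=> //; exact: small.
  move=> [t' n] [/= pt n1] v' vv' pv'; move: pt; rewrite pv' => -[|//] [z /[swap] -[->]].
  apply; exists (reC v', imC v'); last by case: v' {vv' pv'}.
  have := lt_trans vv' n1 => v1; split; rewrite /= in_itv/= -ler_distl.
    by rewrite -reCN -reCD (le_trans (ler_reC_cabs _))// ltW.
  by rewrite -imCN -imCD (le_trans (ler_imC_cabs _))// ltW.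
exists N.+1%:R^-1; first by rewrite invr_gt0.
move=> v' vv' /=; rewrite sE => -[t It pt].
by apply: (HN t It v' vv').
Qed.

End AnalyticArc.

(** * Inverse branches as planar conformal bijections *)

Section Sheets.
Context {R : realType} (Q : ratmap R) (sigma : set (sphere R)).
Variable D : 'I_(ratdeg Q) -> set (sphere R).
Local Notation C := (Cplx R).
Local Notation d := (rden Q).

(* The sheets without the poles, the point at infinity and its fibre, so that
   everything takes place in the affine chart. *)
Definition base : set (sphere R) := [set y | [/\ y <> None, ~ sigma y & y <> Q None]].
Definition sheet (i : 'I_(ratdeg Q)) : set (sphere R) := D i `&` Q @^-1` base.
Definition branch (i : 'I_(ratdeg Q)) : sphere R -> sphere R := pinv (D i) Q.

Hypotheses (deg : (0 < ratdeg Q)%N) (arc : analytic_arc sigma).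
Hypotheses (crit : critical_values Q `<=` sigma) (sh : sheets D sigma).

Lemma sheetsE z i : D i z -> ~ sigma (Q z).
Proof.
move=> Diz; have [DE _ _] := sh.
by have : (\bigcup_i D i) z by [exists i]; rewrite -DE.
Qed.

Lemma branchK i y : ~ sigma y -> D i (branch i y) /\ Q (branch i y) = y.
Proof.
move=> ys; have [_ _ /(_ i)[_ _ [bij _ _]]] := sh.
have [_ _ surj] := bij; split.
  by have [h _ _] := @bijpinv_bij _ _ (fun=> point) _ _ _ bij; exact: (h y ys).
by have := @surjpK _ _ (fun=> point) _ _ _ surj y (mem_set ys); rewrite -/(branch i y).
Qed.

Lemma sheet_inj i x y : D i x -> D i y -> Q x = Q y -> x = y.
Proof.
move=> Dx Dy; have [_ _ /(_ i)[_ _ [[_ inj _] _ _]]] := sh.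
by apply: inj; rewrite inE.
Qed.

Lemma branch_Q i x : D i x -> branch i (Q x) = x.
Proof.
move=> Dx; have [Db Qb] := branchK i (sheetsE Dx).
exact: (sheet_inj Db Dx Qb).
Qed.

Lemma sheet_branch i y : base y -> sheet i (branch i y) /\ Q (branch i y) = y.
Proof.
move=> Uy; have [_ ys _] := Uy; have [Db Qb] := branchK i ys.
by split=> //; split=> //; rewrite /= Qb.
Qed.

Lemma sheet_cover x : base (Q x) -> exists i, sheet i x.
Proof.
move=> Ux; have [_ ys _] := Ux; have [DE _ _] := sh.
have : (Q @^-1` (~` sigma)) x by [].
by rewrite DE => -[i _ Dx]; exists i.
Qed.

Lemma sheet_disjoint i j x : D i x -> D j x -> i = j.
Proof.
by move=> Di Dj; have [_ tD _] := sh; apply: (tD i j Logic.I Logic.I); exists x.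
Qed.

Lemma sheet_None i : ~ sheet i None.
Proof. by move=> [_ [_ _]]; exact. Qed.

Lemma base_den z : base (Q (Some z)) -> d.[z] != 0.
Proof. by move=> [Qz _ _]; apply/eqP => dz; apply: Qz; exact: rat_pole. Qed.

Lemma c_open_base : c_open [set v | base (Some v)].
Proof.
have [QN|[u QN]] : Q None = None \/ exists u, Q None = Some u.
  by case: (Q None) => [u|]; [right; exists u|left].
- move=> v [_ /(c_open_arcC arc)[e e0 he] _]; exists e => // v' /he vs.
  by split=> //; rewrite QN.
- move=> v [_ /(c_open_arcC arc)[e e0 he] vN].
  have uv : v - u != 0 by rewrite subr_eq0; apply/eqP => vu; apply: vN; rewrite QN vu.
  exists (Num.min e (cabs (v - u))); first by rewrite lt_min e0 cabs_gt0.
  move=> v'; rewrite lt_min => /andP[/he v's v'u]; split=> //.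
  rewrite QN => -[v'E]; move: v'u.
  by rewrite v'E -(cabsN (u - v)) opprB ltxx.
Qed.

Lemma ratC_cont z : d.[z] != 0 -> forall e : R, 0 < e -> exists2 k : R, 0 < k &
  forall z', cabs (z' - z) < k -> cabs (ratC Q z' - ratC Q z) < e.
Proof.
move=> dz e e0; have [k k0 hk] := ratC_strict dz ltr01.
pose M := 1 + cabs (derive1 (ratC Q) z).
have M0 : 0 < M by rewrite ltr_pwDl// cabs_ge0.
exists (Num.min k (e / M)); first by rewrite lt_min k0 divr_gt0.
move=> z'; rewrite lt_min => /andP[z'k z'e].
have := hk z' z z'k; rewrite subrr cabs0 => /(_ k0) h1.
rewrite -[ratC Q z' - ratC Q z](subrK (derive1 (ratC Q) z * (z' - z))).
rewrite (le_lt_trans (cabsD _ _))// (@le_lt_trans _ _ (M * cabs (z' - z)))//.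
  by rewrite cabsM mulrDl lerD.
by rewrite mulrC -ltr_pdivlMr.
Qed.

Lemma c_open_den : c_open [set z | d.[z] != 0].
Proof. by move=> z /= /near_den /nbhs_cabsP. Qed.

Lemma c_open_sheet i : c_open [set z | sheet i (Some z)].
Proof.
move=> z [Dz Uz]; have dz := base_den Uz.
have [_ _ /(_ i)[oD _ _]] := sh.
have /nbhs_cabsP[k1 k10 h1] : nbhs z ((Some : C -> sphere R) @^-1` D i).
  by apply: (@one_point_compactification_some_continuous C z); apply: open_nbhs_nbhs; split.
have [k2 k20 h2] := c_open_den dz.
have Uz' : base (Some (ratC Q z)) by rewrite -rat_finite.
have [e e0 he] := c_open_base Uz'.
have [k3 k30 h3] := ratC_cont dz e0.
exists (Num.min k1 (Num.min k2 k3)); first by rewrite !lt_min k10 k20.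
move=> z'; rewrite !lt_min => /and3P[a1 a2 a3]; split; first exact: h1.
by rewrite /= rat_finite; [apply: he; exact: h3|exact: h2].
Qed.

Definition branchC i (v : C) : C := affine (branch i (Some v)).

Lemma branchCE i v : base (Some v) -> branch i (Some v) = Some (branchC i v).
Proof.
move=> /(sheet_branch i)[]; rewrite /branchC; case: (branch i (Some v)) => //.
by move=> /sheet_None.
Qed.

(** Continuity of the inverse comes from [holomorphic_homeo], strict differentiability from the
    divided differences, and the derivative vanishes nowhere because critical values lie in [sigma],
    which [base] avoids. *)
Lemma conformal_sheet i : conformal_pair [set z | sheet i (Some z)]
  [set v | base (Some v)] (ratC Q) (derive1 (ratC Q)) (branchC i).
Proof.
split.
- exact: c_open_sheet.
- exact: c_open_base.
- move=> z [Dz Uz]; have dz := base_den Uz; rewrite /= -rat_finite//.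
  by rewrite /branchC -rat_finite// branch_Q.
- move=> v Uv; have [sv Qv] := sheet_branch i Uv.
  rewrite /= -branchCE//; split=> //.
  have dv : d.[branchC i v] != 0 by apply: base_den; rewrite -branchCE// Qv.
  by have := Qv; rewrite branchCE// rat_finite// => -[].
- move=> v Uv e e0.
  have [_ _ /(_ i)[_ _ [_ _ cont]]] := sh.
  have vs : (~` sigma) (Some v) by have [_] := Uv.
  have cv := (subspace_continuousP _ _).1 cont _ vs.
  have nv : nbhs (branch i (Some v))
      (Some @` [set z | cabs (z - branchC i v) < e] : set (sphere R)).
    rewrite branchCE//; apply: one_point_compactification_some_nbhs.
    by apply/nbhs_cabsP; exists e.
  have /nbhs_cabsP[k k0 hk] : nbhs v ((Some : C -> sphere R) @^-1`
      [set y | (~` sigma) y -> (Some @` [set z | cabs (z - branchC i v) < e]) (branch i y)]).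
    exact: (@one_point_compactification_some_continuous C v _ (cv _ nv)).
  exists k => // v' Uv' vv'; have v's : (~` sigma) (Some v') by have [_] := Uv'.
  have [z ze zE] := hk v' vv' v's.
  by move: zE; rewrite -/(branch i _) branchCE// => -[<-].
- by move=> z [_ /base_den dz]; exact: ratC_strict.
- by move=> z [_ /base_den dz]; exact: ratC_deriv_cont.
- move=> z [Dz Uz]; have dz := base_den Uz; apply/eqP => d0.
  have rE : local_rep Q (Some z) = ratC Q.
    rewrite /local_rep (rat_finite dz); apply/funext => z'.
    exact: affine_rat.
  have cz : critical_point Q (Some z) by rewrite /critical_point rE.
  by have [_ ns _] := Uz; case: (ns (crit (ex_intro2 _ _ _ cz erefl))).
Qed.

End Sheets.

(** * Transfer operators *)

Section BranchedMap.
Context d (T : measurableType d) (R : realType) (mu : {measure set T -> \bar R}).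
Variable n : nat.
Variables (Q : T -> T) (J : T -> Cplx R) (base : set T).
Variables (sheet : 'I_n -> set T) (br : 'I_n -> T -> T).

(* Almost everywhere, [Q] is an [n]-to-one map whose restrictions to the sheets
   are invertible with Jacobian [|J| ^ 2]. *)
Record branched : Prop := {
  br_mbase : measurable base;
  br_msheet : forall i, measurable (sheet i);
  br_base0 : mu.-negligible (~` base);
  br_sheet0 : mu.-negligible (~` \bigcup_i sheet i);
  br_disj : forall i j x, sheet i x -> sheet j x -> i = j;
  br_map : forall i x, sheet i x -> base (Q x) /\ br i (Q x) = x;
  br_inv : forall i y, base y -> sheet i (br i y) /\ Q (br i y) = y;
  br_mQ : forall i, measurable_fun (sheet i) Q;
  br_mbr : forall i, measurable_fun base (br i);
  br_mJ : forall i, measurable_fun (sheet i) (reC \o J) /\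
                    measurable_fun (sheet i) (imC \o J);
  br_J0 : forall i x, sheet i x -> J x != 0;
  br_cov : forall i B, measurable B ->
    mu (B `&` base) = (\int[mu]_(z in sheet i `&` Q @^-1` B) (cabs (J z) ^+ 2)%:E)%E }.

Hypothesis bP : branched.

Let jac x : R := cabs (J x) ^+ 2.

Lemma jac_gt0 i x : sheet i x -> 0 < jac x.
Proof. by move=> sx; rewrite exprn_gt0// cabs_gt0// (br_J0 bP sx). Qed.

Lemma measurable_jac i : measurable_fun (sheet i) jac.
Proof.
have [mr mi] := br_mJ bP i.
rewrite (_ : jac = fun x => (reC \o J) x ^+ 2 + (imC \o J) x ^+ 2).
  by apply: measurable_funD; exact: measurable_funX.
by apply/funext => x; rewrite /jac cabs_sqr.
Qed.

Lemma measurable_br_comp d' (T' : measurableType d') i (F : T -> T') :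
  measurable_fun (sheet i) F -> measurable_fun base (F \o br i).
Proof.
move=> mF; apply: (measurable_comp (br_msheet bP i)) => //; last exact: (br_mbr bP).
by move=> _ [y by_ <-]; have [] := br_inv bP i by_.
Qed.

Lemma measurable_Q_comp d' (T' : measurableType d') i (F : T -> T') :
  measurable_fun base F -> measurable_fun (sheet i) (F \o Q).
Proof.
move=> mF; apply: (measurable_comp (br_mbase bP)) => //; last exact: (br_mQ bP).
by move=> _ [y sy <-]; have [] := br_map bP sy.
Qed.

(** The change of variables is applied to [F (br i y) / jac (br i y)] on [base]: pulled back by [Q],
    its denominator cancels the Jacobian. *)
Lemma ge0_integral_sheet i (F : T -> \bar R) : measurable_fun (sheet i) F ->
  (forall x, 0 <= F x)%E ->
  (\int[mu]_(x in sheet i) F x =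
   \int[mu]_(y in base) (F (br i y) * ((jac (br i y))^-1)%:E))%E.
Proof.
move=> mF F0; pose G y := (F (br i y) * ((jac (br i y))^-1)%:E)%E.
have mG : measurable_fun base G.
  apply: emeasurable_funM; first exact: measurable_br_comp.
  apply/measurable_EFinP; apply: (measurableT_comp (@measurable_invr R)).
  exact/measurable_br_comp/measurable_jac.
have mbase := br_mbase bP; have msheet := br_msheet bP i.
have G0 y : (0 <= (G \_ base) y)%E.
  rewrite patchE; case: ifP => // _; rewrite mule_ge0// lee_fin invr_ge0.
  by rewrite exprn_ge0 ?cabs_ge0.
transitivity (\int[mu]_(y in base) (G \_ base) y)%E; last first.
  by apply: eq_integral => y by_; rewrite patchE by_.
rewrite (@ge0_change_of_variables _ _ _ _ (sheet i) base Q jac)//.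
- apply: eq_integral => x /set_mem sx; have [bx brx] := br_map bP sx.
  rewrite patchE mem_set// /G brx -muleA -EFinM mulVf ?mule1//.
  by rewrite gt_eqF// (jac_gt0 sx).
- exact: (br_mQ bP).
- exact: measurable_jac.
- by move=> x; rewrite exprn_ge0 ?cabs_ge0.
- exact: (br_cov bP).
- by apply/(measurable_restrictT _ mbase).
Qed.

Lemma integral_sheet i (F : T -> R) : measurable_fun (sheet i) F ->
  (\int[mu]_(x in sheet i) (F x)%:E =
   \int[mu]_(y in base) (F (br i y) / jac (br i y))%:E)%E.
Proof.
move=> mF; have mF' : measurable_fun (sheet i) (EFin \o F) by apply/measurable_EFinP.
have j0 y : 0 <= (jac (br i y))^-1 by rewrite invr_ge0 exprn_ge0 ?cabs_ge0.
rewrite integralE [RHS]integralE; congr (_ - _)%E.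
- rewrite ge0_integral_sheet//; last exact: measurable_funepos.
  apply: eq_integral => y _; rewrite !funeposE /= EFinM.
  by rewrite maxe_pMl ?mul0e ?lee_fin.
- rewrite ge0_integral_sheet//; last exact: measurable_funeneg.
  apply: eq_integral => y _; rewrite !funenegE /= -mulNr EFinM.
  by rewrite maxe_pMl ?mul0e ?lee_fin.
Qed.

Lemma ge0_integral_sheets (F : T -> \bar R) : measurable_fun setT F ->
  (forall x, 0 <= F x)%E ->
  (\int[mu]_x F x = \sum_(i < n) \int[mu]_(x in sheet i) F x)%E.
Proof.
move=> mF F0; have sE : \bigcup_i sheet i = \big[setU/set0]_(i <- enum 'I_n) sheet i.
  rewrite -bigcup_seq; apply/seteqP; split=> x [i _ sx]; exists i => //=.
  exact: mem_enum.
have mS : measurable (\bigcup_i sheet i).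
  by rewrite sE; apply: bigsetU_measurable => i _; exact: (br_msheet bP).
rewrite (@ge0_negligible_integral _ _ _ mu setT (~` \bigcup_i sheet i))//.
- rewrite setDE setTI setCK sE ge0_integral_bigsetU ?big_enum//.
  + exact: (br_msheet bP).
  + exact: enum_uniq.
  + by move=> i j _ _ [x [xi xj]]; exact: (br_disj bP xi xj).
  + exact: measurable_funTS.
- exact: measurableC.
- by apply/(negligibleP mu (measurableC mS))/(br_sheet0 bP).
Qed.

(** The Jacobian is positive on the sheet, and its integral over the preimage of [B] is the measure
    of [B] inside [base], which is 0. *)
Lemma sheet_null i B : measurable B -> mu B = 0%E ->
  mu (sheet i `&` Q @^-1` B) = 0%E.
Proof.
move=> mB B0; have ms := br_msheet bP i.
have mQB : measurable (sheet i `&` Q @^-1` B) by exact: (br_mQ bP).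
have jE : (\int[mu]_(z in sheet i `&` Q @^-1` B) `|(jac z)%:E| = 0)%E.
  under eq_integral => z _ do rewrite gee0_abs ?lee_fin ?exprn_ge0 ?cabs_ge0//.
  rewrite -(br_cov bP i mB); apply: (subset_measure0 _ _ _ B0) => //.
  by apply: measurableI => //; exact: (br_mbase bP).
have [|N [mN N0 hN]] := (ae_eq_integral_abs mu mQB _).1 jE.
  apply/measurable_EFinP. exact: (measurable_funS ms (@subIsetl _ _ _) (@measurable_jac i)).
apply: (subset_measure0 _ _ _ N0) => // x sx; apply: hN => /= /(_ sx) [] /eqP.
by rewrite gt_eqF// (jac_gt0 sx.1).
Qed.

Lemma branched_nonsingular : nonsingular mu Q.
Proof.
move=> N [B [mB B0 NB]].
apply: (@negligibleS _ _ _ _ ((~` \bigcup_i sheet i) `|`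
    \big[setU/set0]_(i < n) (sheet i `&` Q @^-1` B))).
  move=> x Nx; have [[i _ sx]|nx] := pselect ((\bigcup_i sheet i) x); last by left.
  right; rewrite -bigcup_seq; exists i => /=; first by rewrite mem_index_enum.
  by split=> //; exact: NB.
apply: negligibleU; first exact: (br_sheet0 bP).
apply: (big_ind (fun A => mu.-negligible A)) => [||i _].
  exact: negligible_set0.
  by move=> *; exact: negligibleU.
have mQB : measurable (sheet i `&` Q @^-1` B) by apply: (br_mQ bP) => //; exact: (br_msheet bP).
by apply/negligibleP => //; exact: sheet_null.
Qed.

(** By the change of variables, the measure of the points of [base] sent by [br i] into a null set
    [B] is an integral over a subset of [B]. *)
Lemma branch_negligible i N : mu.-negligible N ->
  mu.-negligible (base `&` br i @^-1` N).
Proof.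
move=> [B [mB B0 NB]]; pose B' := base `&` br i @^-1` B.
have mB' : measurable B' by apply: (br_mbr bP) => //; exact: (br_mbase bP).
exists B'; split=> // [|y [by_ Ny]]; last by split=> //; exact: NB.
have -> : B' = B' `&` base by rewrite /B' setIAC setIid.
rewrite (br_cov bP i mB'); have ms := br_msheet bP i.
have mQB : measurable (sheet i `&` Q @^-1` B') by exact: (br_mQ bP).
apply: null_set_integral => //.
  apply/measurable_EFinP.
  exact: (measurable_funS ms (@subIsetl _ _ _) (@measurable_jac i)).
apply: (subset_measure0 _ _ _ B0) => // x [sx [_]].
by have [_ /= ->] := br_map bP sx.
Qed.

(** * Maps that permute the sheets *)

Section Permuting.
Variables (g : T -> T) (p : 'I_n -> 'I_n).
Hypotheses (p_inj : injective p).
Hypothesis gP : forall i x, sheet i x -> sheet (p i) (g x) /\ Q (g x) = Q x.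

Let g_br i x : sheet i x -> g x = br (p i) (Q x).
Proof.
move=> sx; have [sgx Qg] := gP sx; rewrite -Qg.
by have [] := br_map bP sgx.
Qed.

Lemma measurable_permuting d' (T' : measurableType d') i (F : T -> T') :
  measurable_fun (sheet (p i)) F -> measurable_fun (sheet i) (F \o g).
Proof.
move=> mF; have := @measurable_Q_comp _ _ i _ (measurable_br_comp mF).
by apply: eq_measurable_fun => x /set_mem sx; rewrite /= (g_br sx).
Qed.

Lemma permuting_nonsingular : nonsingular mu g.
Proof.
move=> N N0; have QN i := branched_nonsingular (branch_negligible i N0).
apply: (@negligibleS _ _ _ _ ((~` \bigcup_i sheet i) `|`
    \big[setU/set0]_(i < n) (Q @^-1` (base `&` br i @^-1` N)))).
  move=> x Nx; have [[i _ sx]|nx] := pselect ((\bigcup_i sheet i) x); last by left.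
  right; rewrite -bigcup_seq; exists (p i) => /=; first by rewrite mem_index_enum.
  have [bx _] := br_map bP sx; split=> //=.
  by rewrite -(g_br sx).
apply: negligibleU; first exact: (br_sheet0 bP).
apply: (big_ind (fun A => mu.-negligible A)) => [||i _]; last exact: QN.
  exact: negligible_set0.
by move=> *; exact: negligibleU.
Qed.

(** On sheet [i] the map [g] is [br (p i) \o Q]. Transported to [base], the integral of [K] over
    sheet [i] and that of [H] over sheet [p i] have the same integrand, and [p] only reorders the
    sheets. *)
Lemma permuting_isometry (H K : T -> \bar R) :
  measurable_fun setT H -> measurable_fun setT K ->
  (forall x, 0 <= H x)%E -> (forall x, 0 <= K x)%E ->
  (forall i, {ae mu, forall x, sheet i x -> K x = H (g x) * (jac x / jac (g x))%:E})%E ->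
  (\int[mu]_x K x = \int[mu]_x H x)%E.
Proof.
move=> mH mK H0 K0 KE; rewrite !ge0_integral_sheets//.
rewrite [RHS](reindex_inj p_inj) /=; apply: eq_bigr => i _.
have c0 x : (0 <= (jac x / jac (g x))%:E)%E.
  by rewrite lee_fin divr_ge0 ?exprn_ge0 ?cabs_ge0.
have mj : measurable_fun (sheet i) (jac \o g).
  exact/measurable_permuting/measurable_jac.
have mHg : measurable_fun (sheet i) (fun x => H (g x) * (jac x / jac (g x))%:E)%E.
  apply: emeasurable_funM.
    by apply: (@measurable_permuting _ _ i H); exact: measurable_funTS.
  apply/measurable_EFinP; apply: measurable_funM; first exact: measurable_jac.
  exact: (measurableT_comp (@measurable_invr R)).
transitivity (\int[mu]_(x in sheet i) (H (g x) * (jac x / jac (g x))%:E))%E.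
  apply: ge0_ae_eq_integral => //.
  - exact: (br_msheet bP).
  - exact: measurable_funTS.
  - by move=> x _; rewrite mule_ge0.
  - exact: KE.
rewrite ge0_integral_sheet//; last by move=> x; rewrite mule_ge0.
rewrite ge0_integral_sheet//; last exact: measurable_funTS.
apply: eq_integral => y /set_mem by_.
have [sy Qy] := br_inv bP i by_; rewrite (g_br sy) Qy -muleA -EFinM.
by congr (_ * _%:E)%E; rewrite mulrAC mulfV ?mul1r// gt_eqF// (jac_gt0 sy).
Qed.

End Permuting.

End BranchedMap.

Section ComplexMeasurability.
Context d (T : measurableType d) (R : realType).
Implicit Types (z w : Cplx R) (D : set T) (f g : T -> Cplx R).

Lemma reC_conj z : reC z^* = reC z. Proof. by case: z. Qed.

Lemma imC_conj z : imC z^* = - imC z. Proof. by case: z. Qed.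

Lemma mulC_conj z : z * z^* = ofreal (cabs z ^+ 2).
Proof. by rewrite -normCK cabsE expr2 -ofrealM. Qed.

Lemma cabs_conj z : cabs z^* = cabs z.
Proof. by rewrite !cabs_sqrt reC_conj imC_conj sqrrN. Qed.

Definition measurable_cplx_on D f :=
  measurable_fun D (reC \o f) /\ measurable_fun D (imC \o f).

Lemma measurable_cplxM D f g : measurable_cplx_on D f -> measurable_cplx_on D g ->
  measurable_cplx_on D (fun x => f x * g x).
Proof.
move=> [fr fi] [gr gi]; split.
  rewrite (_ : _ \o _ = fun x => (reC \o f) x * (reC \o g) x - (imC \o f) x * (imC \o g) x).
    by apply: measurable_funB; exact: measurable_funM.
  by apply/funext => x /=; rewrite reCM.
rewrite (_ : _ \o _ = fun x => (reC \o f) x * (imC \o g) x + (imC \o f) x * (reC \o g) x).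
  by apply: measurable_funD; exact: measurable_funM.
by apply/funext => x /=; rewrite imCM.
Qed.

Lemma measurable_cplxB D f g : measurable_cplx_on D f -> measurable_cplx_on D g ->
  measurable_cplx_on D (fun x => f x - g x).
Proof.
move=> [fr fi] [gr gi]; split.
  rewrite (_ : _ \o _ = fun x => (reC \o f) x - (reC \o g) x).
    exact: measurable_funB.
  by apply/funext => x /=; rewrite reCD reCN.
rewrite (_ : _ \o _ = fun x => (imC \o f) x - (imC \o g) x).
  exact: measurable_funB.
by apply/funext => x /=; rewrite imCD imCN.
Qed.

Lemma measurable_cplx_conj D f : measurable_cplx_on D f ->
  measurable_cplx_on D (fun x => (f x)^*).
Proof.
move=> [fr fi]; split.
  by rewrite (_ : _ \o _ = reC \o f)//; apply/funext => x /=; rewrite reC_conj.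
rewrite (_ : _ \o _ = fun x => - (imC \o f) x); first exact: measurable_funN.
by apply/funext => x /=; rewrite imC_conj.
Qed.

Lemma measurable_cplx_ofreal D (u : T -> R) : measurable_fun D u ->
  measurable_cplx_on D (fun x => ofreal (u x)).
Proof. by move=> mu_; split=> //; exact: measurable_cst. Qed.

(** Origin of the Beltrami factor: the Jacobian [|J|^2] times the weight [J^-2] of the transfer
    operator is [conj J / J]. *)
Lemma divC_conj z w : w != 0 ->
  ofreal (cabs w ^+ 2) * (z / w ^+ 2) = z * (w^* / w).
Proof.
by move=> w0; rewrite -mulC_conj; field.
Qed.

(** Rewrites the factor with conjugation, products and the inverse of a real number, each of which
    preserves measurability. *)
Lemma conj_div w : w != 0 -> w^* / w = (w^*) ^+ 2 * ofreal ((cabs w ^+ 2)^-1).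
Proof.
move=> w0; have n0 : cabs w ^+ 2 != 0 by rewrite expf_neq0// gt_eqF// cabs_gt0.
have o0 : ofreal (cabs w ^+ 2) != 0.
  by rewrite (inj_eq (@ofreal_inj R) _ 0).
apply: (mulfI o0); rewrite [RHS]mulrCA -ofrealM mulfV// (_ : ofreal 1 = 1 :> Cplx R)// mulr1.
by rewrite -mulC_conj; field.
Qed.

End ComplexMeasurability.

(** * Contraction property and invariant densities of the transfer operator *)

Section Transfer.
Context d (T : measurableType d) (R : realType) (mu : {measure set T -> \bar R}).
Variables (n : nat) (Q : T -> T) (J : T -> Cplx R) (base : set T).
Variables (sheet : 'I_n -> set T) (br : 'I_n -> T -> T).
Hypothesis bP : branched mu Q J base sheet br.
Local Notation jac := (fun x => cabs (J x) ^+ 2).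

Lemma integral_base (F : T -> \bar R) (G : T -> \bar R) :
  measurable_fun setT F -> measurable_fun base G ->
  {ae mu, forall y, base y -> F y = G y} ->
  (\int[mu]_y F y = \int[mu]_(y in base) G y)%E.
Proof.
move=> mF mG FG; rewrite [RHS]integral_mkcond; apply: ae_eq_integral => //.
  exact/(measurable_restrictT _ (br_mbase bP)).
have b0 : {ae mu, forall y, base y}.
  exact: negligibleS (br_base0 bP).
by apply: filterS2 FG b0 => y h by_ _; rewrite patchE mem_set// h.
Qed.

(** The triangle inequality in each fibre leaves a sum of the [|f (br i y)| / jac (br i y)]; the
    change of variables turns its integral over [base] into the integral of [|f|] over all
    sheets. *)
Lemma transfer_contraction (f h : T -> Cplx R) :
  measurable_cplx f -> measurable_cplx h ->
  {ae mu, forall y, base y -> h y = \sum_(i < n) f (br i y) / J (br i y) ^+ 2} ->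
  (\int[mu]_y (cabs (h y))%:E <= \int[mu]_x (cabs (f x))%:E)%E.
Proof.
move=> mf mh hE; have mcf := measurable_cabs mf; have mch := measurable_cabs mh.
have mfs i : measurable_fun (sheet i) (fun x => (cabs (f x))%:E) by exact: measurable_funTS.
have mbr i : measurable_fun base
    (fun y => (cabs (f (br i y)))%:E * ((jac (br i y))^-1)%:E)%E.
  apply: emeasurable_funM; first exact: (measurable_br_comp bP (mfs i)).
  apply/measurable_EFinP; apply: (measurableT_comp (@measurable_invr R)).
  exact: (measurable_br_comp bP (@measurable_jac _ _ _ _ _ _ _ _ _ _ bP i)).
have F0 y i : (0 <= (cabs (f (br i y)))%:E * ((jac (br i y))^-1)%:E)%E.
  by rewrite mule_ge0 ?lee_fin ?invr_ge0 ?exprn_ge0 ?cabs_ge0.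
rewrite [leRHS](ge0_integral_sheets bP)//; last by move=> x; rewrite lee_fin cabs_ge0.
have -> : (\sum_(i < n) \int[mu]_(x in sheet i) (cabs (f x))%:E =
    \int[mu]_(y in base) \sum_(i < n)
      ((cabs (f (br i y)))%:E * ((jac (br i y))^-1)%:E))%E.
  rewrite (ge0_integral_sum _ (br_mbase bP))//.
  apply: eq_bigr => i _; rewrite (ge0_integral_sheet bP)//.
  by move=> x; rewrite lee_fin cabs_ge0.
rewrite (@integral_base _ (fun y => (cabs (h y))%:E))//; last 2 first.
- exact: measurable_funTS.
- exact: aeW.
apply: ae_ge0_le_integral.
- exact: (br_mbase bP).
- by move=> y _; rewrite lee_fin cabs_ge0.
- exact: measurable_funTS.
- by move=> y _; apply: sume_ge0 => i _; exact: F0.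
- by apply: emeasurable_sum => i; exact: mbr.
apply: filterS hE => y hy by_; rewrite (hy by_).
under [X in (_ <= X)%E]eq_bigr => i _ do rewrite -EFinM.
rewrite sumEFin lee_fin (le_trans (cabs_sum _ _ _))// ler_sum// => i _.
have [si _] := br_inv bP i by_.
have J2 : cabs (J (br i y) ^+ 2)^-1 = (jac (br i y))^-1.
  have J0 := expf_neq0 2 (br_J0 bP si).
  apply: (mulIf (lt0r_neq0 (cabs_gt0 J0))).
  rewrite -cabsM mulVf// -cabsX mulVf ?gt_eqF ?cabs_gt0//.
  by rewrite -[1]/(ofreal 1) cabs_ofreal normr1.
by rewrite cabsM J2.
Qed.

End Transfer.

Section TransferInvariance.
Context d (T : measurableType d) (R : realType) (mu : {measure set T -> \bar R}).
Variables (n : nat) (Q : T -> T) (J : T -> Cplx R) (base : set T).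
Variables (sheet : 'I_n -> set T) (br : 'I_n -> T -> T).
Hypothesis bP : branched mu Q J base sheet br.
Local Notation jac := (fun x => cabs (J x) ^+ 2).
Local Notation integ f := (mu.-integrable [set: T] (EFin \o f)).
Variables (w : T -> R) (m : T -> Cplx R) (K : R) (A0 : set T).
Hypotheses (iw : integ w) (w0 : forall x, 0 < w x).
Hypotheses (mm : measurable_cplx m) (mK : forall x, cabs (m x) <= K).
Hypothesis mA0 : measurable A0.

(* Integrating [m] against functions supported on a single sheet suffices: for
   these the transfer operator has only one term. *)
Hypothesis inv : forall j (f : T -> Cplx R), measurable_cplx f ->
  (exists K', forall x, cabs (f x) <= K' * w x) ->
  (forall x, ~ (sheet j `&` A0) x -> f x = 0) ->
  exists h, [/\ measurable_cplx h,
    {ae mu, forall y, base y -> h y = f (br j y) / J (br j y) ^+ 2} &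
    \int[mu]_x reC (h x * m x) = \int[mu]_x reC (f x * m x)].

Let twist x := m (Q x) * ((J x)^* / J x).

Let cabs_twist j x : sheet j x -> cabs (twist x) <= K.
Proof.
move=> sx; have J0 := br_J0 bP sx; rewrite cabsM.
rewrite (_ : cabs (_ / _) = 1) ?mulr1//.
apply: (mulIf (lt0r_neq0 (cabs_gt0 J0))).
by rewrite -cabsM divfK// mul1r cabs_conj.
Qed.

Let measurable_twist j : measurable_cplx_on (sheet j) twist.
Proof.
have mmQ : measurable_cplx_on (sheet j) (m \o Q).
  have [mr mi] := mm; have mQ : measurable_fun (sheet j) Q by exact: (br_mQ bP).
  split.
    exact: (measurableT_comp mr mQ).
  exact: (measurableT_comp mi mQ).
have mJ : measurable_cplx_on (sheet j) (fun x => (J x)^* ^+ 2 * ofreal ((jac x)^-1)).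
  apply: measurable_cplxM; last first.
    apply: measurable_cplx_ofreal; apply: (measurableT_comp (@measurable_invr R)).
    exact: (@measurable_jac _ _ _ _ _ _ _ _ _ _ bP j).
  have mc := measurable_cplx_conj (br_mJ bP j).
  by have := measurable_cplxM mc mc; rewrite (_ : (fun x => _) = fun x => (J x)^* ^+ 2).
have [h1 h2] := measurable_cplxM mmQ mJ.
by split; [move: h1|move: h2]; apply: eq_measurable_fun => x /set_mem sx;
  rewrite /= /twist conj_div// (br_J0 bP sx).
Qed.

(** The test function is [f = conj(nu) * w] on the part of the sheet in [A0], where
    [nu = twist - m]. Invariance makes the integrals of [Re(f * twist)] and [Re(f * m)] equal, and
    their difference is the integral of [|nu|^2 * w]; so [nu] vanishes there. *)
Let twist_sheet j : {ae mu, forall x, sheet j x -> A0 x -> twist x = m x}.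
Proof.
pose S := sheet j `&` A0; pose nu x := twist x - m x.
have ms := br_msheet bP j.
have mS : measurable S by exact: measurableI.
have S0 x : ~ S x -> x \in S = false by move=> Sx; rewrite memNset.
have mcm (D : set T) : measurable_cplx_on D m by have [? ?] := mm; split; exact: measurable_funTS.
have mw : measurable_fun setT w by exact: integ_measurable iw.
have mnu : measurable_cplx_on (sheet j) nu by exact: measurable_cplxB.
pose g x := (nu x)^* * ofreal (w x).
have mg : measurable_cplx_on (sheet j) g.
  apply: measurable_cplxM; first exact: measurable_cplx_conj.
  by apply: measurable_cplx_ofreal; exact: measurable_funTS.
pose f x := if x \in S then g x else 0.
have mf : measurable_cplx f.
  have [gr gi] := mg; split.
    rewrite (_ : reC \o f = (reC \o g) \_ S).
      apply/(measurable_restrictT _ mS); exact: (measurable_funS ms (@subIsetl _ _ _) gr).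
    by apply/funext => x; rewrite patchE /= /f; case: ifP.
  rewrite (_ : imC \o f = (imC \o g) \_ S).
    apply/(measurable_restrictT _ mS); exact: (measurable_funS ms (@subIsetl _ _ _) gi).
  by apply/funext => x; rewrite patchE /= /f; case: ifP.
have f0 x : ~ S x -> f x = 0 by move=> Sx; rewrite /f S0.
have K0 (x : T) : 0 <= K by exact: le_trans (cabs_ge0 _) (mK x).
have fK x : cabs (f x) <= (K + K) * w x.
  rewrite /f; case: ifPn => [/set_mem[sx _]|_]; last first.
    by rewrite cabs0 mulr_ge0 ?addr_ge0 ?(K0 x) ?(ltW (w0 x)).
  rewrite cabsM cabs_conj cabs_ofreal ger0_norm ?(ltW (w0 x))// ler_wpM2r ?(ltW (w0 x))//.
  by rewrite (le_trans (cabsD _ _))// cabsN lerD ?(cabs_twist sx).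
have [h [mh hE hI]] := inv mf (ex_intro _ _ fK) f0.
pose F x := reC (f x * twist x); pose G x := reC (f x * m x).
have mfs : measurable_cplx_on (sheet j) f.
  by have [? ?] := mf; split; exact: measurable_funTS.
have mFs : measurable_fun (sheet j) F.
  by have [] := measurable_cplxM mfs (measurable_twist j).
have Fpatch : F = F \_ (sheet j).
  apply/funext => x; rewrite patchE; case: ifPn => // /negP sx.
  by rewrite /F f0 ?mul0r// => -[/mem_set].
have mF : measurable_fun setT F by rewrite Fpatch; apply/(measurable_restrictT _ ms).
have mG : measurable_fun setT G.
  have mfT : measurable_cplx_on setT f by [].
  by have [] := measurable_cplxM mfT (mcm setT).
have iF : integ F.
  apply: (le_integ _ (integZ (K * (K + K)) iw)) => // x.
  rewrite (le_trans (ler_reC_cabs _))// cabsM mulrC -mulrA.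
  have [[sx _]|nS] := pselect (S x); first by rewrite ler_pM ?cabs_ge0 ?(cabs_twist sx).
  by rewrite f0// cabs0 mulr0 !mulr_ge0 ?addr_ge0 ?(K0 x) ?(ltW (w0 x)).
have iG : integ G.
  apply: (le_integ _ (integZ (K * (K + K)) iw)) => // x.
  by rewrite (le_trans (ler_reC_cabs _))// cabsM mulrC -mulrA ler_pM ?cabs_ge0.
(* The substitution [x = br j y] turns the pairing of [h] with [m] over [base] into that of [f] with
   [twist] over the sheet; [divC_conj] supplies the factor. *)
have FE : (\int[mu]_x (reC (h x * m x))%:E = \int[mu]_x (F x)%:E)%E.
  have mhm : measurable_fun setT (fun x => reC (h x * m x)).
    have mhT : measurable_cplx_on setT h by [].
    by have [] := measurable_cplxM mhT (mcm setT).
  transitivity (\int[mu]_(y in base) (F (br j y) / jac (br j y))%:E)%E.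
    apply: (integral_base bP); first exact/measurable_EFinP.
      apply/measurable_EFinP; apply: measurable_funM.
        exact: (measurable_br_comp bP mFs).
      apply: (measurableT_comp (@measurable_invr R)).
      exact: (measurable_br_comp bP (@measurable_jac _ _ _ _ _ _ _ _ _ _ bP j)).
    apply: filterS hE => y hy by_; have [sy Qy] := br_inv bP j by_.
    congr EFin; rewrite (hy by_) /F /twist Qy.
    have J0 := br_J0 bP sy.
    have j0 : jac (br j y) != 0 by rewrite expf_neq0// gt_eqF// cabs_gt0.
    apply: (mulIf j0); rewrite divfK//.
    have -> : f (br j y) * (m y * ((J (br j y))^* / J (br j y))) =
        ofreal (jac (br j y)) * (f (br j y) / J (br j y) ^+ 2 * m y).
      by rewrite [RHS]mulrA /= divC_conj// [LHS]mulrA mulrAC.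
    by rewrite [RHS]reCM /= mul0r subr0 mulrC.
  rewrite -(integral_sheet bP mFs) integral_mkcond; apply: eq_integral => x _.
  rewrite [in RHS]Fpatch !patchE; by case: ifP.
have int0 : \int[mu]_x (F x - G x) = 0.
  rewrite RintegralB// -[X in _ - X]/(\int[mu]_x reC (f x * m x)) -hI.
  by rewrite /Rintegral FE subrr.
have FGE x : F x - G x = if x \in S then cabs (nu x) ^+ 2 * w x else 0.
  rewrite /F /G -reCN -reCD -mulrBr -/(nu x) /f; case: ifP => _; last by rewrite mul0r.
  by rewrite /g mulrAC (mulrC _ (nu x)) mulC_conj -ofrealM.
have FG0 x : 0 <= F x - G x.
  by rewrite FGE; case: ifP => // _; rewrite mulr_ge0 ?exprn_ge0 ?cabs_ge0 ?(ltW (w0 x)).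
have iFG := integB iF iG.
have FGE0 : (\int[mu]_x `|(F x - G x)%:E| = 0)%E.
  under eq_integral => x _ do rewrite gee0_abs ?lee_fin//.
  rewrite -[LHS]fineK; last exact: (integrable_fin_num measurableT iFG).
  by congr EFin; exact: int0.
have /(ae_eq_integral_abs mu measurableT) := FGE0.
move=> /(_ (measurable_int _ iFG)); apply: filterS => x /(_ Logic.I) [] FG sx Ax.
move: FG; rewrite FGE mem_set// => /eqP; rewrite mulf_eq0 (gt_eqF (w0 x)) orbF.
by rewrite expf_eq0/= => /eqP/cabs_eq0/eqP; rewrite subr_eq0 => /eqP.
Qed.

Lemma transfer_invariant_density : {ae mu, forall x, A0 x ->
  m (Q x) * ((J x)^* / J x) = m x}.
Proof.
have s0 : {ae mu, forall x, (\bigcup_i sheet i) x} by exact: negligibleS (br_sheet0 bP).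
have all_j : {ae mu, forall x, forall j, sheet j x -> A0 x -> twist x = m x}.
  by apply: filter_forall; exact: twist_sheet.
by apply: filterS2 s0 all_j => x [j _ sx] /(_ j sx).
Qed.

End TransferInvariance.

(** * The Ruelle representation *)

Section BranchedSphere.
Context {R : realType} (Q : ratmap R) (sigma : set (sphere R)).
Variable D : 'I_(ratdeg Q) -> set (sphere R).
Local Notation C := (Cplx R).
Local Notation P := (measurableTypeR R * measurableTypeR R)%type.
Local Notation leb := (@lebesgue_measure R).
Hypotheses (deg : (0 < ratdeg Q)%N) (arc : analytic_arc sigma).
Hypotheses (crit : critical_values Q `<=` sigma) (sh : sheets D sigma).
Local Notation base := (base Q sigma).
Local Notation sheet := (sheet sigma D).
Local Notation branch := (branch D).

Lemma measurable_fun_sphere d' (T' : measurableType d') (X : set (sphere R))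
    (F : sphere R -> T') : measurable X ->
  measurable_fun (@plane_to_sphere R @^-1` X) (F \o @plane_to_sphere R) ->
  measurable_fun X F.
Proof. by move=> mX mF _ B mB; apply: mF. Qed.

Lemma cderiv_rat z : cderiv Q (Some z) = derive1 (ratC Q) z.
Proof.
rewrite /cderiv; have -> : (@affine R) \o Q \o Some = ratC Q.
  by apply/funext => z'; exact: affine_rat.
by [].
Qed.

Lemma measurable_base : measurable base.
Proof.
apply/measurable_plane_of_sphere; apply: plane_open_measurable.
exact: (c_open_plane (c_open_base (Q := Q) arc)).
Qed.

Lemma measurable_sheet i : measurable (sheet i).
Proof.
apply/measurable_plane_of_sphere; apply: plane_open_measurable.
exact: (c_open_plane (@c_open_sheet _ _ _ _ arc sh i)).
Qed.

(** A finite point is treated as a constant curve with parameter set [{0}]. *)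
Let negligible_fibre (G : set C) (psi : C -> C) (u : sphere R) :
  (forall z, G z -> exists k : nat, forall z1 z2,
     cabs (z1 - z) < k.+1%:R^-1 -> cabs (z2 - z) < k.+1%:R^-1 ->
     cabs (z1 - z2) <= k.+1%:R * cabs (psi z1 - psi z2)) ->
  (leb \x leb)%E.-negligible [set w : P | G (toC w) /\ Some (psi (toC w)) = u].
Proof.
case: u => [u|] Gpsi; last first.
  by apply: negligibleS (negligible_set0 _) => w [].
apply: negligibleS (@negligible_curve_preimage R (cst u) [set 0] psi G _ _ Gpsi).
- by move=> w [Gw [wu]]; split=> //; exists 0.
- by move=> _ ->; rewrite /= in_itv/= lexx ler01.
- by move=> t _; exists 0%N => t' _ _; rewrite subrr cabs0 mulr_ge0.
Qed.

Lemma negligible_baseC : (Leb R).-negligible (~` base).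
Proof.
apply: negligible_sphere.
have id_exp (z : C) : setT z -> exists k : nat, forall z1 z2 : C,
    cabs (z1 - z) < k.+1%:R^-1 -> cabs (z2 - z) < k.+1%:R^-1 ->
    cabs (z1 - z2) <= k.+1%:R * cabs (id z1 - id z2).
  by move=> _; exists 0%N => z1 z2 _ _; rewrite mul1r.
apply: negligibleS (negligibleU (negligible_arc_preimage arc id_exp)
  (negligible_fibre (Q None) id_exp)) => w nb.
have [s|ns] := pselect (sigma (Some (toC w))); first by left.
by right; split=> //; apply: contrapT => nQ; apply: nb.
Qed.

(** A finite point outside all sheets is a pole, a zero of the derivative, a point sent into the
    arc, or one sent to the image of infinity; each of these cases is null. *)
Lemma negligible_sheetC : (Leb R).-negligible (~` \bigcup_i sheet i).
Proof.
apply: negligible_sphere.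
pose G : set C := [set z | (rden Q).[z] != 0 /\ derive1 (ratC Q) z != 0].
have Gexp z : G z -> exists k : nat, forall z1 z2 : C,
    cabs (z1 - z) < k.+1%:R^-1 -> cabs (z2 - z) < k.+1%:R^-1 ->
    cabs (z1 - z2) <= k.+1%:R * cabs (ratC Q z1 - ratC Q z2).
  by move=> [d0 j0]; exact: ratC_expanding.
apply: negligibleS (negligibleU (negligible_irregular deg)
  (negligibleU (negligible_arc_preimage arc Gexp)
    (negligible_fibre (Q None) Gexp))) => w ns.
have [Gw|nG] := pselect (G (toC w)); last by left.
right; have [s|nsig] := pselect (sigma (Some (ratC Q (toC w)))); first by left.
right; split=> //; apply: contrapT => nQ; apply: ns.
have [d0 _] := Gw.
have [|i si] := @sheet_cover _ _ _ _ sh (Some (toC w)); last by exists i.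
by rewrite rat_finite.
Qed.

Lemma sheet_branched : branched (Leb R) Q (cderiv Q) base sheet branch.
Proof.
have cp i := conformal_sheet arc crit sh i.
have preimQ i B : toC @^-1` [set z | sheet i (Some z)] `&`
    (fun w => ofC (ratC Q (toC w))) @^-1` (@plane_to_sphere R @^-1` B) =
    @plane_to_sphere R @^-1` (sheet i `&` Q @^-1` B).
  apply/seteqP; split=> w [sw Bw]; split=> //=; move: Bw;
    by rewrite /= /plane_to_sphere -!/(toC _) ofCK rat_finite//; exact: (base_den sw.2).
have mQ i : measurable_fun (sheet i) Q.
  move=> _ B mB; apply/measurable_plane_of_sphere; rewrite -preimQ.
  exact: (cp_measurable_preimage (cp i) ((measurable_plane_of_sphere B).1 mB)).
have mJ i : measurable_fun (sheet i) (reC \o cderiv Q) /\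
    measurable_fun (sheet i) (imC \o cderiv Q).
  have [mr mi] := cp_measurable_deriv (cp i).
  split; apply: measurable_fun_sphere; try exact: measurable_sheet.
    by apply: eq_measurable_fun mr => w _; rewrite /= cderiv_rat.
  by apply: eq_measurable_fun mi => w _; rewrite /= cderiv_rat.
split=> //.
- exact: measurable_base.
- exact: measurable_sheet.
- exact: negligible_baseC.
- exact: negligible_sheetC.
- by move=> i j x [Di _] [Dj _]; exact: (sheet_disjoint sh Di Dj).
- by move=> i x [Di bx]; split=> //; exact: (branch_Q sh).
- by move=> i y /(sheet_branch sh i).
- move=> i; apply: measurable_fun_sphere; first exact: measurable_base.
  have mi := cp_measurable_inv (cp i).
  have mp := measurableT_comp (@measurable_plane_to_sphere R) mi.
  apply: eq_measurable_fun mp => w /set_mem bw.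
  rewrite /= {1}/plane_to_sphere -/(toC _) ofCK.
  by rewrite -(branchCE sh).
- move=> i [z|] sx; last by have := sheet_None sx.
  by rewrite cderiv_rat; exact: (cp_deriv_neq0 (cp i)).
- move=> i B mB.
  have ms := measurable_sheet i.
  have mSB : measurable (sheet i `&` Q @^-1` B) by exact: mQ.
  have mB' := (measurable_plane_of_sphere B).1 mB.
  rewrite LebE preimage_setI; have -> := plane_change_of_variables (cp i) mB'.
  have [mr mi] := mJ i.
  have mjac : measurable_fun (sheet i `&` Q @^-1` B) (fun z => (cabs (cderiv Q z) ^+ 2)%:E).
    apply/measurable_EFinP; apply: (measurable_funS ms (@subIsetl _ _ _)).
    rewrite (_ : (fun z => _) = fun z => (reC \o cderiv Q) z ^+ 2 + (imC \o cderiv Q) z ^+ 2).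
      by apply: measurable_funD; exact: measurable_funX.
    by apply/funext => z; rewrite cabs_sqr.
  have g0 z : (0 <= (cabs (cderiv Q z) ^+ 2)%:E)%E by rewrite lee_fin exprn_ge0 ?cabs_ge0.
  have -> := ge0_integral_Leb mSB mjac g0.
  rewrite /cp_measure preimQ; apply: eq_integral => w _.
  by rewrite cderiv_rat.
Qed.

End BranchedSphere.

(** * Deck transformations and their derivatives *)

Section DeckGroup.
Context {R : realType} (Q : ratmap R) (sigma : set (sphere R)).
Variable D : 'I_(ratdeg Q) -> set (sphere R).
Local Notation C := (Cplx R).
Hypotheses (deg : (0 < ratdeg Q)%N) (arc : analytic_arc sigma).
Hypotheses (crit : critical_values Q `<=` sigma) (sh : sheets D sigma).
Local Notation base := (base Q sigma).
Local Notation sheet := (sheet sigma D).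
Local Notation branch := (branch D).

Lemma sheet_swapP i j x : Q (sheet_swap D i j x) = Q x /\
  forall k, D k x -> D (tperm i j k) (sheet_swap D i j x).
Proof.
rewrite /sheet_swap; case: ifPn => [/set_mem Dix|/negP nDi].
  have [Db Qb] := branchK sh j (sheetsE sh Dix); split=> // k Dkx.
  by rewrite (sheet_disjoint sh Dkx Dix) tpermL.
case: ifPn => [/set_mem Djx|/negP nDj].
  have [Db Qb] := branchK sh i (sheetsE sh Djx); split=> // k Dkx.
  by rewrite (sheet_disjoint sh Dkx Djx) tpermR.
split=> // k Dkx; rewrite tpermD//.
  by apply: contra_not_neq nDi => ->; exact: mem_set.
by apply: contra_not_neq nDj => ->; exact: mem_set.
Qed.

(** Generators act on the sheets by transpositions; recording an injective map of all indices is
    what makes composition and inversion go through. *)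
Lemma deck_permutes g : deck_group D g -> (forall x, Q (g x) = Q x) /\
  exists2 p : 'I_(ratdeg Q) -> 'I_(ratdeg Q), injective p &
    forall i x, D i x -> D (p i) (g x).
Proof.
elim=> [|i j|f h _ [Qf [p pI pf]] _ [Qh [q qI qh]]|f h _ [Qf [p pI pf]] fh hf].
- by split=> //; exists id.
- split=> [x|]; first by have [] := sheet_swapP i j x.
  exists (tperm i j); first exact: perm_inj.
  by move=> k x Dkx; have [_] := sheet_swapP i j x; exact.
- split=> [x|]; first by rewrite /= Qf.
  exists (p \o q); first exact: inj_comp.
  by move=> k x /qh/pf.
- have Qh x : Q (h x) = Q x by rewrite -{2}(hf x) Qf.
  split=> //; exists (invF pI); first exact: can_inj (f_invF pI).
  (* For the inverse [h], the point [h x] lies in some sheet because [Q (h x) = Q x] avoids [sigma];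
     applying [f] shows that [p] sends the index of that sheet to [i]. *)
  move=> i x Dix; have [DE _ _] := sh.
  have : (Q @^-1` (~` sigma)) (h x) by rewrite /= Qh; exact: (sheetsE sh Dix).
  rewrite DE => -[k _ Dk]; have := pf _ _ Dk; rewrite hf => Dpk.
  by rewrite -(sheet_disjoint sh Dpk Dix) invF_f.
Qed.

Variables (g : sphere R -> sphere R) (p : 'I_(ratdeg Q) -> 'I_(ratdeg Q)).
Hypotheses (Qg : forall x, Q (g x) = Q x) (pg : forall i x, D i x -> D (p i) (g x)).

Lemma deck_sheet i x : sheet i x -> sheet (p i) (g x) /\ Q (g x) = Q x.
Proof. by move=> [Dx bx]; split=> //; split; [exact: pg|rewrite /= Qg]. Qed.

(* Differentiate [Q \o g = Q]. *)
Lemma cderiv_deck i x : sheet i x -> cderiv g x = cderiv Q x / cderiv Q (g x).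
Proof.
case: x => [w|] sw; last by have := sheet_None sw.
pose psi : C -> C := (@affine R) \o g \o Some.
have gE z : sheet i (Some z) -> g (Some z) = Some (psi z).
  move=> /deck_sheet[sg _]; rewrite /psi /=.
  by case: (g (Some z)) sg => // /sheet_None.
have spsi z : sheet i (Some z) -> sheet (p i) (Some (psi z)).
  by move=> sz; rewrite -gE//; have [] := deck_sheet sz.
have den z : sheet i (Some z) -> (rden Q).[z] != 0 by move=> [_ /base_den].
have denpsi z : sheet i (Some z) -> (rden Q).[psi z] != 0.
  by move=> /spsi[_ /base_den].
have rE z : sheet i (Some z) -> ratC Q (psi z) = ratC Q z.
  move=> sz; have := Qg (Some z); rewrite (gE _ sz) !rat_finite ?(den _ sz) ?(denpsi _ sz)//.
  by case.
have psiE z : sheet i (Some z) -> psi z = branchC D (p i) (ratC Q z).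
  move=> sz; have cp := conformal_sheet arc crit sh (p i).
  by have [_] := cp_map cp (spsi _ sz); rewrite rE.
have near_sheet : \forall z \near w, sheet i (Some z).
  by apply/nbhs_cabsP; exact: (c_open_sheet arc sh sw).
(* Near [w], [psi] is the inverse branch of index [p i] after [ratC], and both are continuous
   here. *)
have cpsi : psi z @[z --> w] --> psi w.
  apply: (@cvg_cabsP R C (nbhs w) (nbhs_filter w) psi (psi w)).2 => e e0.
  have cp := conformal_sheet arc crit sh (p i).
  have Urw : base (Some (ratC Q w)) by rewrite -rat_finite ?(den _ sw)//; have [] := sw.
  have [k k0 hk] := cp_inv_cont cp Urw e0.
  have [l l0 hl] := ratC_cont (den _ sw) k0.
  have : \forall z \near w, cabs (z - w) < l by apply/nbhs_cabsP; exists l.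
  apply: filterS2 near_sheet => z sz zl.
  rewrite !psiE//; apply: hk; last exact: hl.
  by rewrite /= -rat_finite ?(den _ sz)//; have [] := sz.
have [s [cs sE sd]] := rat_slope Q.
have J0 z i' : sheet i' (Some z) -> s (z, z) = cderiv Q (Some z) /\ s (z, z) != 0.
  move=> sz; have dz : (rden Q).[z] != 0 by have [_ /base_den] := sz.
  have sJ : s (z, z) = cderiv Q (Some z) by rewrite cderiv_rat sd (derive_ratC dz).2.
  by split=> //; rewrite sJ cderiv_rat (cp_deriv_neq0 (conformal_sheet arc crit sh i')).
have [sw1 _] := J0 _ _ sw; have [sp1 sp0] := J0 _ _ (spsi _ sw).
have c1 : s (z, w) @[z --> w] --> s (w, w).
  have h : (fun z : C => (z, w)) @ w --> (w, w).
    exact: (@cvg_pair C C C (nbhs w) (nbhs w) (nbhs w) _ _ _ id (cst w)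
      cvg_id (cvg_cst w)).
  exact: (continuous_comp h (cs w w (den _ sw) (den _ sw))).
have c2 : s (psi z, psi w) @[z --> w] --> s (psi w, psi w).
  have h : (fun z : C => (psi z, psi w)) @ w --> (psi w, psi w).
    exact: (@cvg_pair C C C (nbhs w) (nbhs (psi w)) (nbhs (psi w)) _ _ _ psi (cst (psi w))
      cpsi (cvg_cst (psi w))).
  exact: (continuous_comp h (cs (psi w) (psi w) (denpsi _ sw) (denpsi _ sw))).
have near0 : \forall z \near w, s (psi z, psi w) != 0.
  have /cvg_cabsP/(_ _ (cabs_gt0 sp0)) := c2.
  apply: filterS => z h; apply/eqP => sz.
  by move: h; rewrite sz sub0r cabsN ltxx.
(* Since [ratC \o psi = ratC] near [w], both [s (psi z, psi w) * (psi z - psi w)] and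
   [s (z, w) * (z - w)] equal [ratC Q z - ratC Q w]; so [phi] is a continuous slope of [psi]. *)
pose phi z := s (z, w) / s (psi z, psi w).
have phi_cont : {for w, continuous phi} by exact: (cvgM c1 (cvgV sp0 c2)).
have phi_slope : \forall z \near w, psi z - psi w = phi z * (z - w).
  apply: filterS2 near_sheet near0 => z sz s0; apply: (mulfI s0).
  rewrite -(sE _ _ (denpsi _ sz) (denpsi _ sw)) !rE// (sE _ _ (den _ sz) (den _ sw)).
  by rewrite /phi [RHS]mulrA; congr (_ * _); rewrite mulrCA mulfV// mulr1.
have [_ dpsi] := derive1_slope phi_cont erefl phi_slope.
by rewrite (gE _ sw) -sw1 -sp1; exact: dpsi.
Qed.

End DeckGroup.

(** * Uniform bound and absence of invariant functionals *)

Section RuelleRepresentation.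
Context {R : realType} (Q : ratmap R) (A sigma : set (sphere R)).
Variable D : 'I_(ratdeg Q) -> set (sphere R).
Local Notation C := (Cplx R).
Hypotheses (deg : (0 < ratdeg Q)%N) (arc : analytic_arc sigma).
Hypotheses (crit : critical_values Q `<=` sigma) (sh : sheets D sigma).
Local Notation base := (base Q sigma).
Local Notation sheet := (sheet sigma D).
Local Notation branch := (branch D).
Local Notation J := (cderiv Q).

Let bP := sheet_branched deg arc crit sh.

(** Over [base] the branches enumerate the fibre bijectively, so the finitely supported sum becomes
    a sum over indices. *)
Lemma ruelle_op_branches (f : sphere R -> C) y : base y ->
  ruelle_op Q f y = \sum_i f (branch i y) / J (branch i y) ^+ 2.
Proof.
move=> by_; rewrite [RHS]fsbig_seq ?index_enum_uniq//.
rewrite /ruelle_op (reindex_fsbig (fun i => branch i y) [set` index_enum _])//.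
split=> [i _|i j _ _ ij|x /= Qx].
- by have [] := br_inv bP i by_.
- have [si _] := br_inv bP i by_; have [sj _] := br_inv bP j by_.
  by apply: (br_disj bP si); rewrite ij.
- have [|i sx] := @sheet_cover _ _ _ _ sh x; first by rewrite Qx.
  exists i; first by rewrite /= mem_index_enum.
  by have [_] := br_map bP sx; rewrite Qx.
Qed.

Lemma cderiv_id (x : sphere R) : cderiv id x = 1.
Proof.
rewrite /cderiv (_ : _ \o Some = id); last by apply/funext.
by rewrite derive1E derive_id.
Qed.

Definition ratmap_class : aemap (Leb R) :=
  \pi_(aemap (Leb R)) (MkNsmap (branched_nonsingular bP)).

Lemma ratmap_classE : aerep ratmap_class = Q %[ae Leb R].
Proof.
have /eqmodP/asboolP h : repr ratmap_class = MkNsmap (branched_nonsingular bP)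
  %[mod aemap (Leb R)] by rewrite reprK.
exact: h.
Qed.

Let s0 : deck_semigroup D :=
  MkGen (generated_gen (ex_intro2 _ _ id (deck_id D) ratmap_classE)).

Variable rho : deck_semigroup D -> {linear L1space (Leb R) A -> L1space (Leb R) A}.
Hypothesis rhoP : ruelle_representation rho.

Lemma rho_ruelle f :
  {ae Leb R, forall y, base y -> L1rep (rho s0 f) y =
    \sum_i L1rep f (branch i y) / J (branch i y) ^+ 2}.
Proof.
have [_ /(_ id s0 (deck_id D) ratmap_classE f)] := rhoP.
apply: filterS => y /(_ Logic.I) fy by_; rewrite [LHS]fy /deck_act cderiv_id.
by rewrite expr1n mulr1 ruelle_op_branches.
Qed.

Let normE (f : L1space (Leb R) A) : `|f| = ofreal (fine (\int[Leb R]_x (cabs (L1rep f x))%:E)).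
Proof. by []. Qed.

Let norm_le (f h : L1space (Leb R) A) :
  (\int[Leb R]_x (cabs (L1rep h x))%:E <= \int[Leb R]_x (cabs (L1rep f x))%:E)%E -> `|h| <= `|f|.
Proof. by move=> fh; rewrite !normE ofreal_le -lee_fin !L1norm_fineK. Qed.

(** [rho s f] and [rho s0 f] have the same norm: they differ by the action of [g], whose factor has
    squared modulus [jac / (jac \o g)], the one of [permuting_isometry]. The class of [Q] itself
    contracts by [transfer_contraction]. *)
Lemma rho_generator_contraction g (s : deck_semigroup D) f : deck_group D g ->
  conjugate_class Q g (genval s) -> `|rho s f| <= `|f|.
Proof.
move=> dg cg; apply: norm_le.
have [Qg [p pI pg]] := deck_permutes sh dg.
have gP i x : sheet i x -> sheet (p i) (g x) /\ Q (g x) = Q x.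
  exact: (deck_sheet Qg pg).
have mrep (h : L1space (Leb R) A) : measurable_cplx (L1rep h) by have [] := L1repP h.
have h0f : (\int[Leb R]_x (cabs (L1rep (rho s0 f) x))%:E <= \int[Leb R]_x (cabs (L1rep f x))%:E)%E.
  exact: (transfer_contraction bP _ _ (rho_ruelle f)).
apply: le_trans h0f; rewrite le_eqVlt; apply/orP; left; apply/eqP.
have [_ rhoE] := rhoP.
have h0E := rhoE id s0 (deck_id D) ratmap_classE f.
have hE := rhoE g s dg cg f.
have h0gE : L1rep (rho s0 f) \o g = deck_act id (ruelle_op Q (L1rep f)) \o g %[ae Leb R].
  exact: (permuting_nonsingular bP gP h0E).
apply: (permuting_isometry bP pI gP).
- exact: measurable_cabs.
- exact: measurable_cabs.
- by move=> x; rewrite lee_fin cabs_ge0.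
- by move=> x; rewrite lee_fin cabs_ge0.
- move=> i; apply: filterS2 hE h0gE => x hx h0x sx.
  have -> : L1rep (rho s f) x = _ := hx Logic.I.
  have -> : L1rep (rho s0 f) (g x) = _ := h0x Logic.I.
  rewrite /deck_act /= cderiv_id expr1n mulr1 (cderiv_deck arc crit sh Qg pg sx).
  rewrite -EFinM cabsM cabsX; congr (_ * _)%:E.
  have [sgx _] := gP i x sx; have J0 := br_J0 bP sgx.
  have c0 : cabs (J (g x)) != 0 by rewrite gt_eqF// cabs_gt0.
  apply: (mulIf (expf_neq0 2 c0)).
  by rewrite divfK ?expf_neq0// -exprMn -cabsM divfK.
Qed.

Lemma rho_bounded : uniformly_bounded rho.
Proof.
have [[_ rhoM] _] := rhoP.
pose gens := [set c | exists2 g, deck_group D g & conjugate_class Q g c].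
(* Two membership proofs are quantified: the induction consumes the first, while [rho] is evaluated
   at the element built with the second. *)
suff contr c (gc : generated gens c) (gc' : generated gens c) f :
    `|rho (MkGen gc') f| <= `|f|.
  exists 1 => -[c gc] f; rewrite [ofreal 1]/(1 : C) mul1r.
  exact: (contr c gc gc f).
elim: gc gc' f => [x [g dg cg] gx f|x y gx ihx gy ihy gxy f].
  exact: (rho_generator_contraction _ dg).
have -> : MkGen gxy = (MkGen gx * MkGen gy : deck_semigroup D)%g.
  by congr MkGen; exact: Prop_irrelevance.
by rewrite rhoM (le_trans (ihx gx _))// (ihy gy).
Qed.

Hypothesis mA : lebesgue_measurable A.
Hypotheses (cA : completely_invariant Q A) (noA : ~ supports_beltrami Q A).

Lemma invariant_functional_eq0 (L : {linear L1space (Leb R) A -> C}) :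
  continuous L -> (forall f, L (rho s0 f) = L f) -> forall f, L f = 0.
Proof.
(* [A] is the union of a Borel set [A0] and a negligible set [N]. *)
move=> cL Linv; have [A0 mA0 [N N0 A0E]] := mA.
have AA0 : {ae Leb R, forall x, A x <-> A0 x}.
  apply: negligibleS N0 => x /= nx; apply: contrapT => nN; apply: nx.
  by rewrite -A0E; split=> [[]//|]; left.
have [m [mm [K mK] m0 Lm]] := @L1_dual_repr _ _ R (@Leb_sf R) A (@weight R) A0
  (@integrable_weight R) (@weight_gt0 R) mA0 AA0 L cL.
have mm' : measurable_cplx_on setT m by [].
have on_A0 : {ae Leb R, forall x, A0 x -> m (Q x) * ((J x)^* / J x) = m x}.
  apply: (transfer_invariant_density bP (@integrable_weight R) (@weight_gt0 R) mm mK mA0).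
  move=> j f mf [K' fK'] f0.
  have fL1 : L1_pred (Leb R) A f.
    split=> //.
    + apply: (@le_lt_trans _ _ (\int[Leb R]_x `|(K' * weight x)%:E|)%E); last first.
        by have /integrableP[] := integZ K' (@integrable_weight R).
      apply: ge0_le_integral => //.
      * by move=> x _; rewrite lee_fin cabs_ge0.
      * exact: measurable_cabs.
      * apply: measurableT_comp => //.
        exact: (measurable_int _ (integZ K' (@integrable_weight R))).
      * by move=> x _; rewrite lee_fin (le_trans (fK' x))// ler_norm.
    + apply: filterS AA0 => x AA0x nAx; apply: f0 => -[_ A0x].
      by apply: nAx; exact/AA0x.
  pose F : L1space (Leb R) A := toL1 (@Leb_sf R) A f.
  have fE : L1rep F = f %[ae Leb R] := @toL1E _ _ _ (@Leb_sf R) A _ fL1.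
  pose h := L1rep (rho s0 F).
  have mh : measurable_cplx h by have [] := L1repP (rho s0 F).
  exists h; split=> //.
    (* The representative of [F] agrees with [f] only almost everywhere; [branch_negligible] carries
       the exceptional set through the inverse branches. *)
    have fE' : {ae Leb R, forall y, forall i, base y ->
        L1rep F (branch i y) = f (branch i y)}.
      apply: filter_forall => i.
      apply: negligibleS (branch_negligible bP i fE) => y /= /not_implyP[by_ ne].
      by split=> // fy; apply: ne; exact: fy.
    apply: filterS2 (rho_ruelle F) fE' => y hy fy by_.
    rewrite [LHS]hy// (bigD1 j)//= big1 ?addr0 ?fy// => i ij.
    rewrite fy// f0 ?mul0r// => -[sj _]; have [si _] := br_inv bP i by_.
    by move/eqP: ij; apply; exact: (br_disj bP si sj).
  have <- := Lm (rho s0 F).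
  rewrite Linv Lm; congr fine; apply: ae_eq_integral => //.
  - have mF : measurable_cplx_on setT (L1rep F) by have [] := L1repP F.
    by apply/measurable_EFinP; have [] := measurable_cplxM mF mm'.
  - have mf' : measurable_cplx_on setT f by [].
    by apply/measurable_EFinP; have [] := measurable_cplxM mf' mm'.
  - by apply: filterS fE => x /(_ Logic.I) fx _; rewrite [L1rep _ x]fx.
have inv : invariant_beltrami Q m.
  split=> //; first by exists K; exact: aeW.
  (* Off [A0] both sides must vanish, so [Q x] has to be off [A0] as well. This is complete
     invariance of [A], transferred to [A0] because preimages of null sets under [Q] are null. *)
  have QAA0 : {ae Leb R, forall x, A (Q x) <-> A0 (Q x)}.
    exact: (branched_nonsingular bP AA0).
  have AQ : {ae Leb R, forall x, A0 (Q x) -> A0 x}.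
    have AQA : {ae Leb R, forall x, A (Q x) <-> A x} by exact: cA.
    by apply: filterS3 AQA AA0 QAA0 => x cAx AA0x QAA0x /QAA0x/cAx/AA0x.
  apply: filterS2 on_A0 AQ => x onA AQx.
  have [A0x|nA0x] := pselect (A0 x); first exact: onA.
  by rewrite (m0 x)// (m0 (Q x)) ?mul0r// => /AQx.
have m_eq0 : {ae Leb R, forall x, m x = 0}.
  apply: contrapT => mN0; apply: noA; exists m; split=> //.
  by apply: filterS AA0 => x AA0x nAx; apply: m0 => /AA0x.
have re0 f : reC (L f) = 0.
  have mf : measurable_cplx_on setT (L1rep f) by have [] := L1repP f.
  rewrite Lm -[RHS]/(fine 0) -(integral0 (Leb R) setT); congr fine.
  apply: ae_eq_integral => //.
    by apply/measurable_EFinP; have [] := measurable_cplxM mf mm'.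
  by apply: filterS m_eq0 => x mx _ /=; rewrite mx mulr0.
move=> f; apply: Cplx_eqP; first exact: re0.
(* The real part of [L (i f)] is minus the imaginary part of [L f]. *)
have := re0 ((Complex 0 1 : C) *: f).
by rewrite linearZ/= reCM/= mul0r add0r mul1r => /eqP; rewrite oppr_eq0 => /eqP.
Qed.

Lemma ruelle_left_amenable : left_amenable rho.
Proof.
have [rhoR _] := rhoP.
exact: (left_amenable_of_no_invariant rhoR rho_bounded invariant_functional_eq0).
Qed.

End RuelleRepresentation.

Theorem proposition39 (R : realType) (Q : ratmap R) (A sigma : set (sphere R))
    (D : 'I_(ratdeg Q) -> set (sphere R)) :
  (2 <= ratdeg Q)%N ->
  lebesgue_measurable A -> (0 < mu_ext (Leb R) A)%E -> completely_invariant Q A ->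
  ~ supports_beltrami Q A ->
  analytic_arc sigma -> critical_values Q `<=` sigma -> sheets D sigma ->
  forall rho : deck_semigroup D ->
      {linear L1space (Leb R) A -> L1space (Leb R) A},
    ruelle_representation rho -> left_amenable rho.
Proof.
move=> deg mA _ cA noA arc crit sh rho rhoP.
exact: (ruelle_left_amenable (ltnW deg) arc crit sh rhoP mA cA noA).
Qed.
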